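(* Let $N\ge2$. There exist pairs of analytic maps $\Phi_1,\Phi_2\colon\mathbb{D}^N\to\mathbb{D}^N$ with $\Phi_1(\mathbb{D}^N)=\Phi_2(\mathbb{D}^N)$ realizing each of the following four situations (for composition operators on $H^2(\mathbb{D}^N)$): (1) $C_{\Phi_1}$ is not bounded, while $C_{\Phi_2}$ is compact with $\beta_N(C_{\Phi_2})=0$; (2) $C_{\Phi_1}$ is bounded but not compact (so $\beta_N(C_{\Phi_1})=1$), while $C_{\Phi_2}$ is compact with $\beta_N(C_{\Phi_2})=0$; (3) $C_{\Phi_1}$ is compact with $\beta_N^-(C_{\Phi_1})>0$ and $\beta_N^+(C_{\Phi_1})<1$, while $C_{\Phi_2}$ is compact with $\beta_N(C_{\Phi_2})=0$; (4) $C_{\Phi_1}$ is compact with $\beta_N(C_{\Phi_1})=1$, while $C_{\Phi_2}$ is compact with $\beta_N(C_{\Phi_2})=0$.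
   Context: $H^2(\mathbb{D}^N)$ is the Hardy space of the polydisk: analytic $f=\sum_{\alpha\in\mathbb{N}^N}a_\alpha z^\alpha$ with $\|f\|^2=\sum_\alpha|a_\alpha|^2<\infty$; $C_\Phi f=f\circ\Phi$. The approximation numbers are $a_n(T)=\inf\{\|T-R\|:\operatorname{rank}R<n\}$. For an operator $T$, $\beta_N^-(T)=\liminf_{n\to\infty}[a_n(T)]^{1/n^{1/N}}$, $\beta_N^+(T)=\limsup_{n\to\infty}[a_n(T)]^{1/n^{1/N}}$, and $\beta_N(T)$ denotes their common value when they coincide. *)

(* Defs.v *)
From Stdlib Require Import Reals Lra List ClassicalEpsilon.
Import ListNotations.
Open Scope R_scope.

Definition C := (R * R)%type.
Definition C0 : C := (0, 0).
Definition C1 : C := (1, 0).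
Definition Cadd (z w : C) : C := (fst z + fst w, snd z + snd w).
Definition Csub (z w : C) : C := (fst z - fst w, snd z - snd w).
Definition Cmul (z w : C) : C :=
  (fst z * fst w - snd z * snd w, fst z * snd w + snd z * fst w).
Fixpoint Cpow (z : C) (k : nat) : C :=
  match k with O => C1 | S k' => Cmul z (Cpow z k') end.
Definition Cmod (z : C) : R := sqrt (fst z * fst z + snd z * snd z).

(* A multi-index alpha in N^N is a list of naturals of length N;
   a point of C^N is a list of complex numbers of length N. *)
Fixpoint mono (z : list C) (alpha : list nat) : C :=
  match z, alpha with
  | c :: z', k :: a' => Cmul (Cpow c k) (mono z' a')
  | _, _ => C1
  end.

Fixpoint box (N n : nat) : list (list nat) :=
  match N with
  | O => [[]]
  | S N' => flat_map (fun k => map (cons k) (box N' n)) (seq 0 (S n))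
  end.

Definition csum (l : list (list nat)) (c : list nat -> C) : C :=
  fold_right (fun a s => Cadd (c a) s) C0 l.
Definition rsum (l : list (list nat)) (u : list nat -> R) : R :=
  fold_right (fun a s => u a + s) 0 l.

Definition abs_conv (N : nat) (c : list nat -> C) : Prop :=
  exists M, forall n, rsum (box N n) (fun a => Cmod (c a)) <= M.

Definition series_val (N : nat) (c : list nat -> C) (v : C) : Prop :=
  Un_cv (fun n => fst (csum (box N n) c)) (fst v) /\
  Un_cv (fun n => snd (csum (box N n) c)) (snd v).

Definition inD (N : nat) (z : list C) : Prop :=
  length z = N /\ Forall (fun c => Cmod c < 1) z.

Definition vsub (z w : list C) : list C :=
  map (fun p => Csub (fst p) (snd p)) (combine z w).

Definition analytic_on_D (N : nat) (F : list C -> C) : Prop :=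
  forall w, inD N w ->
    exists r, 0 < r /\ exists c : list nat -> C,
      forall z, inD N z ->
        (forall i, (i < N)%nat -> Cmod (Csub (nth i z C0) (nth i w C0)) < r) ->
        abs_conv N (fun a => Cmul (c a) (mono (vsub z w) a)) /\
        series_val N (fun a => Cmul (c a) (mono (vsub z w) a)) (F z).

Definition analytic_self_map (N : nat) (Phi : list C -> list C) : Prop :=
  (forall z, inD N z -> inD N (Phi z)) /\
  (forall j, (j < N)%nat -> analytic_on_D N (fun z => nth j (Phi z) C0)).

Definition same_image (N : nat) (Phi1 Phi2 : list C -> list C) : Prop :=
  forall y, (exists z, inD N z /\ Phi1 z = y) <-> (exists z, inD N z /\ Phi2 z = y).

(* elements are coefficient families (only multi-indices of length N matter) *)
Definition coeffs := list nat -> C.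

Definition Csq (z : C) : R := fst z * fst z + snd z * snd z.

Definition inH2 (N : nat) (f : coeffs) : Prop :=
  exists M, forall n, rsum (box N n) (fun a => Csq (f a)) <= M.

Definition H2sqnorm (N : nat) (f : coeffs) : R :=
  epsilon (inhabits 0)
    (fun S => is_lub (fun x => exists n, x = rsum (box N n) (fun a => Csq (f a))) S).
Definition H2norm (N : nat) (f : coeffs) : R := sqrt (H2sqnorm N f).

Definition H2val (N : nat) (f : coeffs) (z : list C) : C :=
  epsilon (inhabits C0) (fun v => series_val N (fun a => Cmul (f a) (mono z a)) v).

Definition fadd (f g : coeffs) : coeffs := fun a => Cadd (f a) (g a).
Definition fsub (f g : coeffs) : coeffs := fun a => Csub (f a) (g a).
Definition fscal (l : C) (f : coeffs) : coeffs := fun a => Cmul l (f a).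

Definition Op := coeffs -> coeffs.

Definition linear_op (N : nat) (T : Op) : Prop :=
  (forall f g, inH2 N f -> inH2 N g -> forall a, length a = N ->
      T (fadd f g) a = fadd (T f) (T g) a) /\
  (forall l f, inH2 N f -> forall a, length a = N ->
      T (fscal l f) a = fscal l (T f) a).

Definition bounded_op (N : nat) (T : Op) : Prop :=
  (forall f, inH2 N f -> inH2 N (T f)) /\ linear_op N T /\
  exists M, forall f, inH2 N f -> H2norm N (T f) <= M * H2norm N f.

Fixpoint lincomb (ls : list C) (es : list coeffs) : coeffs :=
  match ls, es with
  | l :: ls', e :: es' => fadd (fscal l e) (lincomb ls' es')
  | _, _ => fun _ => C0
  end.

Definition rank_lt (N : nat) (Rop : Op) (n : nat) : Prop :=
  exists es : list coeffs, (length es < n)%nat /\ Forall (inH2 N) es /\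
    forall f, inH2 N f -> exists ls : list C, length ls = length es /\
      forall a, length a = N -> Rop f a = lincomb ls es a.

Definition is_glb (E : R -> Prop) (m : R) : Prop :=
  (forall x, E x -> m <= x) /\ (forall b, (forall x, E x -> b <= x) -> b <= m).

Definition approx_num (N : nat) (T : Op) (n : nat) : R :=
  epsilon (inhabits 0) (is_glb (fun t =>
    exists Rop, bounded_op N Rop /\ rank_lt N Rop n /\
      forall f, inH2 N f -> H2norm N (fsub (T f) (Rop f)) <= t * H2norm N f)).

Definition compact_op (N : nat) (T : Op) : Prop :=
  bounded_op N T /\
  forall fs : nat -> coeffs, (forall k, inH2 N (fs k)) ->
    (exists M, forall k, H2norm N (fs k) <= M) ->
    exists phi : nat -> nat, (forall k, (phi k < phi (S k))%nat) /\
      exists g, inH2 N g /\ Un_cv (fun k => H2norm N (fsub (T (fs (phi k))) g)) 0.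

Definition comp_rel (N : nat) (Phi : list C -> list C) (f g : coeffs) : Prop :=
  inH2 N g /\ forall z, inD N z -> H2val N g z = H2val N f (Phi z).

Definition comp_fun (N : nat) (Phi : list C -> list C) : Op :=
  fun f => epsilon (inhabits (fun _ => C0)) (comp_rel N Phi f).

Definition comp_welldef (N : nat) (Phi : list C -> list C) : Prop :=
  forall f, inH2 N f -> exists g, comp_rel N Phi f g.

Definition comp_bounded (N : nat) (Phi : list C -> list C) : Prop :=
  comp_welldef N Phi /\ bounded_op N (comp_fun N Phi).
Definition comp_compact (N : nat) (Phi : list C -> list C) : Prop :=
  comp_welldef N Phi /\ compact_op N (comp_fun N Phi).

Definition rpow (a x : R) : R := if Rlt_dec 0 a then Rpower a x else 0.

Definition beta_seq (N : nat) (T : Op) (k : nat) : R :=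
  rpow (approx_num N T (S k)) (1 / Rpower (INR (S k)) (1 / INR N)).

Definition is_liminf (u : nat -> R) (L : R) : Prop :=
  forall eps, 0 < eps ->
    (exists K, forall k, (K <= k)%nat -> L - eps < u k) /\
    (forall K, exists k, (K <= k)%nat /\ u k < L + eps).
Definition is_limsup (u : nat -> R) (L : R) : Prop :=
  forall eps, 0 < eps ->
    (exists K, forall k, (K <= k)%nat -> u k < L + eps) /\
    (forall K, exists k, (K <= k)%nat /\ L - eps < u k).

Definition beta_minus_pos (N : nat) (T : Op) : Prop :=
  exists L, is_liminf (beta_seq N T) L /\ 0 < L.
Definition beta_plus_lt1 (N : nat) (T : Op) : Prop :=
  exists L, is_limsup (beta_seq N T) L /\ L < 1.
Definition beta_eq (N : nat) (T : Op) (c : R) : Prop :=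
  is_liminf (beta_seq N T) c /\ is_limsup (beta_seq N T) c.

(* Main.v *)
(* With y = z_2 psi(z_1) and psi(z) = sum_i p_i z^i for a probability sequence p, the maps
   (y, 0, ..., 0) and (y, y, 0, ..., 0) have an image that does not depend on p, because psi(r)
   tends to 1 as r tends to 1.  The powers y^k = z_2^k psi(z_1)^k are pairwise orthogonal, so the
   singular values of f |-> f(y, 0, ..., 0) are the norms of the psi^k; on (y, y, 0, ..., 0) they
   are multiplied by at most sqrt(k + 1), a factor that is attained.  By positivity of p the norm of
   psi^k is a collision probability: ||psi^k||^2 = P(S = S') for two independent sums of k
   variables of law p.  A tail P(X >= i) = (1 + ln(1 + i))^(-e) makes it decay like exp(-c k^s)
   with s = 1 / (1 + e).  For Phi_2 we take e = 1/2, so that s = 2/3 > 1/N; for Phi_1 we take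
   psi = 1 in (1), with (y, y, 0, ..., 0), and in (2), e = N - 1, so that s = 1/N, in (3), and
   e = N in (4). *)

From Stdlib Require Import Reals Lra Lia List Arith Classical ClassicalEpsilon FunctionalExtensionality.
From Coquelicot Require Rcomplements Lim_seq Complex.
Require Import Defs.
Import ListNotations.
Open Scope R_scope.

(** * Finite sums and limits of real sequences *)

(** The exponent s comes from a balance at a cut exp X. All k variables stay below the cut with
    probability about exp(- k X^(-e)), while beyond it the law has coefficients at most e / exp X.
    Both effects are of order exp(- X) when k X^(-e) = X, that is X = k^(1 / (1 + e)). For the upper
    estimate this bounds the largest coefficient of psi^k; for the lower one, on the event that all
    variables stay below the cut, the sum takes about k exp X values at most, and Cauchy-Schwarz
    forces collisions. No singular value decomposition is invoked. Approximation numbers are bounded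
    above by cutting the operator at a level, and below by a combination of monomials that an
    operator of small rank must kill. The other obstacle is that the composition operator is a
    choice among functions with prescribed values. Identifying it with an explicit operator on
    coefficients rests on uniqueness of power series coefficients and on exchanges of limits, all
    obtained by dominated convergence. *)

Lemma sum_ext (u v : nat -> R) (n : nat) :
  (forall i, (i <= n)%nat -> u i = v i) -> sum_f_R0 u n = sum_f_R0 v n.
Proof. intros H; apply sum_eq; auto. Qed.

Lemma sum_const0 (n : nat) : sum_f_R0 (fun _ => 0) n = 0.
Proof. induction n as [|n IH]; simpl; lra. Qed.

Lemma sum_zero (u : nat -> R) (n : nat) :
  (forall i, (i <= n)%nat -> u i = 0) -> sum_f_R0 u n = 0.
Proof. intros H; rewrite (sum_ext u (fun _ => 0)); auto using sum_const0. Qed.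

Lemma sum_nonneg (u : nat -> R) (n : nat) :
  (forall i, (i <= n)%nat -> 0 <= u i) -> 0 <= sum_f_R0 u n.
Proof.
  intros H; rewrite <- (sum_const0 n); apply sum_Rle; auto.
Qed.

Lemma sum_scal (c : R) (u : nat -> R) (n : nat) :
  sum_f_R0 (fun i => c * u i) n = c * sum_f_R0 u n.
Proof. induction n as [|n IH]; simpl; rewrite ?IH; ring. Qed.

Lemma sum_mono (u : nat -> R) (m n : nat) :
  (forall i, 0 <= u i) -> (m <= n)%nat -> sum_f_R0 u m <= sum_f_R0 u n.
Proof.
  intros H L; induction L as [|n L IH]; simpl; [lra|]. specialize (H (S n)); lra.
Qed.

Lemma sum_term (u : nat -> R) (k n : nat) :
  (forall i, 0 <= u i) -> (k <= n)%nat -> u k <= sum_f_R0 u n.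
Proof.
  intros H L. apply Rle_trans with (sum_f_R0 u k); [|apply sum_mono; auto].
  destruct k; simpl; [lra|].
  assert (0 <= sum_f_R0 u k) by (apply sum_nonneg; auto). lra.
Qed.

Lemma sum_single (u : nat -> R) (k n : nat) :
  (k <= n)%nat -> (forall i, i <> k -> u i = 0) -> sum_f_R0 u n = u k.
Proof.
  intros L H. induction L as [|n L IH].
  - destruct k; simpl; [reflexivity|].
    rewrite sum_zero; [lra|]. intros i Hi; apply H; lia.
  - simpl. rewrite IH, (H (S n)); [lra|lia].
Qed.

Lemma sum_two (u : nat -> R) (n : nat) :
  (1 <= n)%nat -> (forall i, (2 <= i)%nat -> u i = 0) -> sum_f_R0 u n = u 0%nat + u 1%nat.
Proof.
  intros L H. induction L as [|n L IH]; simpl; [reflexivity|].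
  rewrite IH, (H (S n)); [lra|lia].
Qed.

Lemma sum_switch (u : nat -> nat -> R) (n m : nat) :
  sum_f_R0 (fun i => sum_f_R0 (fun j => u i j) m) n =
  sum_f_R0 (fun j => sum_f_R0 (fun i => u i j) n) m.
Proof.
  induction n as [|n IH]; simpl; [reflexivity|].
  rewrite IH, <- plus_sum; reflexivity.
Qed.

(** The combinatorial core of the Cauchy products: pairs of sum at most n, by antidiagonals and by
    rows. *)
Lemma sum_triangle (u : nat -> nat -> R) (n : nat) :
  sum_f_R0 (fun k => sum_f_R0 (fun j => u j (k - j)%nat) k) n =
  sum_f_R0 (fun j => sum_f_R0 (u j) (n - j)) n.
Proof.
  induction n as [|n IH]; [reflexivity|].
  change (sum_f_R0 (fun k => sum_f_R0 (fun j => u j (k - j)%nat) k) (S n))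
    with (sum_f_R0 (fun k => sum_f_R0 (fun j => u j (k - j)%nat) k) n +
          (sum_f_R0 (fun j => u j (S n - j)%nat) n + u (S n) (S n - S n)%nat)).
  change (sum_f_R0 (fun j => sum_f_R0 (u j) (S n - j)) (S n))
    with (sum_f_R0 (fun j => sum_f_R0 (u j) (S n - j)) n + sum_f_R0 (u (S n)) (S n - S n)).
  rewrite IH, <- Rplus_assoc, <- plus_sum, Nat.sub_diag. f_equal.
  apply sum_ext; intros j Hj.
  replace (S n - j)%nat with (S (n - j)) by lia. reflexivity.
Qed.

Lemma sum_geom_le (x : R) (n : nat) : 0 <= x < 1 -> sum_f_R0 (fun i => x ^ i) n <= / (1 - x).
Proof.
  intros H. rewrite tech3 by lra. unfold Rdiv.
  rewrite <- (Rmult_1_l (/ (1 - x))) at 2. apply Rmult_le_compat_r.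
  - left; apply Rinv_0_lt_compat; lra.
  - assert (0 <= x ^ S n) by (apply pow_le; lra). lra.
Qed.

Lemma Un_cv_const (c : R) : Un_cv (fun _ => c) c.
Proof.
  intros e He; exists 0%nat; intros n _. unfold Rdist. rewrite Rminus_diag, Rabs_R0; exact He.
Qed.

Lemma Un_cv_ext_ev (u v : nat -> R) (l : R) (n0 : nat) :
  (forall n, (n0 <= n)%nat -> u n = v n) -> Un_cv u l -> Un_cv v l.
Proof.
  intros E H e He. destruct (H e He) as [M HM]. exists (max n0 M); intros n Hn.
  rewrite <- E by lia. apply HM; lia.
Qed.

Lemma Un_cv_squeeze0 (u v : nat -> R) :
  (forall n, 0 <= u n <= v n) -> Un_cv v 0 -> Un_cv u 0.
Proof.
  intros E H e He. destruct (H e He) as [M HM]. exists M; intros n Hn.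
  specialize (HM n Hn). specialize (E n). unfold Rdist in *.
  rewrite Rminus_0_r in *. rewrite Rabs_right in * by lra. lra.
Qed.

Lemma Un_cv_le (u : nat -> R) (l M : R) : (forall n, u n <= M) -> Un_cv u l -> l <= M.
Proof. intros H C. exact (Rle_cv_lim H C (Un_cv_const M)). Qed.

Lemma Un_cv_scal0 (c : R) (u : nat -> R) : Un_cv u 0 -> Un_cv (fun n => c * u n) 0.
Proof.
  intros H. replace 0 with (c * 0) by ring. apply CV_mult; auto using Un_cv_const.
Qed.

Lemma Un_cv_sum (x : nat -> nat -> R) (l : nat -> R) (m : nat) :
  (forall j, Un_cv (fun n => x n j) (l j)) ->
  Un_cv (fun n => sum_f_R0 (x n) m) (sum_f_R0 l m).
Proof.
  intros H; induction m as [|m IH]; simpl; [apply H|].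
  apply (CV_plus (fun n => sum_f_R0 (x n) m) (fun n => x n (S m))); auto.
Qed.

Lemma nonneg_bounded_sums_cv (u : nat -> R) (M : R) :
  (forall i, 0 <= u i) -> (forall n, sum_f_R0 u n <= M) ->
  exists l, Un_cv (sum_f_R0 u) l /\ forall n, sum_f_R0 u n <= l.
Proof.
  intros P B. assert (G : Un_growing (sum_f_R0 u)).
  { intros n; simpl; specialize (P (S n)); lra. }
  destruct (growing_cv (sum_f_R0 u)) as [l Hl].
  - exact G.
  - exists M; intros x [n ->]; apply B.
  - exists l; split; [exact Hl|]. intros n; apply (growing_ineq _ _ G Hl).
Qed.

(** Dominated convergence for series: beyond a fixed J the dominating tail is below e / 2, and the
    terms up to J tend to 0. The bound is uniform in the truncation m, so it survives a later
    passage to the limit in m. *)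
Lemma tannery (x : nat -> nat -> R) (v : nat -> R) (M : R) :
  (forall n j, 0 <= x n j <= v j) -> (forall n, sum_f_R0 v n <= M) ->
  (forall j, Un_cv (fun n => x n j) 0) ->
  forall e, 0 < e -> exists n0, forall n, (n0 <= n)%nat -> forall m, sum_f_R0 (x n) m <= e.
Proof.
  intros D B C e He.
  assert (V0 : forall j, 0 <= v j) by (intros j; specialize (D 0%nat j); lra).
  destruct (nonneg_bounded_sums_cv v M V0 B) as [V [HV HVl]].
  destruct (HV (e / 2)) as [J HJ]; [lra|].
  specialize (HJ J (Nat.le_refl _)). unfold Rdist in HJ.
  assert (HJ' : V - sum_f_R0 v J < e / 2).
  { specialize (HVl J). rewrite Rabs_left1 in HJ; lra. }
  destruct (Un_cv_sum x (fun _ => 0) J C (e / 2)) as [n0 Hn0]; [lra|].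
  exists n0; intros n Hn m. specialize (Hn0 n Hn). unfold Rdist in Hn0.
  rewrite sum_const0, Rminus_0_r in Hn0.
  assert (HXJ : sum_f_R0 (x n) J < e / 2).
  { eapply Rle_lt_trans; [apply Rle_abs|exact Hn0]. }
  assert (P : forall j, 0 <= x n j) by (intros j; apply D).
  destruct (le_lt_dec m J) as [L|L].
  - pose proof (sum_mono (x n) m J P L). lra.
  - assert (K : sum_f_R0 (x n) m - sum_f_R0 (x n) J <= sum_f_R0 v m - sum_f_R0 v J).
    { apply Nat.lt_le_incl in L. induction L as [|m L IH]; [lra|]. simpl.
      specialize (D n (S m)); lra. }
    specialize (HVl m). lra.
Qed.

Lemma tannery_diag (x : nat -> nat -> R) (v : nat -> R) (M : R) :
  (forall n j, 0 <= x n j <= v j) -> (forall n, sum_f_R0 v n <= M) ->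
  (forall j, Un_cv (fun n => x n j) 0) ->
  Un_cv (fun n => sum_f_R0 (x n) n) 0.
Proof.
  intros D B C e He.
  destruct (tannery x v M D B C (e / 2)) as [n0 H]; [lra|].
  exists n0; intros n Hn. specialize (H n Hn n).
  assert (0 <= sum_f_R0 (x n) n) by (apply sum_nonneg; intros; apply D).
  unfold Rdist. rewrite Rminus_0_r, Rabs_right; lra.
Qed.

(** * Complex numbers *)

Definition RtoC (x : R) : C := (x, 0).

Lemma C_eq (z w : C) : fst z = fst w -> snd z = snd w -> z = w.
Proof. destruct z, w; simpl; congruence. Qed.

Definition Copp (z : C) : C := (- fst z, - snd z).
Lemma C_ring : ring_theory C0 C1 Cadd Cmul Csub Copp eq.
Proof.
  constructor; intros; apply C_eq; unfold Cadd, Cmul, Csub, Copp, C0, C1; simpl; ring.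
Qed.
Add Ring C_ring : C_ring.

Definition Cinv (z : C) : C := (fst z / Csq z, - snd z / Csq z).

Lemma Csq_pos (z : C) : z <> C0 -> 0 < Csq z.
Proof.
  intros H. unfold Csq. destruct z as [x y]; simpl.
  destruct (Req_dec x 0) as [->|Hx].
  - destruct (Req_dec y 0) as [->|Hy]; [now elim H|nra].
  - nra.
Qed.

Lemma Cmul_inv (z : C) : z <> C0 -> Cmul z (Cinv z) = C1.
Proof.
  intros H. apply Csq_pos in H. apply C_eq; unfold Cmul, Cinv, C1, Csq in *; simpl; field; lra.
Qed.

Lemma Csq_nonneg (z : C) : 0 <= Csq z.
Proof. unfold Csq; nra. Qed.

Lemma Csq_mul (z w : C) : Csq (Cmul z w) = Csq z * Csq w.
Proof. unfold Csq, Cmul; simpl; ring. Qed.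

Lemma Csq_RtoC (x : R) : Csq (RtoC x) = x * x.
Proof. unfold Csq, RtoC; simpl; ring. Qed.

Lemma Csq_add_le (z w : C) : Csq (Cadd z w) <= 2 * Csq z + 2 * Csq w.
Proof.
  unfold Csq, Cadd; simpl.
  pose proof (Rle_0_sqr (fst z - fst w)); pose proof (Rle_0_sqr (snd z - snd w)).
  unfold Rsqr in *; nra.
Qed.

Lemma Csq_sub_le (z w : C) : Csq (Csub z w) <= 2 * Csq z + 2 * Csq w.
Proof.
  unfold Csq, Csub; simpl.
  pose proof (Rle_0_sqr (fst z + fst w)); pose proof (Rle_0_sqr (snd z + snd w)).
  unfold Rsqr in *; nra.
Qed.

Lemma Cmod_Csq (z : C) : Cmod z = sqrt (Csq z).
Proof. reflexivity. Qed.

Lemma Cmod_sq (z : C) : Cmod z * Cmod z = Csq z.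
Proof. rewrite Cmod_Csq; apply sqrt_sqrt, Csq_nonneg. Qed.

Lemma Cmod_nonneg (z : C) : 0 <= Cmod z.
Proof. apply sqrt_pos. Qed.

Lemma Cmod_mul (z w : C) : Cmod (Cmul z w) = Cmod z * Cmod w.
Proof. rewrite !Cmod_Csq, Csq_mul. apply sqrt_mult; apply Csq_nonneg. Qed.

Lemma Cmod_complex (z : C) : Cmod z = Complex.Cmod z.
Proof. unfold Cmod, Complex.Cmod. f_equal; ring. Qed.

Lemma Cmod_add (z w : C) : Cmod (Cadd z w) <= Cmod z + Cmod w.
Proof. rewrite !Cmod_complex. apply Complex.Cmod_triangle. Qed.

Lemma Cmod_RtoC (x : R) : Cmod (RtoC x) = Rabs x.
Proof. rewrite Cmod_Csq, Csq_RtoC. apply sqrt_Rsqr_abs. Qed.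

Lemma Cmod_RtoC_nonneg (x : R) : 0 <= x -> Cmod (RtoC x) = x.
Proof. intros H; rewrite Cmod_RtoC, Rabs_right; lra. Qed.

Lemma Cmod_C0 : Cmod C0 = 0.
Proof. change C0 with (RtoC 0). apply Cmod_RtoC_nonneg; lra. Qed.

Lemma Cmod_C1 : Cmod C1 = 1.
Proof. change C1 with (RtoC 1). apply Cmod_RtoC_nonneg; lra. Qed.

Lemma Cmod_sub (z w : C) : Cmod (Csub z w) <= Cmod z + Cmod w.
Proof.
  replace (Csub z w) with (Cadd z (Cmul (RtoC (-1)) w))
    by (apply C_eq; unfold Csub, Cadd, Cmul, RtoC; simpl; ring).
  eapply Rle_trans; [apply Cmod_add|]. rewrite Cmod_mul, Cmod_RtoC.
  rewrite Rabs_left; lra.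
Qed.

Lemma Cmod_sub_sym (z w : C) : Cmod (Csub z w) = Cmod (Csub w z).
Proof. rewrite !Cmod_Csq; f_equal; unfold Csq, Csub; simpl; ring. Qed.

Lemma Cmod_fst (z : C) : Rabs (fst z) <= Cmod z.
Proof.
  rewrite <- sqrt_Rsqr_abs. apply sqrt_le_1_alt. unfold Rsqr. nra.
Qed.

Lemma Cmod_snd (z : C) : Rabs (snd z) <= Cmod z.
Proof.
  rewrite <- sqrt_Rsqr_abs. apply sqrt_le_1_alt. unfold Rsqr. nra.
Qed.

Lemma Cmod_le_parts (z : C) : Cmod z <= Rabs (fst z) + Rabs (snd z).
Proof.
  assert (0 <= Rabs (fst z)) by apply Rabs_pos. assert (0 <= Rabs (snd z)) by apply Rabs_pos.
  apply Rsqr_incr_0; [|apply Cmod_nonneg|lra].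
  unfold Rsqr at 1; rewrite Cmod_sq. unfold Csq, Rsqr.
  assert (Rabs (fst z) * Rabs (fst z) = fst z * fst z) by (rewrite <- Rabs_mult, Rabs_right; nra).
  assert (Rabs (snd z) * Rabs (snd z) = snd z * snd z) by (rewrite <- Rabs_mult, Rabs_right; nra).
  nra.
Qed.

Lemma Cmod_pow (z : C) (k : nat) : Cmod (Cpow z k) = Cmod z ^ k.
Proof. induction k as [|k IH]; simpl; [apply Cmod_C1|now rewrite Cmod_mul, IH]. Qed.

Lemma Cpow_RtoC (x : R) (k : nat) : Cpow (RtoC x) k = RtoC (x ^ k).
Proof.
  induction k as [|k IH]; simpl; [reflexivity|]. rewrite IH.
  apply C_eq; unfold Cmul, RtoC; simpl; ring.
Qed.

Lemma Cpow_add (z : C) (j k : nat) : Cpow z (j + k) = Cmul (Cpow z j) (Cpow z k).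
Proof. induction j as [|j IH]; simpl; [ring|rewrite IH; ring]. Qed.

Lemma Cpow_mul (z w : C) (k : nat) : Cpow (Cmul z w) k = Cmul (Cpow z k) (Cpow w k).
Proof. induction k as [|k IH]; simpl; [ring|rewrite IH; ring]. Qed.

Lemma Cpow_C0 (k : nat) : Cpow C0 (S k) = C0.
Proof. simpl; ring. Qed.

(** * Finite sums, limits and series of complex numbers *)

Fixpoint Csum (u : nat -> C) (n : nat) : C :=
  match n with O => u O | S n' => Cadd (Csum u n') (u n) end.

Lemma Csum_parts (u : nat -> C) (n : nat) :
  Csum u n = (sum_f_R0 (fun i => fst (u i)) n, sum_f_R0 (fun i => snd (u i)) n).
Proof.
  induction n as [|n IH]; simpl; [now destruct (u 0%nat)|now rewrite IH].
Qed.

Lemma Csum_ext (u v : nat -> C) (n : nat) :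
  (forall i, (i <= n)%nat -> u i = v i) -> Csum u n = Csum v n.
Proof.
  intros H. rewrite !Csum_parts. f_equal; apply sum_ext; intros; now rewrite H.
Qed.

Lemma Csum_add (u v : nat -> C) (n : nat) :
  Csum (fun i => Cadd (u i) (v i)) n = Cadd (Csum u n) (Csum v n).
Proof. induction n as [|n IH]; simpl; [reflexivity|]. rewrite IH; ring. Qed.

Lemma Csum_sub (u v : nat -> C) (n : nat) :
  Csum (fun i => Csub (u i) (v i)) n = Csub (Csum u n) (Csum v n).
Proof. induction n as [|n IH]; simpl; [reflexivity|]. rewrite IH; ring. Qed.

Lemma Csum_scal (c : C) (u : nat -> C) (n : nat) :
  Csum (fun i => Cmul c (u i)) n = Cmul c (Csum u n).
Proof. induction n as [|n IH]; simpl; [reflexivity|]. rewrite IH; ring. Qed.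

Lemma Csum_zero (u : nat -> C) (n : nat) :
  (forall i, (i <= n)%nat -> u i = C0) -> Csum u n = C0.
Proof.
  intros H. rewrite Csum_parts. apply C_eq; simpl; apply sum_zero; intros; now rewrite H.
Qed.

Lemma Csum_single (u : nat -> C) (k n : nat) :
  (k <= n)%nat -> (forall i, i <> k -> u i = C0) -> Csum u n = u k.
Proof.
  intros L H. rewrite Csum_parts.
  apply C_eq; simpl.
  - apply (sum_single (fun i => fst (u i))); auto; intros; now rewrite H.
  - apply (sum_single (fun i => snd (u i))); auto; intros; now rewrite H.
Qed.

Lemma Csum_two (u : nat -> C) (n : nat) :
  (1 <= n)%nat -> (forall i, (2 <= i)%nat -> u i = C0) -> Csum u n = Cadd (u 0%nat) (u 1%nat).
Proof.
  intros L H. rewrite Csum_parts.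
  apply C_eq; simpl.
  - apply (sum_two (fun i => fst (u i))); auto; intros; now rewrite H.
  - apply (sum_two (fun i => snd (u i))); auto; intros; now rewrite H.
Qed.

Lemma Csum_switch (u : nat -> nat -> C) (n m : nat) :
  Csum (fun i => Csum (fun j => u i j) m) n = Csum (fun j => Csum (fun i => u i j) n) m.
Proof.
  induction n as [|n IH]; simpl; [reflexivity|].
  rewrite IH, <- Csum_add; reflexivity.
Qed.

Lemma Csum_triangle (u : nat -> nat -> C) (n : nat) :
  Csum (fun k => Csum (fun j => u j (k - j)%nat) k) n =
  Csum (fun j => Csum (u j) (n - j)) n.
Proof.
  apply C_eq; rewrite !Csum_parts; simpl.
  - rewrite (sum_ext _ (fun k => sum_f_R0 (fun j => fst (u j (k - j)%nat)) k))
      by (intros; now rewrite Csum_parts).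
    rewrite (sum_triangle (fun j l => fst (u j l))).
    apply sum_ext; intros; now rewrite Csum_parts.
  - rewrite (sum_ext _ (fun k => sum_f_R0 (fun j => snd (u j (k - j)%nat)) k))
      by (intros; now rewrite Csum_parts).
    rewrite (sum_triangle (fun j l => snd (u j l))).
    apply sum_ext; intros; now rewrite Csum_parts.
Qed.

Lemma Cmod_Csum (u : nat -> C) (n : nat) : Cmod (Csum u n) <= sum_f_R0 (fun i => Cmod (u i)) n.
Proof.
  induction n as [|n IH]; simpl; [lra|]. eapply Rle_trans; [apply Cmod_add|lra].
Qed.

Definition Ccv (u : nat -> C) (l : C) : Prop :=
  Un_cv (fun n => fst (u n)) (fst l) /\ Un_cv (fun n => snd (u n)) (snd l).

Lemma Ccv_Cmod (u : nat -> C) (l : C) : Ccv u l <-> Un_cv (fun n => Cmod (Csub (u n) l)) 0.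
Proof.
  split.
  - intros [H1 H2].
    assert (A : forall v m, Un_cv v m -> Un_cv (fun n => Rabs (v n - m)) 0).
    { intros v m H e He. destruct (H e He) as [M HM]; exists M; intros n Hn.
      unfold Rdist in *. rewrite Rminus_0_r, Rabs_Rabsolu. auto. }
    apply Un_cv_squeeze0 with (v := fun n => Rabs (fst (u n) - fst l) + Rabs (snd (u n) - snd l)).
    + intros n; split; [apply Cmod_nonneg|]. apply (Cmod_le_parts (Csub (u n) l)).
    + replace 0 with (0 + 0) by ring. apply CV_plus; apply A; auto.
  - intros H; split; intros e He; destruct (H e He) as [M HM]; exists M; intros n Hn;
      specialize (HM n Hn); unfold Rdist in *; rewrite Rminus_0_r, Rabs_right in HM
      by (apply Rle_ge, Cmod_nonneg).
    + eapply Rle_lt_trans; [apply (Cmod_fst (Csub (u n) l))|exact HM].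
    + eapply Rle_lt_trans; [apply (Cmod_snd (Csub (u n) l))|exact HM].
Qed.

Lemma Ccv_unique (u : nat -> C) (l m : C) : Ccv u l -> Ccv u m -> l = m.
Proof. intros [A B] [A' B']. apply C_eq; eapply UL_sequence; eauto. Qed.

Lemma Ccv_const (c : C) : Ccv (fun _ => c) c.
Proof. split; apply Un_cv_const. Qed.

Lemma Ccv_ext_ev (u v : nat -> C) (l : C) (n0 : nat) :
  (forall n, (n0 <= n)%nat -> u n = v n) -> Ccv u l -> Ccv v l.
Proof.
  intros H [A B]; split; eapply Un_cv_ext_ev with (n0 := n0); eauto;
    intros; simpl; now rewrite H.
Qed.

Lemma Ccv_add (u v : nat -> C) (l m : C) :
  Ccv u l -> Ccv v m -> Ccv (fun n => Cadd (u n) (v n)) (Cadd l m).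
Proof. intros [A B] [A' B']; split; simpl; apply CV_plus; auto. Qed.

Lemma Ccv_sub (u v : nat -> C) (l m : C) :
  Ccv u l -> Ccv v m -> Ccv (fun n => Csub (u n) (v n)) (Csub l m).
Proof. intros [A B] [A' B']; split; simpl; apply CV_minus; auto. Qed.

Lemma Ccv_mul (u v : nat -> C) (l m : C) :
  Ccv u l -> Ccv v m -> Ccv (fun n => Cmul (u n) (v n)) (Cmul l m).
Proof.
  intros [A B] [A' B']; split; simpl.
  - apply CV_minus; apply CV_mult; auto.
  - apply CV_plus; apply CV_mult; auto.
Qed.

Lemma Ccv_scal (c : C) (u : nat -> C) (l : C) :
  Ccv u l -> Ccv (fun n => Cmul c (u n)) (Cmul c l).
Proof. intros; apply Ccv_mul; auto using Ccv_const. Qed.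

Lemma Ccv_Csum (x : nat -> nat -> C) (l : nat -> C) (m : nat) :
  (forall j, Ccv (fun n => x n j) (l j)) -> Ccv (fun n => Csum (x n) m) (Csum l m).
Proof.
  intros H; induction m as [|m IH]; simpl; [apply H|]. apply Ccv_add; auto.
Qed.

Lemma Ccv_Cmod_lim (u : nat -> C) (l : C) : Ccv u l -> Un_cv (fun n => Cmod (u n)) (Cmod l).
Proof.
  intros H. apply Ccv_Cmod in H. intros e He. destruct (H e He) as [M HM].
  exists M; intros n Hn. specialize (HM n Hn). unfold Rdist in *.
  rewrite Rminus_0_r, Rabs_right in HM by (apply Rle_ge, Cmod_nonneg).
  apply Rle_lt_trans with (2 := HM). apply Rabs_le.
  pose proof (Cmod_add (Csub (u n) l) l) as E1.
  replace (Cadd (Csub (u n) l) l) with (u n) in E1 by ring.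
  pose proof (Cmod_add (Csub l (u n)) (u n)) as E2.
  replace (Cadd (Csub l (u n)) (u n)) with l in E2 by ring.
  rewrite (Cmod_sub_sym l) in E2. lra.
Qed.

(** Both |u| and u + |u| have nonnegative terms and bounded sums, and u is their difference. *)
Lemma real_abs_series_cv (u : nat -> R) (M : R) :
  (forall n, sum_f_R0 (fun i => Rabs (u i)) n <= M) -> exists l, Un_cv (sum_f_R0 u) l.
Proof.
  intros B.
  destruct (nonneg_bounded_sums_cv (fun i => Rabs (u i)) M) as [l1 [H1 _]];
    [intros; apply Rabs_pos|exact B|].
  destruct (nonneg_bounded_sums_cv (fun i => u i + Rabs (u i)) (2 * M)) as [l2 [H2 _]].
  - intros i. pose proof (Rle_abs (- u i)). rewrite Rabs_Ropp in *; lra.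
  - intros n. rewrite plus_sum. pose proof (Rle_abs (sum_f_R0 u n)).
    pose proof (Rsum_abs u n). specialize (B n). lra.
  - exists (l2 - l1). eapply Un_cv_ext_ev with (n0 := 0%nat); [|exact (CV_minus _ _ _ _ H2 H1)].
    intros n _; simpl. rewrite plus_sum. ring.
Qed.

Lemma Cseries_cv (u : nat -> C) (M : R) :
  (forall n, sum_f_R0 (fun i => Cmod (u i)) n <= M) ->
  exists l, Ccv (Csum u) l /\ Cmod l <= M.
Proof.
  intros B.
  destruct (real_abs_series_cv (fun i => fst (u i)) M) as [x Hx].
  { intros n; eapply Rle_trans; [apply sum_Rle; intros; apply Cmod_fst|apply B]. }
  destruct (real_abs_series_cv (fun i => snd (u i)) M) as [y Hy].
  { intros n; eapply Rle_trans; [apply sum_Rle; intros; apply Cmod_snd|apply B]. }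
  assert (H : Ccv (Csum u) (x, y)).
  { split; simpl; [apply (Un_cv_ext_ev _ _ _ 0) with (2 := Hx)|apply (Un_cv_ext_ev _ _ _ 0) with (2 := Hy)];
      intros; now rewrite Csum_parts. }
  exists (x, y); split; [exact H|].
  apply Un_cv_le with (u := fun n => Cmod (Csum u n)); [|apply Ccv_Cmod_lim, H].
  intros n; eapply Rle_trans; [apply Cmod_Csum|apply B].
Qed.

Lemma Ccv_null_of_bound (u : nat -> C) (v : nat -> R) :
  (forall n, Cmod (u n) <= v n) -> Un_cv v 0 -> Ccv u C0.
Proof.
  intros H V. apply Ccv_Cmod. apply Un_cv_squeeze0 with (2 := V).
  intros n; split; [apply Cmod_nonneg|].
  replace (Csub (u n) C0) with (u n) by ring. apply H.
Qed.

Lemma Ccv_of_diff (u v : nat -> C) (l : C) :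
  Ccv v l -> Ccv (fun n => Csub (u n) (v n)) C0 -> Ccv u l.
Proof.
  intros H D. replace l with (Cadd C0 l) by ring.
  apply Ccv_ext_ev with (n0 := 0%nat) (u := fun n => Cadd (Csub (u n) (v n)) (v n)).
  - intros; ring.
  - now apply Ccv_add.
Qed.

(** Dominated convergence along the diagonal: the terms and the truncation move together, and the
    domination is known only for j <= n, which is how triangular partial sums arrive. *)
Lemma Csum_tannery (x : nat -> nat -> C) (y : nat -> C) (v : nat -> R) (M : R) (l : C) :
  (forall n j, (j <= n)%nat -> Cmod (x n j) <= v j) -> (forall j, Cmod (y j) <= v j) ->
  (forall n, sum_f_R0 v n <= M) -> (forall j, Ccv (fun n => x n j) (y j)) ->
  Ccv (Csum y) l -> Ccv (fun n => Csum (x n) n) l.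
Proof.
  intros Dx Dy B C L. apply Ccv_of_diff with (1 := L).
  (* Set to 0 for j > n, where nothing bounds [x n j]. *)
  set (d := fun n j => if le_dec j n then Cmod (Csub (x n j) (y j)) else 0).
  apply Ccv_null_of_bound with (v := fun n => sum_f_R0 (d n) n).
  - intros n. rewrite <- Csum_sub. eapply Rle_trans; [apply Cmod_Csum|].
    apply sum_Rle; intros j Hj. unfold d. destruct (le_dec j n); [lra|lia].
  - assert (V0 : forall j, 0 <= v j) by (intros j; eapply Rle_trans; [apply Cmod_nonneg|apply Dy]).
    apply tannery_diag with (v := fun j => 2 * v j) (M := 2 * M).
    + intros n j; unfold d. destruct (le_dec j n) as [Hj|Hj].
      * split; [apply Cmod_nonneg|]. eapply Rle_trans; [apply Cmod_sub|].
        specialize (Dx n j Hj); specialize (Dy j); lra.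
      * specialize (V0 j); lra.
    + intros n; rewrite sum_scal. specialize (B n); lra.
    + intros j. specialize (C j). apply Ccv_Cmod in C.
      apply Un_cv_ext_ev with (n0 := j) (2 := C). intros n Hn; unfold d.
      destruct (le_dec j n); [reflexivity|lia].
Qed.

(** * Powers of a power series with probability coefficients *)

Definition prob (p : nat -> R) : Prop := (forall i, 0 <= p i) /\ Un_cv (sum_f_R0 p) 1.

(* [pcoef p k i] is the coefficient of [z ^ i] in the [k]-th power of [psi p]. *)
Fixpoint pcoef (p : nat -> R) (k i : nat) : R :=
  match k with
  | O => match i with O => 1 | S _ => 0 end
  | S k' => sum_f_R0 (fun j => p j * pcoef p k' (i - j)) i
  end.

Definition psi (p : nat -> R) (z : C) : C :=
  epsilon (inhabits C0) (Ccv (Csum (fun i => Cmul (RtoC (p i)) (Cpow z i)))).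

Lemma prob_sum_le1 (p : nat -> R) (n : nat) : prob p -> sum_f_R0 p n <= 1.
Proof.
  intros [H0 H1]. apply (growing_ineq (sum_f_R0 p)); auto.
  intros m; simpl; specialize (H0 (S m)); lra.
Qed.

Lemma pow_le1 (x : R) (n : nat) : 0 <= x <= 1 -> 0 <= x ^ n <= 1.
Proof.
  intros H; split; [apply pow_le; lra|]. rewrite <- (pow1 n). apply pow_incr; auto.
Qed.

Lemma psi_term_le (p : nat -> R) (z : C) (i : nat) :
  prob p -> Cmod z <= 1 -> Cmod (Cmul (RtoC (p i)) (Cpow z i)) <= p i.
Proof.
  intros [H0 _] Hz. rewrite Cmod_mul, Cmod_pow, Cmod_RtoC_nonneg by auto.
  destruct (pow_le1 (Cmod z) i) as [A B]; [split; [apply Cmod_nonneg|auto]|].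
  specialize (H0 i); nra.
Qed.

Lemma psi_cv (p : nat -> R) (z : C) : prob p -> Cmod z <= 1 ->
  Ccv (Csum (fun i => Cmul (RtoC (p i)) (Cpow z i))) (psi p z) /\ Cmod (psi p z) <= 1.
Proof.
  intros Hp Hz.
  destruct (Cseries_cv (fun i => Cmul (RtoC (p i)) (Cpow z i)) 1) as [l [Hl Hl1]].
  - intros n. eapply Rle_trans; [|apply (prob_sum_le1 p n Hp)].
    apply sum_Rle; intros; now apply psi_term_le.
  - assert (E : Ccv (Csum (fun i => Cmul (RtoC (p i)) (Cpow z i))) (psi p z))
      by (unfold psi; apply epsilon_spec; eauto).
    split; [exact E|]. now rewrite (Ccv_unique _ _ _ E Hl).
Qed.

Lemma pcoef_nonneg (p : nat -> R) (k i : nat) : (forall i, 0 <= p i) -> 0 <= pcoef p k i.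
Proof.
  intros H; revert i; induction k as [|k IH]; intros i; simpl; [destruct i; lra|].
  apply sum_nonneg; intros; apply Rmult_le_pos; auto.
Qed.

(** [pcoef p k] is the law of a sum of k independent variables of law p. *)
Lemma pcoef_sum_le1 (p : nat -> R) (k n : nat) : prob p -> sum_f_R0 (pcoef p k) n <= 1.
Proof.
  intros Hp; revert n; induction k as [|k IH]; intros n.
  - rewrite (sum_single _ 0) by (try lia; intros [|i]; simpl; tauto). simpl; lra.
  - simpl pcoef. rewrite (sum_triangle (fun j l => p j * pcoef p k l)).
    eapply Rle_trans; [|apply (prob_sum_le1 p n Hp)]. apply sum_Rle; intros j Hj.
    rewrite sum_scal. destruct Hp as [H0 _]. specialize (H0 j); specialize (IH (n - j)%nat); nra.
Qed.

(** A Cauchy product: the partial sums for the power k + 1 regroup as p_j z^j times a partial sum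
    for the power k up to n - j, and p_j dominates these terms uniformly in n. *)
Lemma psi_pow_cv (p : nat -> R) (k : nat) (z : C) : prob p -> Cmod z <= 1 ->
  Ccv (Csum (fun i => Cmul (RtoC (pcoef p k i)) (Cpow z i))) (Cpow (psi p z) k).
Proof.
  intros Hp Hz. induction k as [|k IH].
  - apply Ccv_ext_ev with (n0 := 0%nat) (2 := Ccv_const C1). intros n _.
    rewrite (Csum_single _ 0); [simpl; change (RtoC 1) with C1; ring|lia|].
    intros [|i] Hi; [tauto|]. change (RtoC (pcoef p 0 (S i))) with C0; ring.
  - set (u := fun j l => Cmul (Cmul (RtoC (p j)) (Cpow z j)) (Cmul (RtoC (pcoef p k l)) (Cpow z l))).
    apply Ccv_ext_ev with (n0 := 0%nat) (u := fun n => Csum (fun j => Csum (u j) (n - j)) n).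
    { intros n _. rewrite <- (Csum_triangle u). apply Csum_ext; intros i Hi.
      replace (RtoC (pcoef p (S k) i))
        with (Csum (fun j => Cmul (RtoC (p j)) (RtoC (pcoef p k (i - j)))) i).
      - rewrite (Csum_ext _ (fun j => Cmul (Cpow z i) (Cmul (RtoC (p j)) (RtoC (pcoef p k (i - j)))))).
        + rewrite Csum_scal; ring.
        + intros j Hj; unfold u. replace i with (j + (i - j))%nat at 3 by lia.
          rewrite Cpow_add; ring.
      - apply C_eq; rewrite Csum_parts; simpl; [apply sum_ext|apply sum_zero]; intros; ring. }
    apply Csum_tannery with (y := fun j => Cmul (Cmul (RtoC (p j)) (Cpow z j)) (Cpow (psi p z) k))
      (v := p) (M := 1).
    + intros n j Hj; unfold u. rewrite Csum_scal, Cmod_mul.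
      assert (A := psi_term_le p z j Hp Hz).
      assert (B : Cmod (Csum (fun l => Cmul (RtoC (pcoef p k l)) (Cpow z l)) (n - j)) <= 1).
      { eapply Rle_trans; [apply Cmod_Csum|].
        eapply Rle_trans; [|apply (pcoef_sum_le1 p k (n - j) Hp)].
        apply sum_Rle; intros l _. rewrite Cmod_mul, Cmod_pow.
        destruct Hp as [H0 _]. rewrite Cmod_RtoC_nonneg by (apply pcoef_nonneg; auto).
        destruct (pow_le1 (Cmod z) l) as [A' B']; [split; [apply Cmod_nonneg|auto]|].
        assert (0 <= pcoef p k l) by (apply pcoef_nonneg; auto). nra. }
      match goal with |- ?x * ?y <= _ => assert (0 <= x) by apply Cmod_nonneg; nra end.
    + intros j. rewrite Cmod_mul. assert (A := psi_term_le p z j Hp Hz).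
      destruct (psi_cv p z Hp Hz) as [_ B]. rewrite Cmod_pow.
      destruct (pow_le1 (Cmod (psi p z)) k) as [A' B']; [split; [apply Cmod_nonneg|auto]|].
      match goal with |- ?x * ?y <= _ => assert (0 <= x) by apply Cmod_nonneg; nra end.
    + intros n; apply prob_sum_le1; auto.
    + intros j. unfold u.
      apply Ccv_ext_ev with (n0 := j) (u := fun n => Cmul (Cmul (RtoC (p j)) (Cpow z j))
        (Csum (fun l => Cmul (RtoC (pcoef p k l)) (Cpow z l)) (n - j))).
      { intros n Hn. now rewrite Csum_scal. }
      apply Ccv_scal. destruct IH as [I1 I2].
      split; simpl; intros e He; [destruct (I1 e He) as [M HM]|destruct (I2 e He) as [M HM]];
        exists (M + j)%nat; intros n Hn; apply HM; lia.
    + apply Ccv_ext_ev with (n0 := 0%nat)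
        (u := fun n => Cmul (Cpow (psi p z) k) (Csum (fun j => Cmul (RtoC (p j)) (Cpow z j)) n)).
      * intros n _. rewrite <- Csum_scal. apply Csum_ext; intros; ring.
      * replace (Cpow (psi p z) (S k)) with (Cmul (Cpow (psi p z) k) (psi p z)) by (simpl; ring).
        apply Ccv_scal. apply psi_cv; auto.
Qed.

Lemma psi_real (p : nat -> R) (r : R) (m : nat) : prob p -> 0 <= r <= 1 ->
  exists x, psi p (RtoC r) = RtoC x /\ r ^ m * sum_f_R0 p m <= x.
Proof.
  intros Hp Hr. destruct (psi_cv p (RtoC r) Hp) as [[H1 H2] _].
  { rewrite Cmod_RtoC_nonneg; lra. }
  exists (fst (psi p (RtoC r))). split.
  - apply C_eq; [reflexivity|]. simpl. symmetry. eapply UL_sequence; [|exact H2].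
    apply Un_cv_ext_ev with (n0 := 0%nat) (2 := Un_cv_const 0). intros n _.
    rewrite Csum_parts; simpl. symmetry; apply sum_zero; intros.
    rewrite Cpow_RtoC; simpl; ring.
  - assert (G : forall n, fst (Csum (fun i => Cmul (RtoC (p i)) (Cpow (RtoC r) i)) n)
                      = sum_f_R0 (fun i => p i * r ^ i) n).
    { intros n; rewrite Csum_parts; simpl. apply sum_ext; intros.
      rewrite Cpow_RtoC; simpl; ring. }
    assert (P : forall i, 0 <= p i * r ^ i).
    { intros; apply Rmult_le_pos; [apply Hp|apply pow_le; lra]. }
    apply Rle_trans with (sum_f_R0 (fun i => p i * r ^ i) m).
    + rewrite <- sum_scal. apply sum_Rle; intros i Hi.
      rewrite Rmult_comm. apply Rmult_le_compat_l; [apply Hp|].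
      replace m with ((m - i) + i)%nat by lia. rewrite pow_add.
      destruct (pow_le1 r (m - i)); auto. destruct (pow_le1 r i); auto. nra.
    + rewrite <- G. refine (growing_ineq (fun n => fst (Csum _ n)) _ _ H1 m).
      intros n. rewrite !G. simpl. specialize (P (S n)); simpl in P. lra.
Qed.

(** A form of Abel's theorem at 1. It supplies points r where psi exceeds any prescribed modulus,
    which makes y run through the whole disc. *)
Lemma psi_real_near1 (p : nat -> R) (y : R) : prob p -> y < 1 ->
  exists r x, 0 <= r < 1 /\ psi p (RtoC r) = RtoC x /\ y < x.
Proof.
  (* The minimum with 1 caps e when y is negative, and so keeps t at most 1 / 2. *)
  intros Hp Hy. set (e := Rmin (1 - y) 1).
  assert (He : 0 < e <= 1) by (unfold e; split; [apply Rmin_glb_lt; lra|apply Rmin_r]).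
  assert (He' : e <= 1 - y) by apply Rmin_l.
  destruct (proj2 Hp (e / 2)) as [m Hm]; [lra|]. specialize (Hm m (Nat.le_refl _)).
  unfold Rdist in Hm. apply Rabs_def2 in Hm.
  assert (Hn : 1 <= INR (S m)) by (rewrite S_INR; pose proof (pos_INR m); lra).
  (* With this t, Bernoulli's inequality gives (1 - t)^m > 1 - e / 2; multiplied by a mass above 1 -
     e / 2, this exceeds 1 - e. *)
  set (t := e / (2 * INR (S m))).
  assert (Ht : t * INR (S m) = e / 2) by (unfold t; field; lra).
  assert (Ht0 : 0 < t) by (unfold t; apply Rdiv_lt_0_compat; lra).
  assert (Ht1 : t <= 1 / 2) by nra.
  destruct (psi_real p (1 - t) m Hp) as [x [Hx Hx']]; [lra|].
  exists (1 - t), x; split; [lra|split; [exact Hx|]].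
  assert (B : 1 - INR m * t <= (1 - t) ^ m).
  { clearbody t. clear -Ht0 Ht1. induction m as [|m IH]; [simpl; lra|].
    rewrite S_INR; simpl pow. pose proof (pos_INR m).
    assert ((1 - t) * (1 - INR m * t) <= (1 - t) * (1 - t) ^ m)
      by (apply Rmult_le_compat_l; lra).
    assert (0 <= INR m * (t * t)) by (apply Rmult_le_pos; nra). lra. }
  assert (INR m * t < e / 2) by (rewrite S_INR in Ht; nra).
  assert (sum_f_R0 p m <= 1) by (apply prob_sum_le1; auto).
  nra.
Qed.

Lemma sum_rev (u : nat -> R) (n : nat) : sum_f_R0 (fun j => u (n - j)%nat) n = sum_f_R0 u n.
Proof.
  induction n as [|n IH]; [reflexivity|].
  rewrite decomp_sum by lia. simpl Nat.pred. rewrite Nat.sub_0_r.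
  rewrite (sum_ext _ (fun j => u (n - j)%nat)) by reflexivity.
  rewrite IH; simpl; ring.
Qed.

(* The largest coefficient of the [k]-th power contracts by the mass [1 - tau] of the first
   [m] coefficients of [p], up to the size [sigma] of the others. *)
Lemma pcoef_upper (p : nat -> R) (m : nat) (tau sigma : R) : prob p ->
  0 <= tau <= 1 -> 0 <= sigma ->
  (forall n, sum_f_R0 (fun j => if lt_dec j m then p j else 0) n <= 1 - tau) ->
  (forall j, (m <= j)%nat -> p j <= sigma) ->
  forall k i, pcoef p k i <= (1 - tau) ^ k + INR k * sigma.
Proof.
  intros Hp Ht Hs Hm HM k. induction k as [|k IH]; intros i.
  - simpl. destruct i; lra.
  - set (Mk := (1 - tau) ^ k + INR k * sigma) in *.
    assert (M0 : 0 <= Mk).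
    { unfold Mk. assert (0 <= (1 - tau) ^ k) by (apply pow_le; lra).
      pose proof (pos_INR k). nra. }
    simpl pcoef.
    (* Before the cut m the factor [pcoef p k (i - j)] is replaced by its bound [Mk]; from m on it
       is [p j] that is replaced, and the remaining factor has mass at most 1. *)
    apply Rle_trans with (sum_f_R0 (fun j => Mk * (if lt_dec j m then p j else 0)
                                           + sigma * pcoef p k (i - j)) i).
    + apply sum_Rle; intros j Hj. specialize (IH (i - j)%nat).
      assert (0 <= pcoef p k (i - j)) by (apply pcoef_nonneg, Hp).
      assert (0 <= p j) by apply Hp.
      destruct (lt_dec j m) as [L|L]; [nra|]. specialize (HM j ltac:(lia)). nra.
    + rewrite plus_sum, !sum_scal.
      assert (S1 : sum_f_R0 (fun j => pcoef p k (i - j)) i <= 1).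
      { rewrite (sum_rev (pcoef p k)). now apply pcoef_sum_le1. }
      specialize (Hm i).
      assert (Mk * sum_f_R0 (fun j => if lt_dec j m then p j else 0) i <= Mk * (1 - tau))
        by (apply Rmult_le_compat_l; auto).
      assert (sigma * sum_f_R0 (fun j => pcoef p k (i - j)) i <= sigma * 1)
        by (apply Rmult_le_compat_l; auto).
      apply Rle_trans with (Mk * (1 - tau) + sigma * 1); [lra|].
      rewrite S_INR. simpl pow. unfold Mk. pose proof (pos_INR k).
      assert (0 <= INR k * sigma * tau) by (repeat apply Rmult_le_pos; lra). lra.
Qed.

(** With probability [(sum_f_R0 p m) ^ k] all k variables are at most m, and then their sum is at
    most k m. *)
Lemma pcoef_lower (p : nat -> R) (m k : nat) : prob p ->
  (sum_f_R0 p m) ^ k <= sum_f_R0 (pcoef p k) (k * m).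
Proof.
  intros Hp. induction k as [|k IH]; [simpl; lra|].
  assert (H0 := proj1 Hp).
  simpl pcoef. rewrite (sum_triangle (fun j l => p j * pcoef p k l)).
  apply Rle_trans with (sum_f_R0 (fun j => sum_f_R0 (fun l => p j * pcoef p k l) (S k * m - j)) m).
  - simpl pow. rewrite Rmult_comm, <- sum_scal. apply sum_Rle; intros j Hj.
    rewrite sum_scal, (Rmult_comm _ (p j)). apply Rmult_le_compat_l; [apply H0|].
    eapply Rle_trans; [exact IH|]. apply sum_mono; [intros; apply pcoef_nonneg; auto|simpl; nia].
  - apply sum_mono; [|simpl; nia]. intros; apply sum_nonneg; intros.
    apply Rmult_le_pos; auto using pcoef_nonneg.
Qed.

Lemma sum_sq_Cauchy (u : nat -> R) (n : nat) :
  (sum_f_R0 u n) * (sum_f_R0 u n) <= INR (S n) * sum_f_R0 (fun i => u i * u i) n.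
Proof.
  induction n as [|n IH]; [simpl; nra|].
  simpl sum_f_R0. rewrite (S_INR (S n)).
  set (s := sum_f_R0 u n) in *. set (q := sum_f_R0 (fun i => u i * u i) n) in *.
  set (a := INR (S n)) in *. set (x := u (S n)).
  assert (Ha : 0 < a) by (unfold a; apply lt_0_INR; lia).
  (* This is (s - a x)^2 >= 0 divided by a, with s^2 <= a q. *)
  assert (2 * s * x <= q + a * (x * x)).
  { assert (D : 0 <= (s - a * x) * (s - a * x)) by apply Rle_0_sqr.
    assert (a * (2 * s * x) <= a * (q + a * (x * x))) by nra.
    apply Rmult_le_reg_l with a; auto. }
  nra.
Qed.

(** * Box sums and uniqueness of power series coefficients *)

Lemma rsum_app (l l' : list (list nat)) (u : list nat -> R) :
  rsum (l ++ l') u = rsum l u + rsum l' u.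
Proof. induction l as [|a l IH]; simpl; [|rewrite IH]; ring. Qed.

Lemma rsum_map (f : list nat -> list nat) (l : list (list nat)) (u : list nat -> R) :
  rsum (map f l) u = rsum l (fun a => u (f a)).
Proof. induction l as [|a l IH]; simpl; [|rewrite IH]; ring. Qed.

Lemma rsum_box_S (N n : nat) (u : list nat -> R) :
  rsum (box (S N) n) u = sum_f_R0 (fun k => rsum (box N n) (fun a => u (k :: a))) n.
Proof.
  simpl box. generalize (box N n) as L; intros L.
  change (map (cons 0%nat) L ++ flat_map (fun k => map (cons k) L) (seq 1 n))
    with (flat_map (fun k => map (cons k) L) (seq 0 (S n))).
  induction n as [|n IH].
  - simpl. rewrite app_nil_r. apply rsum_map.
  - rewrite seq_S, flat_map_app, rsum_app, IH. simpl flat_map.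
    rewrite app_nil_r, rsum_map. reflexivity.
Qed.

Lemma csum_parts (l : list (list nat)) (c : list nat -> C) :
  csum l c = (rsum l (fun a => fst (c a)), rsum l (fun a => snd (c a))).
Proof. induction l as [|a l IH]; simpl; [reflexivity|]. now rewrite IH. Qed.

Lemma csum_box_S (N n : nat) (c : list nat -> C) :
  csum (box (S N) n) c = Csum (fun k => csum (box N n) (fun a => c (k :: a))) n.
Proof.
  rewrite csum_parts, !rsum_box_S, Csum_parts.
  f_equal; apply sum_ext; intros; now rewrite csum_parts.
Qed.

Lemma rsum_box_le (N n : nat) (u v : list nat -> R) :
  (forall a, length a = N -> u a <= v a) -> rsum (box N n) u <= rsum (box N n) v.
Proof.
  revert u v; induction N as [|N IH]; intros u v H.
  - simpl. specialize (H [] eq_refl); lra.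
  - rewrite !rsum_box_S. apply sum_Rle; intros k Hk. apply IH; intros a Ha.
    apply H; simpl; auto.
Qed.

Lemma rsum_box_ext (N n : nat) (u v : list nat -> R) :
  (forall a, length a = N -> u a = v a) -> rsum (box N n) u = rsum (box N n) v.
Proof.
  intros H; apply Rle_antisym; apply rsum_box_le; intros; rewrite H; auto; lra.
Qed.

Lemma csum_box_ext (N n : nat) (u v : list nat -> C) :
  (forall a, length a = N -> u a = v a) -> csum (box N n) u = csum (box N n) v.
Proof.
  intros H. rewrite !csum_parts. f_equal; apply rsum_box_ext; intros; now rewrite H.
Qed.

Lemma rsum_add (l : list (list nat)) (u v : list nat -> R) :
  rsum l (fun a => u a + v a) = rsum l u + rsum l v.
Proof. induction l as [|a l IH]; simpl; rewrite ?IH; ring. Qed.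

Lemma rsum_scal (l : list (list nat)) (x : R) (u : list nat -> R) :
  rsum l (fun a => x * u a) = x * rsum l u.
Proof. induction l as [|a l IH]; simpl; rewrite ?IH; ring. Qed.

Lemma csum_scal (l : list (list nat)) (x : C) (u : list nat -> C) :
  csum l (fun a => Cmul x (u a)) = Cmul x (csum l u).
Proof. induction l as [|a l IH]; simpl; rewrite ?IH; ring. Qed.

Lemma csum_sub (l : list (list nat)) (u v : list nat -> C) :
  csum l (fun a => Csub (u a) (v a)) = Csub (csum l u) (csum l v).
Proof. induction l as [|a l IH]; simpl; rewrite ?IH; ring. Qed.

Lemma rsum_box_nonneg (N n : nat) (u : list nat -> R) :
  (forall a, length a = N -> 0 <= u a) -> 0 <= rsum (box N n) u.
Proof.
  revert u; induction N as [|N IH]; intros u H.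
  - simpl. specialize (H [] eq_refl); lra.
  - rewrite rsum_box_S. apply sum_nonneg; intros; apply IH; intros; apply H; simpl; auto.
Qed.

Lemma rsum_box_mono (N m n : nat) (u : list nat -> R) : (forall a, 0 <= u a) -> (m <= n)%nat ->
  rsum (box N m) u <= rsum (box N n) u.
Proof.
  intros H L; revert u H; induction N as [|N IH]; intros u H.
  - simpl; lra.
  - rewrite !rsum_box_S.
    apply Rle_trans with (sum_f_R0 (fun k => rsum (box N n) (fun a => u (k :: a))) m).
    + apply sum_Rle; intros; apply IH; auto.
    + apply sum_mono; auto. intros; apply rsum_box_nonneg; auto.
Qed.

Lemma rsum_box_term (N : nat) (u : list nat -> R) (a : list nat) : (forall a, 0 <= u a) ->
  length a = N -> exists n, u a <= rsum (box N n) u.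
Proof.
  intros H <-. revert u H; induction a as [|k a IH]; intros u H.
  - exists 0%nat; simpl; lra.
  - destruct (IH (fun a => u (k :: a))) as [n Hn]; auto.
    exists (max k n). simpl length. rewrite rsum_box_S.
    eapply Rle_trans; [exact Hn|].
    eapply Rle_trans; [apply (rsum_box_mono _ n (max k n)); auto; lia|].
    refine (sum_term (fun j => rsum (box (length a) (max k n)) (fun a0 => u (j :: a0))) k _ _ _).
    + intros; apply rsum_box_nonneg; auto.
    + lia.
Qed.

Lemma rsum_box_zeros (d n : nat) (u : list nat -> R) :
  (forall a, length a = d -> a <> repeat 0%nat d -> u a = 0) ->
  rsum (box d n) u = u (repeat 0%nat d).
Proof.
  revert u; induction d as [|d IH]; intros u H; [simpl; lra|].
  rewrite rsum_box_S, (sum_single _ 0); [|lia|].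
  - simpl repeat. apply (IH (fun a => u (0%nat :: a))). intros a Ha Hne; apply H; simpl; [lia|congruence].
  - intros k Hk. rewrite (rsum_box_ext _ _ _ (fun _ => 0 * 0)).
    + rewrite rsum_scal; ring.
    + intros a Ha. rewrite H; simpl; [ring|lia|congruence].
Qed.

Lemma csum_box_zeros (d n : nat) (u : list nat -> C) :
  (forall a, length a = d -> a <> repeat 0%nat d -> u a = C0) ->
  csum (box d n) u = u (repeat 0%nat d).
Proof.
  intros H. rewrite csum_parts.
  apply C_eq; simpl; [apply (rsum_box_zeros d n (fun a => fst (u a)))|
                      apply (rsum_box_zeros d n (fun a => snd (u a)))];
    intros; rewrite H; auto.
Qed.

Lemma rsum_box2 (d n : nat) (u : list nat -> R) :
  (forall i k a, length a = d -> a <> repeat 0%nat d -> u (i :: k :: a) = 0) ->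
  rsum (box (S (S d)) n) u =
  sum_f_R0 (fun i => sum_f_R0 (fun k => u (i :: k :: repeat 0%nat d)) n) n.
Proof.
  intros H. rewrite rsum_box_S. apply sum_ext; intros i _.
  rewrite rsum_box_S. apply sum_ext; intros k _.
  apply (rsum_box_zeros d n (fun a => u (i :: k :: a))); auto.
Qed.

Lemma csum_box2 (d n : nat) (u : list nat -> C) :
  (forall i k a, length a = d -> a <> repeat 0%nat d -> u (i :: k :: a) = C0) ->
  csum (box (S (S d)) n) u =
  Csum (fun i => Csum (fun k => u (i :: k :: repeat 0%nat d)) n) n.
Proof.
  intros H. rewrite csum_box_S. apply Csum_ext; intros i _.
  rewrite csum_box_S. apply Csum_ext; intros k _.
  apply (csum_box_zeros d n (fun a => u (i :: k :: a))); auto.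
Qed.

Lemma Cmod_csum (l : list (list nat)) (c : list nat -> C) :
  Cmod (csum l c) <= rsum l (fun a => Cmod (c a)).
Proof.
  induction l as [|a l IH]; simpl; [rewrite Cmod_C0; lra|].
  eapply Rle_trans; [apply Cmod_add|lra].
Qed.

Lemma rsum_box_abs_cv (N : nat) (u : list nat -> R) (M : R) :
  (forall n, rsum (box N n) (fun a => Rabs (u a)) <= M) ->
  exists l, Un_cv (fun n => rsum (box N n) u) l.
Proof.
  intros B.
  assert (K : forall v, (forall a, 0 <= v a) -> (exists M, forall n, rsum (box N n) v <= M) ->
    exists l, Un_cv (fun n => rsum (box N n) v) l).
  { intros v Hv [M' HM]. destruct (growing_cv (fun n => rsum (box N n) v)) as [l Hl]; eauto.
    - intros n; apply rsum_box_mono; auto.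
    - exists M'; intros x [n ->]; apply HM. }
  destruct (K (fun a => Rabs (u a))) as [l1 H1]; [intros; apply Rabs_pos|eauto|].
  destruct (K (fun a => u a + Rabs (u a))) as [l2 H2].
  - intros a. pose proof (Rle_abs (- u a)). rewrite Rabs_Ropp in *; lra.
  - exists (2 * M); intros n. eapply Rle_trans; [apply rsum_box_le with (v := fun a => 2 * Rabs (u a))|].
    + intros a _; pose proof (Rle_abs (u a)); lra.
    + rewrite rsum_scal. specialize (B n); lra.
  - exists (l2 - l1). eapply Un_cv_ext_ev with (n0 := 0%nat); [|exact (CV_minus _ _ _ _ H2 H1)].
    intros n _; simpl. rewrite rsum_add. ring.
Qed.

Lemma abs_series_val (N : nat) (c : list nat -> C) (M : R) :
  (forall n, rsum (box N n) (fun a => Cmod (c a)) <= M) -> exists v, series_val N c v.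
Proof.
  intros B.
  destruct (rsum_box_abs_cv N (fun a => fst (c a)) M) as [x Hx].
  { intros n; eapply Rle_trans; [apply rsum_box_le; intros; apply Cmod_fst|apply B]. }
  destruct (rsum_box_abs_cv N (fun a => snd (c a)) M) as [y Hy].
  { intros n; eapply Rle_trans; [apply rsum_box_le; intros; apply Cmod_snd|apply B]. }
  exists (x, y); split; simpl; [apply Un_cv_ext_ev with (n0 := 0%nat) (2 := Hx)|
    apply Un_cv_ext_ev with (n0 := 0%nat) (2 := Hy)]; intros; now rewrite csum_parts.
Qed.

Lemma inD_cons (N : nat) (c : C) (z : list C) : inD (S N) (c :: z) <-> Cmod c < 1 /\ inD N z.
Proof.
  unfold inD; simpl. split.
  - intros [L F]; inversion F; subst; auto.
  - intros [H [L F]]; auto.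
Qed.

Lemma mono_box_bound (N : nat) (z : list C) : inD N z ->
  exists M, 0 <= M /\ forall n, rsum (box N n) (fun a => Cmod (mono z a)) <= M.
Proof.
  revert z; induction N as [|N IH]; intros z Hz.
  - exists (Cmod C1); split; [apply Cmod_nonneg|]. intros n; simpl. destruct z; simpl; lra.
  - destruct z as [|c z]; [destruct Hz; discriminate|].
    apply inD_cons in Hz. destruct Hz as [Hc Hz]. destruct (IH z Hz) as [M [M0 HM]].
    assert (Hi : 0 < / (1 - Cmod c)) by (apply Rinv_0_lt_compat; lra).
    exists (M * / (1 - Cmod c)). split; [apply Rmult_le_pos; lra|]. intros n.
    rewrite rsum_box_S.
    apply Rle_trans with (sum_f_R0 (fun k => M * Cmod c ^ k) n).
    + apply sum_Rle; intros k _.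
      rewrite (rsum_box_ext _ _ _ (fun a => Cmod c ^ k * Cmod (mono z a)))
        by (intros; simpl; now rewrite Cmod_mul, Cmod_pow).
      rewrite rsum_scal, Rmult_comm. apply Rmult_le_compat_r; [|apply HM].
      apply pow_le, Cmod_nonneg.
    + rewrite sum_scal. apply Rmult_le_compat_l; auto. apply sum_geom_le.
      split; [apply Cmod_nonneg|auto].
Qed.

Lemma bounded_box_bound (N : nat) (z : list C) (h : list nat -> C) (B : R) : inD N z ->
  (forall a, length a = N -> Cmod (h a) <= B) ->
  exists M, 0 <= M /\ forall n, rsum (box N n) (fun a => Cmod (Cmul (h a) (mono z a))) <= M.
Proof.
  intros Hz HB. destruct (mono_box_bound N z Hz) as [M [M0 HM]].
  assert (B0 : 0 <= B).
  { eapply Rle_trans; [apply Cmod_nonneg|apply (HB (repeat 0%nat N)), repeat_length]. }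
  exists (B * M); split; [now apply Rmult_le_pos|]. intros n.
  apply Rle_trans with (rsum (box N n) (fun a => B * Cmod (mono z a))).
  - apply rsum_box_le; intros a Ha. rewrite Cmod_mul. apply Rmult_le_compat_r; auto.
    apply Cmod_nonneg.
  - rewrite rsum_scal. apply Rmult_le_compat_l; auto.
Qed.

(** When the coefficients below k vanish, the value at a small e is e^k q_k up to a geometric
    remainder. The bound is kept as a difference of two powers so that the induction on n
    telescopes. *)
Lemma geom_tail_bound (q : nat -> C) (e Q : R) (k n : nat) :
  0 < e <= 1 / 2 -> (forall j, Cmod (q j) <= Q) -> (forall j, (j < k)%nat -> q j = C0) ->
  (k <= n)%nat ->
  Cmod (Csub (Csum (fun j => Cmul (RtoC (e ^ j)) (q j)) n) (Cmul (RtoC (e ^ k)) (q k)))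
    <= Q * (2 * e ^ S k - 2 * e ^ S n).
Proof.
  intros He HQ Hz L. induction L as [|n L IH].
  - replace (Csum _ k) with (Cmul (RtoC (e ^ k)) (q k)).
    + replace (Csub _ _) with C0 by ring. rewrite Cmod_C0. lra.
    + destruct k; simpl Csum; [reflexivity|]. rewrite Csum_zero; [simpl pow; ring|].
      intros i Hi; rewrite Hz by lia; ring.
  - simpl Csum. match goal with |- Cmod (Csub (Cadd ?x ?y) ?w) <= _ =>
      replace (Csub (Cadd x y) w) with (Cadd (Csub x w) y) by ring end.
    eapply Rle_trans; [apply Cmod_add|].
    assert (P : 0 < e ^ S n) by (apply pow_lt; lra).
    rewrite Cmod_mul, Cmod_RtoC_nonneg by (simpl in *; lra).
    assert (Q0 : 0 <= Q) by (eapply Rle_trans; [apply Cmod_nonneg|apply (HQ 0%nat)]).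
    apply Rle_trans with (Q * (2 * e ^ S k - 2 * e ^ S n) + e ^ S n * Q).
    + apply Rplus_le_compat; [exact IH|]. apply Rmult_le_compat_l; auto; lra.
    + assert (e ^ S (S n) <= e ^ S n / 2) by (change (e ^ S (S n)) with (e * e ^ S n); nra).
      nra.
Qed.

(** Induction on the number of variables and, inside it, strong induction on the first exponent k.
    With a small real e as first coordinate, division by e^k isolates the partial sums of the k-th
    slice, which therefore tend to 0; the slice is a series in one variable fewer. *)
Lemma coeffs_zero (N : nat) (h : list nat -> C) (B : R) :
  (forall a, length a = N -> Cmod (h a) <= B) ->
  (forall z, inD N z -> series_val N (fun a => Cmul (h a) (mono z a)) C0) ->
  forall a, length a = N -> h a = C0.
Proof.
  revert h; induction N as [|N IH]; intros h HB H a Ha.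
  - destruct a; [|discriminate]. assert (Hz : inD 0 []) by (split; auto).
    specialize (H [] Hz). apply (Ccv_unique (fun _ => h []) _ _ (Ccv_const _)).
    apply Ccv_ext_ev with (n0 := 0%nat) (2 := H). intros; simpl; ring.
  - destruct a as [|k a]; [discriminate|]. injection Ha as Ha. revert a Ha.
    induction k as [k IHk] using (well_founded_induction lt_wf).
    apply (IH (fun a => h (k :: a))); [intros; apply HB; simpl; auto|].
    intros z Hz.
    destruct (mono_box_bound N z Hz) as [M [M0 HM]].
    assert (B0 : 0 <= B).
    { eapply Rle_trans; [apply Cmod_nonneg|apply (HB (repeat 0%nat (S N))), repeat_length]. }
    set (Q := B * M). assert (HQ0 : 0 <= Q) by (apply Rmult_le_pos; auto).
    set (q := fun n j => csum (box N n) (fun a => Cmul (h (j :: a)) (mono z a))).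
    assert (HQ : forall n j, Cmod (q n j) <= Q).
    { intros n j; unfold q. eapply Rle_trans; [apply Cmod_csum|].
      apply Rle_trans with (rsum (box N n) (fun a => B * Cmod (mono z a))).
      - apply rsum_box_le; intros a Ha. rewrite Cmod_mul.
        apply Rmult_le_compat_r; [apply Cmod_nonneg|]. apply HB; simpl; auto.
      - rewrite rsum_scal. apply Rmult_le_compat_l; auto. }
    assert (Hq0 : forall n j, (j < k)%nat -> q n j = C0).
    { intros n j Hj; unfold q. rewrite (csum_box_ext _ _ _ (fun a => Cmul C0 (mono z a))).
      - rewrite csum_scal; ring.
      - intros a Ha. now rewrite (IHk j Hj a Ha). }
    change (Ccv (fun n => q n k) C0). apply Ccv_Cmod. intros eta Heta.
    assert (HD : 0 < eta / (4 * (Q + 1))) by (apply Rdiv_lt_0_compat; lra).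
    (* e is fixed before n: it makes the remainder 2 e Q at most eta / 2 for all n at once. *)
    set (e := Rmin (1 / 2) (eta / (4 * (Q + 1)))).
    assert (He : 0 < e <= 1 / 2) by (unfold e; split; [apply Rmin_glb_lt; lra|apply Rmin_l]).
    assert (He2 : 2 * e * Q <= eta / 2).
    { assert (e <= eta / (4 * (Q + 1))) by apply Rmin_r.
      assert (eta / (4 * (Q + 1)) * (4 * (Q + 1)) = eta) by (field; lra). nra. }
    assert (Hez : inD (S N) (RtoC e :: z)).
    { apply inD_cons; split; auto. rewrite Cmod_RtoC_nonneg; lra. }
    assert (HE := H _ Hez). apply Ccv_Cmod in HE.
    assert (Hek : 0 < e ^ k) by (apply pow_lt; lra).
    (* The tolerance carries e^k because the final estimate is divided by e^k. *)
    destruct (HE (eta / 2 * e ^ k)) as [n0 Hn0]; [apply Rmult_lt_0_compat; lra|].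
    exists (max n0 k); intros n Hn. specialize (Hn0 n ltac:(lia)).
    unfold Rdist in *. rewrite Rminus_0_r, Rabs_right in * by (apply Rle_ge, Cmod_nonneg).
    replace (Csub (q n k) C0) with (q n k) by ring.
    set (E := csum (box (S N) n) (fun a => Cmul (h a) (mono (RtoC e :: z) a))) in *.
    replace (Csub E C0) with E in Hn0 by ring.
    assert (EE : E = Csum (fun j => Cmul (RtoC (e ^ j)) (q n j)) n).
    { unfold E; rewrite csum_box_S. apply Csum_ext; intros j _. unfold q.
      rewrite <- csum_scal. apply csum_box_ext; intros a _. simpl mono.
      rewrite Cpow_RtoC; ring. }
    pose proof (geom_tail_bound (q n) e Q k n He (HQ n) (Hq0 n) ltac:(lia)) as T.
    rewrite <- EE in T.
    assert (P : 0 < e ^ S n) by (apply pow_lt; lra).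
    assert (F : Cmod (Cmul (RtoC (e ^ k)) (q n k)) <= Cmod E + Q * (2 * e ^ S k)).
    { replace (Cmul (RtoC (e ^ k)) (q n k))
        with (Csub E (Csub E (Cmul (RtoC (e ^ k)) (q n k)))) by ring.
      eapply Rle_trans; [apply Cmod_sub|]. nra. }
    rewrite Cmod_mul, Cmod_RtoC_nonneg in F by lra.
    apply Rmult_lt_reg_l with (e ^ k); auto.
    change (e ^ S k) with (e * e ^ k) in F. nra.
Qed.

(** * The Hardy space norm *)

Lemma H2sqnorm_lub (N : nat) (f : coeffs) : inH2 N f ->
  is_lub (fun x => exists n, x = rsum (box N n) (fun a => Csq (f a))) (H2sqnorm N f).
Proof.
  intros [M HM]. unfold H2sqnorm. apply epsilon_spec.
  destruct (completeness (fun x => exists n, x = rsum (box N n) (fun a => Csq (f a)))) as [l Hl].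
  - exists M; intros x [n ->]; apply HM.
  - exists (rsum (box N 0) (fun a => Csq (f a))); eauto.
  - eauto.
Qed.

Lemma H2sqnorm_ge (N n : nat) (f : coeffs) : inH2 N f ->
  rsum (box N n) (fun a => Csq (f a)) <= H2sqnorm N f.
Proof. intros H; apply (H2sqnorm_lub N f H); eauto. Qed.

Lemma H2sqnorm_le (N : nat) (f : coeffs) (M : R) :
  (forall n, rsum (box N n) (fun a => Csq (f a)) <= M) -> inH2 N f /\ H2sqnorm N f <= M.
Proof.
  intros H. assert (I : inH2 N f) by (exists M; auto). split; auto.
  apply (H2sqnorm_lub N f I). intros x [n ->]; auto.
Qed.

Lemma H2sqnorm_nonneg (N : nat) (f : coeffs) : inH2 N f -> 0 <= H2sqnorm N f.
Proof.
  intros H; eapply Rle_trans; [|apply (H2sqnorm_ge N 0 f H)].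
  apply rsum_box_nonneg; intros; apply Csq_nonneg.
Qed.

Lemma H2sqnorm_term (N : nat) (f : coeffs) (a : list nat) : inH2 N f -> length a = N ->
  Csq (f a) <= H2sqnorm N f.
Proof.
  intros H Ha. destruct (rsum_box_term N (fun a => Csq (f a)) a) as [n Hn]; auto.
  - intros; apply Csq_nonneg.
  - eapply Rle_trans; [exact Hn|apply H2sqnorm_ge; auto].
Qed.

Lemma H2norm_nonneg (N : nat) (f : coeffs) : 0 <= H2norm N f.
Proof. apply sqrt_pos. Qed.

Lemma Cmod_le_H2norm (N : nat) (f : coeffs) (a : list nat) : inH2 N f -> length a = N ->
  Cmod (f a) <= H2norm N f.
Proof. intros; apply sqrt_le_1_alt, H2sqnorm_term; auto. Qed.

Lemma H2norm_sq (N : nat) (f : coeffs) : inH2 N f -> H2norm N f * H2norm N f = H2sqnorm N f.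
Proof. intros; apply sqrt_sqrt, H2sqnorm_nonneg; auto. Qed.

Lemma H2_ext (N : nat) (f g : coeffs) : (forall a, length a = N -> f a = g a) ->
  (inH2 N f -> inH2 N g) /\ H2sqnorm N f = H2sqnorm N g.
Proof.
  intros H.
  (* [H2sqnorm] is an [epsilon] of a predicate, so its two instances are identified by equating the
     box sums as functions of n. *)
  assert (E : (fun n => rsum (box N n) (fun a => Csq (f a)))
            = (fun n => rsum (box N n) (fun a => Csq (g a)))).
  { extensionality n. apply rsum_box_ext; intros; now rewrite H. }
  split.
  - intros [M HM]; exists M; intros n. specialize (HM n).
    now rewrite <- (equal_f E n).
  - unfold H2sqnorm.
    change (epsilon (inhabits 0) (fun S => is_lub (fun x => exists n, x =
        (fun n => rsum (box N n) (fun a => Csq (f a))) n) S) =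
      epsilon (inhabits 0) (fun S => is_lub (fun x => exists n, x =
        (fun n => rsum (box N n) (fun a => Csq (g a))) n) S)).
    now rewrite E.
Qed.

Lemma H2norm_ext (N : nat) (f g : coeffs) : (forall a, length a = N -> f a = g a) ->
  H2norm N f = H2norm N g.
Proof. intros H; unfold H2norm; now rewrite (proj2 (H2_ext N f g H)). Qed.

Lemma inH2_fadd (N : nat) (f g : coeffs) : inH2 N f -> inH2 N g -> inH2 N (fadd f g).
Proof.
  intros [M HM] [M' HM']. exists (2 * M + 2 * M'); intros n.
  eapply Rle_trans; [apply rsum_box_le; intros; apply Csq_add_le|].
  rewrite rsum_add, !rsum_scal. specialize (HM n); specialize (HM' n); lra.
Qed.

Lemma inH2_fsub (N : nat) (f g : coeffs) : inH2 N f -> inH2 N g -> inH2 N (fsub f g).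
Proof.
  intros [M HM] [M' HM']. exists (2 * M + 2 * M'); intros n.
  eapply Rle_trans; [apply rsum_box_le; intros; apply Csq_sub_le|].
  rewrite rsum_add, !rsum_scal. specialize (HM n); specialize (HM' n); lra.
Qed.

Lemma inH2_fscal (N : nat) (l : C) (f : coeffs) : inH2 N f -> inH2 N (fscal l f).
Proof.
  intros [M HM]. exists (Csq l * M); intros n.
  rewrite (rsum_box_ext _ _ _ (fun a => Csq l * Csq (f a))) by (intros; apply Csq_mul).
  rewrite rsum_scal. apply Rmult_le_compat_l; [apply Csq_nonneg|auto].
Qed.

Lemma inH2_series_val (N : nat) (f : coeffs) (z : list C) : inH2 N f -> inD N z ->
  series_val N (fun a => Cmul (f a) (mono z a)) (H2val N f z).
Proof.
  intros Hf Hz. unfold H2val. apply epsilon_spec.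
  destruct (bounded_box_bound N z f (H2norm N f) Hz) as [M [_ HM]].
  - intros; apply Cmod_le_H2norm; auto.
  - eapply abs_series_val; exact HM.
Qed.

Lemma H2val_eq (N : nat) (f : coeffs) (z : list C) (v : C) : inH2 N f -> inD N z ->
  series_val N (fun a => Cmul (f a) (mono z a)) v -> H2val N f z = v.
Proof.
  intros Hf Hz H. exact (Ccv_unique _ _ _ (inH2_series_val N f z Hf Hz) H).
Qed.

(** [comp_fun] is known only through values on the polydisk; this turns them into coefficients. *)
Lemma H2_coeffs_unique (N : nat) (f g : coeffs) : inH2 N f -> inH2 N g ->
  (forall z, inD N z -> H2val N f z = H2val N g z) ->
  forall a, length a = N -> f a = g a.
Proof.
  intros Hf Hg H a Ha.
  assert (E : fsub f g a = C0).
  { assert (I := inH2_fsub N f g Hf Hg).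
    apply (coeffs_zero N (fsub f g) (H2norm N (fsub f g))); auto.
    - intros; apply Cmod_le_H2norm; auto.
    - intros z Hz.
      replace C0 with (Csub (H2val N f z) (H2val N g z)) by (rewrite H by auto; ring).
      refine (Ccv_ext_ev _ _ _ 0 _ (Ccv_sub _ _ _ _ (inH2_series_val N f z Hf Hz)
        (inH2_series_val N g z Hg Hz))).
      intros n _; simpl. rewrite <- csum_sub. apply csum_box_ext; intros.
      unfold fsub; ring. }
  unfold fsub in E. replace (f a) with (Cadd (Csub (f a) (g a)) (g a)) by ring.
  rewrite E; ring.
Qed.

(** * The maps and their coefficient operators *)

Definition Phi (d : nat) (b : bool) (p : nat -> R) (z : list C) : list C :=
  match z with
  | z1 :: z2 :: _ =>
      let y := Cmul z2 (psi p z1) in y :: (if b then y else C0) :: repeat C0 d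
  | _ => z
  end.

Notation zs d := (repeat 0%nat d).

(* The coefficient of [w ^ k] in [f (w, 0, ..., 0)], respectively [f (w, w, 0, ..., 0)]. *)
Definition level (d : nat) (b : bool) (f : coeffs) (k : nat) : C :=
  if b then Csum (fun j => f (j :: (k - j)%nat :: zs d)) k else f (k :: 0%nat :: zs d).

(* The coefficients of [sum_k c_k y ^ k]. *)
Definition syn (d : nat) (p : nat -> R) (c : nat -> C) : coeffs := fun a =>
  match a with
  | i :: k :: r =>
      if list_eq_dec Nat.eq_dec r (zs d) then Cmul (RtoC (pcoef p k i)) (c k) else C0
  | _ => C0
  end.

(** The composition operator read on coefficients: f composed with [Phi] is the sum over k of
    [level d b f k] times y^k. *)
Definition Top (d : nat) (b : bool) (p : nat -> R) : Op := fun f => syn d p (level d b f).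

(** The partial sums, in n, of ||psi^k||^2. *)
Definition energy (p : nat -> R) (k n : nat) : R :=
  sum_f_R0 (fun i => pcoef p k i * pcoef p k i) n.

(** The Cauchy-Schwarz loss in adding up the k + 1 coefficients of degree k, absent when a single
    coefficient is read. *)
Definition wt (b : bool) (k : nat) : R := if b then INR (S k) else 1.

(** The share of ||f||^2 that [level] reads at k. *)
Definition mass (d : nat) (b : bool) (f : coeffs) (k : nat) : R :=
  if b then sum_f_R0 (fun j => Csq (f (j :: (k - j)%nat :: zs d))) k
  else Csq (f (k :: 0%nat :: zs d)).

Lemma wt_ge1 (b : bool) (k : nat) : 1 <= wt b k <= INR (S k).
Proof. rewrite S_INR; pose proof (pos_INR k); destruct b; unfold wt; rewrite ?S_INR; lra. Qed.

Lemma energy_nonneg (p : nat -> R) (k n : nat) : 0 <= energy p k n.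
Proof. apply sum_nonneg; intros; apply Rle_0_sqr. Qed.

Lemma mass_nonneg (d : nat) (b : bool) (f : coeffs) (k : nat) : 0 <= mass d b f k.
Proof. unfold mass; destruct b; [apply sum_nonneg; intros|]; apply Csq_nonneg. Qed.

Lemma Csq_Csum (u : nat -> C) (n : nat) :
  Csq (Csum u n) <= INR (S n) * sum_f_R0 (fun i => Csq (u i)) n.
Proof.
  rewrite Csum_parts. unfold Csq; simpl fst; simpl snd. rewrite plus_sum.
  pose proof (sum_sq_Cauchy (fun i => fst (u i)) n).
  pose proof (sum_sq_Cauchy (fun i => snd (u i)) n). lra.
Qed.

Lemma level_le (d : nat) (b : bool) (f : coeffs) (k : nat) :
  Csq (level d b f k) <= wt b k * mass d b f k.
Proof.
  unfold level, wt, mass; destruct b; [apply Csq_Csum|lra].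
Qed.

Lemma rsum_box_ge_zeros (d n : nat) (u : list nat -> R) : (forall a, 0 <= u a) ->
  u (zs d) <= rsum (box d n) u.
Proof.
  intros P. set (v := fun a => if list_eq_dec Nat.eq_dec a (zs d) then u a else 0).
  apply Rle_trans with (rsum (box d n) v).
  - rewrite rsum_box_zeros; unfold v.
    + destruct (list_eq_dec Nat.eq_dec (zs d) (zs d)); [lra|tauto].
    + intros a _ Hne. destruct (list_eq_dec Nat.eq_dec a (zs d)); tauto.
  - apply rsum_box_le; intros a _; unfold v. specialize (P a).
    destruct (list_eq_dec Nat.eq_dec a (zs d)); lra.
Qed.

Lemma mass_sum_le (d : nat) (b : bool) (f : coeffs) (n : nat) : inH2 (S (S d)) f ->
  sum_f_R0 (mass d b f) n <= H2sqnorm (S (S d)) f.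
Proof.
  intros H. eapply Rle_trans; [|apply (H2sqnorm_ge _ n f H)].
  set (u := fun i k => Csq (f (i :: k :: zs d))).
  assert (P : forall i k, 0 <= u i k) by (intros; apply Csq_nonneg).
  apply Rle_trans with (sum_f_R0 (fun i => sum_f_R0 (u i) n) n).
  - unfold mass; destruct b.
    + rewrite (sum_triangle u). apply sum_Rle; intros; apply sum_mono; auto; lia.
    + apply sum_Rle; intros i Hi. apply (sum_term (u i) 0); auto; lia.
  - rewrite rsum_box_S. apply sum_Rle; intros i _.
    rewrite rsum_box_S. apply sum_Rle; intros k _.
    apply (rsum_box_ge_zeros d n (fun a => Csq (f (i :: k :: a)))). intros; apply Csq_nonneg.
Qed.

Lemma syn_eq (d : nat) (p : nat -> R) (c : nat -> C) (i k : nat) :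
  syn d p c (i :: k :: zs d) = Cmul (RtoC (pcoef p k i)) (c k).
Proof. simpl. destruct (list_eq_dec Nat.eq_dec (zs d) (zs d)); tauto. Qed.

Lemma syn_tail (d : nat) (p : nat -> R) (c : nat -> C) (i k : nat) (a : list nat) :
  a <> zs d -> syn d p c (i :: k :: a) = C0.
Proof. intros H. simpl. destruct (list_eq_dec Nat.eq_dec a (zs d)); tauto. Qed.

(** The exponent of z_2 is the index k of the power of y, so distinct k occupy disjoint coefficients
    and no cross term appears. *)
Lemma syn_rsum (d n : nat) (p : nat -> R) (c : nat -> C) :
  rsum (box (S (S d)) n) (fun a => Csq (syn d p c a)) =
  sum_f_R0 (fun k => Csq (c k) * energy p k n) n.
Proof.
  rewrite rsum_box2.
  - rewrite sum_switch. apply sum_ext; intros k _. unfold energy. rewrite <- sum_scal.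
    apply sum_ext; intros i _. rewrite syn_eq, Csq_mul, Csq_RtoC. ring.
  - intros i k a _ Ha. rewrite syn_tail by auto. unfold Csq; simpl; ring.
Qed.

Lemma syn_H2 (d : nat) (p : nat -> R) (c : nat -> C) (v : nat -> R) (M : R) :
  (forall k n, Csq (c k) * energy p k n <= v k) -> (forall n, sum_f_R0 v n <= M) ->
  inH2 (S (S d)) (syn d p c) /\ H2sqnorm (S (S d)) (syn d p c) <= M.
Proof.
  intros H HM. apply H2sqnorm_le. intros n. rewrite syn_rsum.
  eapply Rle_trans; [apply sum_Rle; intros; apply H|apply HM].
Qed.

(** Levels are sent to multiples of orthogonal vectors, so a supremum over k controls the norm. The
    filter [chi] lets one estimate serve the whole operator, its truncation to k < n and the
    remainder. *)
Lemma level_syn_H2 (d : nat) (b : bool) (p : nat -> R) (f : coeffs) (chi : nat -> bool) (B : R) :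
  0 <= B -> inH2 (S (S d)) f ->
  (forall k n, chi k = true -> wt b k * energy p k n <= B) ->
  let g := syn d p (fun k => if chi k then level d b f k else C0) in
  inH2 (S (S d)) g /\ H2sqnorm (S (S d)) g <= B * H2sqnorm (S (S d)) f.
Proof.
  intros HB Hf H. apply syn_H2 with (v := fun k => B * mass d b f k).
  - intros k n. pose proof (mass_nonneg d b f k). pose proof (energy_nonneg p k n).
    destruct (chi k) eqn:E.
    + pose proof (level_le d b f k). specialize (H k n E).
      apply Rle_trans with (wt b k * mass d b f k * energy p k n); [nra|].
      replace (wt b k * mass d b f k * energy p k n)
        with (wt b k * energy p k n * mass d b f k) by ring. nra.
    + unfold Csq; simpl. nra.
  - intros n. rewrite sum_scal. apply Rmult_le_compat_l; auto. apply mass_sum_le; auto.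
Qed.

Lemma level_fadd (d : nat) (b : bool) (f g : coeffs) (k : nat) :
  level d b (fadd f g) k = Cadd (level d b f k) (level d b g k).
Proof. unfold level; destruct b; [apply Csum_add|reflexivity]. Qed.

Lemma level_fscal (d : nat) (b : bool) (l : C) (f : coeffs) (k : nat) :
  level d b (fscal l f) k = Cmul l (level d b f k).
Proof. unfold level; destruct b; [apply Csum_scal|reflexivity]. Qed.

Lemma syn_fadd (d : nat) (p : nat -> R) (c e : nat -> C) :
  syn d p (fun k => Cadd (c k) (e k)) = fadd (syn d p c) (syn d p e).
Proof.
  extensionality a. unfold fadd, syn. destruct a as [|i [|k r]]; try ring.
  destruct (list_eq_dec Nat.eq_dec r (zs d)); ring.
Qed.

Lemma syn_fscal (d : nat) (p : nat -> R) (l : C) (c : nat -> C) :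
  syn d p (fun k => Cmul l (c k)) = fscal l (syn d p c).
Proof.
  extensionality a. unfold fscal, syn. destruct a as [|i [|k r]]; try ring.
  destruct (list_eq_dec Nat.eq_dec r (zs d)); ring.
Qed.

Lemma syn_fsub (d : nat) (p : nat -> R) (c e : nat -> C) :
  syn d p (fun k => Csub (c k) (e k)) = fsub (syn d p c) (syn d p e).
Proof.
  extensionality a. unfold fsub, syn. destruct a as [|i [|k r]]; try ring.
  destruct (list_eq_dec Nat.eq_dec r (zs d)); ring.
Qed.

Lemma syn_ext (d : nat) (p : nat -> R) (c e : nat -> C) :
  (forall k, c k = e k) -> syn d p c = syn d p e.
Proof. intros H. f_equal. extensionality k; auto. Qed.

Definition trunc (d : nat) (b : bool) (p : nat -> R) (chi : nat -> bool) : Op :=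
  fun f => syn d p (fun k => if chi k then level d b f k else C0).

Lemma trunc_bounded_op (d : nat) (b : bool) (p : nat -> R) (chi : nat -> bool) (B : R) :
  0 <= B -> (forall k n, chi k = true -> wt b k * energy p k n <= B) ->
  bounded_op (S (S d)) (trunc d b p chi).
Proof.
  intros HB H. split; [|split; [split|]].
  - intros f Hf. apply (level_syn_H2 d b p f chi B); auto.
  - intros f g _ _ a _. unfold trunc. rewrite <- syn_fadd. refine (equal_f (syn_ext _ _ _ _ _) a).
    intros k. rewrite level_fadd. destruct (chi k); ring.
  - intros l f _ a _. unfold trunc. rewrite <- syn_fscal. refine (equal_f (syn_ext _ _ _ _ _) a).
    intros k. rewrite level_fscal. destruct (chi k); ring.
  - exists (sqrt B). intros f Hf. destruct (level_syn_H2 d b p f chi B HB Hf H) as [_ K].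
    unfold H2norm. rewrite <- sqrt_mult; auto using H2sqnorm_nonneg.
    apply sqrt_le_1_alt, K.
Qed.

Lemma Top_trunc (d : nat) (b : bool) (p : nat -> R) : Top d b p = trunc d b p (fun _ => true).
Proof. reflexivity. Qed.

(** * The composition operator *)

Lemma mono_zeros (d : nat) (z : list C) : length z = d -> mono z (zs d) = C1.
Proof.
  intros <-; induction z as [|c z IH]; simpl; [reflexivity|]. rewrite IH; ring.
Qed.

Lemma mono_C0_tail (d : nat) (a : list nat) : length a = d -> a <> zs d ->
  mono (repeat C0 d) a = C0.
Proof.
  revert a; induction d as [|d IH]; intros [|k a] H Hne; try discriminate.
  - now elim Hne.
  - injection H as H. simpl. destruct k.
    + rewrite IH; auto; [ring|]. intros ->; now apply Hne.
    + simpl; ring.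
Qed.

(** k + 1 counts the pairs of sum k, so the series is the square of the geometric one. *)
Lemma sum_wgeom_le (r : R) (n : nat) : 0 <= r < 1 ->
  sum_f_R0 (fun k => INR (S k) * r ^ k) n <= / (1 - r) * / (1 - r).
Proof.
  intros Hr.
  assert (Hi : 0 < / (1 - r)) by (apply Rinv_0_lt_compat; lra).
  rewrite (sum_ext _ (fun k => sum_f_R0 (fun j => r ^ j * r ^ (k - j)) k)).
  - rewrite (sum_triangle (fun j l => r ^ j * r ^ l)).
    apply Rle_trans with (sum_f_R0 (fun j => / (1 - r) * r ^ j) n).
    + apply sum_Rle; intros j _. rewrite sum_scal, Rmult_comm.
      apply Rmult_le_compat_r; [apply pow_le; lra|apply sum_geom_le; auto].
    + rewrite sum_scal. apply Rmult_le_compat_l; [lra|apply sum_geom_le; auto].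
  - intros k _. rewrite (sum_ext _ (fun _ => r ^ k)).
    + rewrite sum_cte. ring.
    + intros j Hj. rewrite <- pow_add. f_equal; lia.
Qed.

Lemma level_abs_le (d : nat) (b : bool) (f : coeffs) (k : nat) : inH2 (S (S d)) f ->
  Cmod (level d b f k) <= INR (S k) * H2norm (S (S d)) f.
Proof.
  intros Hf. assert (H0 := H2norm_nonneg (S (S d)) f).
  assert (K : forall i j, Cmod (f (i :: j :: zs d)) <= H2norm (S (S d)) f).
  { intros; apply Cmod_le_H2norm; auto. simpl; now rewrite repeat_length. }
  unfold level; destruct b.
  - eapply Rle_trans; [apply Cmod_Csum|].
    eapply Rle_trans; [apply sum_Rle; intros; apply K|]. rewrite sum_cte; lra.
  - eapply Rle_trans; [apply K|]. rewrite S_INR. pose proof (pos_INR k). nra.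
Qed.

Lemma inD_Phi_y (p : nat -> R) (z1 z2 : C) : prob p -> Cmod z1 < 1 -> Cmod z2 < 1 ->
  Cmod (Cmul z2 (psi p z1)) < 1.
Proof.
  intros Hp H1 H2. destruct (psi_cv p z1 Hp) as [_ H]; [lra|]. rewrite Cmod_mul.
  pose proof (Cmod_nonneg z2); pose proof (Cmod_nonneg (psi p z1)). nra.
Qed.

Lemma level_series_cv (d : nat) (b : bool) (f : coeffs) (y : C) : inH2 (S (S d)) f ->
  Cmod y < 1 -> exists V, Ccv (Csum (fun k => Cmul (level d b f k) (Cpow y k))) V.
Proof.
  intros Hf Hy.
  destruct (Cseries_cv (fun k => Cmul (level d b f k) (Cpow y k))
    (H2norm (S (S d)) f * (/ (1 - Cmod y) * / (1 - Cmod y)))) as [V [HV _]]; [|eauto].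
  intros n. apply Rle_trans with
    (sum_f_R0 (fun k => H2norm (S (S d)) f * (INR (S k) * Cmod y ^ k)) n).
  - apply sum_Rle; intros k _. rewrite Cmod_mul, Cmod_pow.
    pose proof (level_abs_le d b f k Hf).
    assert (0 <= Cmod y ^ k) by apply pow_le, Cmod_nonneg.
    apply Rle_trans with (INR (S k) * H2norm (S (S d)) f * Cmod y ^ k); [|right; ring].
    apply Rmult_le_compat_r; auto.
  - rewrite sum_scal. apply Rmult_le_compat_l; [apply H2norm_nonneg|].
    apply sum_wgeom_le; split; [apply Cmod_nonneg|auto].
Qed.

(** For fixed k the sum over the exponent of z_1 tends to psi(z_1)^k, and the terms in k are
    dominated by a multiple of (k + 1) |z_2|^k. *)
Lemma series_val_Top (d : nat) (b : bool) (p : nat -> R) (f : coeffs) (z1 z2 : C) (z : list C)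
  (V : C) : prob p -> inH2 (S (S d)) f -> inD (S (S d)) (z1 :: z2 :: z) ->
  Ccv (Csum (fun k => Cmul (level d b f k) (Cpow (Cmul z2 (psi p z1)) k))) V ->
  series_val (S (S d)) (fun a => Cmul (Top d b p f a) (mono (z1 :: z2 :: z) a)) V.
Proof.
  intros Hp Hf Hz HV.
  assert (L : length z = d) by (destruct Hz as [L _]; simpl in L; lia).
  apply inD_cons in Hz as [H1 Hz]. apply inD_cons in Hz as [H2 _].
  set (K := H2norm (S (S d)) f). assert (HK : 0 <= K) by apply H2norm_nonneg.
  set (s := fun k n => Csum (fun i => Cmul (RtoC (pcoef p k i)) (Cpow z1 i)) n).
  apply Ccv_ext_ev with (n0 := 0%nat)
    (u := fun n => Csum (fun k => Cmul (Cmul (level d b f k) (Cpow z2 k)) (s k n)) n).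
  { intros n _. rewrite csum_box2.
    - rewrite Csum_switch. apply Csum_ext; intros k _. unfold s.
      rewrite <- Csum_scal. apply Csum_ext; intros i _. unfold Top. rewrite syn_eq.
      simpl mono. rewrite mono_zeros by auto. ring.
    - intros i k a _ Ha. unfold Top. rewrite syn_tail by auto. ring. }
  assert (S1 : forall k n, Cmod (s k n) <= 1).
  { intros k n; unfold s. eapply Rle_trans; [apply Cmod_Csum|].
    eapply Rle_trans; [|apply (pcoef_sum_le1 p k n Hp)].
    apply sum_Rle; intros i _. rewrite Cmod_mul, Cmod_pow.
    assert (P : 0 <= pcoef p k i) by (apply pcoef_nonneg, Hp).
    rewrite Cmod_RtoC_nonneg by auto.
    destruct (pow_le1 (Cmod z1) i) as [A' B']; [split; [apply Cmod_nonneg|lra]|]. nra. }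
  assert (Hdom : forall k w, Cmod w <= 1 ->
    Cmod (Cmul (Cmul (level d b f k) (Cpow z2 k)) w) <= K * (INR (S k) * Cmod z2 ^ k)).
  { intros k w Hw. rewrite !Cmod_mul, Cmod_pow.
    pose proof (level_abs_le d b f k Hf) as A. fold K in A.
    assert (P : 0 <= Cmod z2 ^ k) by apply pow_le, Cmod_nonneg.
    pose proof (Cmod_nonneg w). pose proof (Cmod_nonneg (level d b f k)).
    apply Rle_trans with (Cmod (level d b f k) * Cmod z2 ^ k).
    - assert (0 <= Cmod (level d b f k) * Cmod z2 ^ k) by (apply Rmult_le_pos; auto). nra.
    - apply Rle_trans with (INR (S k) * K * Cmod z2 ^ k); [|right; ring].
      apply Rmult_le_compat_r; auto. }
  apply Csum_tannery with
    (y := fun k => Cmul (Cmul (level d b f k) (Cpow z2 k)) (Cpow (psi p z1) k))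
    (v := fun k => K * (INR (S k) * Cmod z2 ^ k))
    (M := K * (/ (1 - Cmod z2) * / (1 - Cmod z2))).
  - auto.
  - intros k. apply Hdom. rewrite Cmod_pow. destruct (psi_cv p z1 Hp) as [_ B]; [lra|].
    apply pow_le1; split; [apply Cmod_nonneg|auto].
  - intros n; rewrite sum_scal. apply Rmult_le_compat_l; auto.
    apply sum_wgeom_le; split; [apply Cmod_nonneg|auto].
  - intros k. apply Ccv_scal. apply psi_pow_cv; auto; lra.
  - refine (Ccv_ext_ev _ _ _ 0 _ HV). intros n _. apply Csum_ext; intros k _.
    rewrite Cpow_mul; ring.
Qed.

(** The two truncations differ: [series_val] sums over squares j, k <= n, while the levels fill
    triangles j + k <= n. For the doubled coordinate the difference vanishes by dominated
    convergence. *)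
Lemma series_val_Phi (d : nat) (b : bool) (p : nat -> R) (f : coeffs) (z1 z2 : C) (z : list C)
  (V : C) : inH2 (S (S d)) f -> Cmod (Cmul z2 (psi p z1)) < 1 ->
  Ccv (Csum (fun k => Cmul (level d b f k) (Cpow (Cmul z2 (psi p z1)) k))) V ->
  series_val (S (S d)) (fun a => Cmul (f a) (mono (Phi d b p (z1 :: z2 :: z)) a)) V.
Proof.
  intros Hf. simpl Phi. generalize (Cmul z2 (psi p z1)); intros y Hy HV.
  set (y' := if b then y else C0).
  set (u := fun j k => Cmul (f (j :: k :: zs d)) (Cmul (Cpow y j) (Cpow y' k))).
  apply Ccv_ext_ev with (n0 := 0%nat) (u := fun n => Csum (fun j => Csum (u j) n) n).
  { intros n _. rewrite csum_box2.
    - apply Csum_ext; intros j _; apply Csum_ext; intros k _. unfold u; simpl mono.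
      rewrite (mono_zeros d) by apply repeat_length. ring.
    - intros i k a Ha Hne. simpl mono. rewrite (mono_C0_tail d) by auto. ring. }
  destruct b; unfold y' in *; clear y'.
  - set (K := H2norm (S (S d)) f). assert (HK : 0 <= K) by apply H2norm_nonneg.
    set (q := / (1 - Cmod y)).
    assert (Hq : 0 < q) by (apply Rinv_0_lt_compat; lra).
    assert (Y0 := Cmod_nonneg y).
    assert (Abs : forall j n, sum_f_R0 (fun k => Cmod (u j k)) n <= K * q * Cmod y ^ j).
    { intros j n. assert (P : 0 <= Cmod y ^ j) by (apply pow_le; auto).
      apply Rle_trans with (sum_f_R0 (fun k => K * Cmod y ^ j * Cmod y ^ k) n).
      - apply sum_Rle; intros k _. unfold u. rewrite !Cmod_mul, !Cmod_pow, <- Rmult_assoc.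
        assert (0 <= Cmod y ^ k) by (apply pow_le; auto).
        apply Rmult_le_compat_r; auto. apply Rmult_le_compat_r; auto.
        apply Cmod_le_H2norm; auto. simpl; now rewrite repeat_length.
      - rewrite sum_scal. replace (K * q * Cmod y ^ j) with (K * Cmod y ^ j * q) by ring.
        apply Rmult_le_compat_l; [apply Rmult_le_pos; auto|apply sum_geom_le; lra]. }
    apply Ccv_of_diff with (v := fun n => Csum (fun j => Csum (u j) (n - j)) n).
    + refine (Ccv_ext_ev _ _ _ 0 _ HV). intros n _. rewrite <- Csum_triangle.
      apply Csum_ext; intros k _. unfold level.
      rewrite (Csum_ext (fun j => u j (k - j)%nat)
                 (fun j => Cmul (Cpow y k) (f (j :: (k - j)%nat :: zs d)))).
      * rewrite Csum_scal; ring.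
      * intros j Hj. unfold u. rewrite <- Cpow_add. replace (j + (k - j))%nat with k by lia. ring.
    + apply Ccv_ext_ev with (n0 := 0%nat)
        (u := fun n => Csum (fun j => Csub (Csum (u j) n) (Csum (u j) (n - j))) n).
      { intros n _. apply Csum_sub. }
      apply Csum_tannery with (y := fun _ => C0) (v := fun j => 2 * (K * q) * Cmod y ^ j)
        (M := 2 * (K * q) * q).
      * intros n j _. eapply Rle_trans; [apply Cmod_sub|].
        pose proof (Rle_trans _ _ _ (Cmod_Csum (u j) n) (Abs j n)).
        pose proof (Rle_trans _ _ _ (Cmod_Csum (u j) (n - j)) (Abs j (n - j)%nat)). lra.
      * intros j. rewrite Cmod_C0. apply Rmult_le_pos; [|apply pow_le; auto].
        assert (0 <= K * q) by (apply Rmult_le_pos; lra). lra.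
      * intros n. rewrite sum_scal. apply Rmult_le_compat_l; [|apply sum_geom_le; lra].
        assert (0 <= K * q) by (apply Rmult_le_pos; lra). lra.
      (* For fixed j the row sums up to n and up to n - j have the same limit. *)
      * intros j. destruct (Cseries_cv (u j) _ (Abs j)) as [l [Hl _]].
        replace C0 with (Csub l l) by ring. apply Ccv_sub; auto.
        destruct Hl as [I1 I2]; split; simpl; intros e He;
          [destruct (I1 e He) as [M HM]|destruct (I2 e He) as [M HM]];
          exists (M + j)%nat; intros n Hn; apply HM; lia.
      * apply Ccv_ext_ev with (n0 := 0%nat) (2 := Ccv_const C0).
        intros n _; symmetry; apply Csum_zero; auto.
  - refine (Ccv_ext_ev _ _ _ 0 _ HV). intros n _. apply Csum_ext; intros j _.
    (* Only the exponent 0 of the second coordinate survives, since [Cpow C0 0] is [C1]. *)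
    rewrite (Csum_single _ 0); [unfold u, level; simpl; ring|lia|].
    intros [|k] Hk; [tauto|]. unfold u. rewrite Cpow_C0; ring.
Qed.

Lemma comp_rel_Top (d : nat) (b : bool) (p : nat -> R) (f : coeffs) : prob p ->
  inH2 (S (S d)) f -> inH2 (S (S d)) (Top d b p f) ->
  comp_rel (S (S d)) (Phi d b p) f (Top d b p f).
Proof.
  intros Hp Hf HT. split; auto. intros z Hz.
  destruct z as [|z1 [|z2 z]]; try (destruct Hz as [L _]; discriminate).
  assert (Hz' := Hz). apply inD_cons in Hz' as [H1 Hz']. apply inD_cons in Hz' as [H2 Hz'].
  assert (Hy := inD_Phi_y p z1 z2 Hp H1 H2).
  destruct (level_series_cv d b f _ Hf Hy) as [V HV].
  assert (HP : inD (S (S d)) (Phi d b p (z1 :: z2 :: z))).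
  { simpl. apply inD_cons; split; auto. apply inD_cons; split.
    - destruct b; auto. rewrite Cmod_C0; lra.
    - split; [apply repeat_length|]. apply Forall_forall; intros c Hc.
      apply repeat_spec in Hc; subst; rewrite Cmod_C0; lra. }
  rewrite (H2val_eq _ _ _ V HT Hz), (H2val_eq _ _ _ V Hf HP); auto.
  - apply series_val_Phi; auto.
  - apply series_val_Top; auto.
Qed.

(** Whatever [epsilon] selects has the same values as [Top], hence the same coefficients on
    multi-indices of the right length. *)
Lemma comp_fun_Top (d : nat) (b : bool) (p : nat -> R) (f : coeffs) : prob p ->
  inH2 (S (S d)) f -> inH2 (S (S d)) (Top d b p f) ->
  forall a, length a = S (S d) -> comp_fun (S (S d)) (Phi d b p) f a = Top d b p f a.
Proof.
  intros Hp Hf HT. assert (R1 := comp_rel_Top d b p f Hp Hf HT).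
  assert (R2 : comp_rel (S (S d)) (Phi d b p) f (comp_fun (S (S d)) (Phi d b p) f))
    by (unfold comp_fun; apply epsilon_spec; eauto).
  apply H2_coeffs_unique; [apply R2|auto|].
  intros z Hz. rewrite (proj2 R2 z Hz), (proj2 R1 z Hz). reflexivity.
Qed.

(** * Analyticity and images of the maps *)

(* [shiftC w k m] is the coefficient of [h ^ m] in [(w + h) ^ k]. *)
Fixpoint shiftC (w : C) (k m : nat) : C :=
  match k with
  | O => match m with O => C1 | S _ => C0 end
  | S k' => Cadd (Cmul w (shiftC w k' m)) (match m with O => C0 | S m' => shiftC w k' m' end)
  end.

Lemma Csum_shift (u : nat -> C) (h : C) (n : nat) :
  Csum (fun m => Cmul (match m with O => C0 | S m' => u m' end) (Cpow h m)) (S n)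
  = Cmul h (Csum (fun m => Cmul (u m) (Cpow h m)) n).
Proof. induction n as [|n IH]; [simpl; ring|]. simpl in *. rewrite IH. ring. Qed.

Lemma shiftC_sum (w h : C) (k n : nat) : (k <= n)%nat ->
  Csum (fun m => Cmul (shiftC w k m) (Cpow h m)) n = Cpow (Cadd w h) k.
Proof.
  revert n; induction k as [|k IH]; intros n L.
  - rewrite (Csum_single _ 0); [simpl; ring|lia|]. intros [|m] Hm; [tauto|simpl; ring].
  - destruct n as [|n]; [lia|]. simpl shiftC.
    rewrite (Csum_ext _ (fun m => Cadd (Cmul w (Cmul (shiftC w k m) (Cpow h m)))
      (Cmul (match m with O => C0 | S m' => shiftC w k m' end) (Cpow h m))))
      by (intros; ring).
    rewrite Csum_add, Csum_scal, Csum_shift, !IH by lia. simpl; ring.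
Qed.

(** The moduli are dominated by the binomial coefficients of (|w| + x)^k, through the same
    recursion. *)
Lemma shiftC_abs_sum (w : C) (x : R) (k n : nat) : 0 <= x ->
  sum_f_R0 (fun m => Cmod (shiftC w k m) * x ^ m) n <= (Cmod w + x) ^ k.
Proof.
  intros Hx. assert (W := Cmod_nonneg w). revert n; induction k as [|k IH]; intros n.
  - rewrite (sum_single _ 0); [simpl; rewrite Cmod_C1; lra|lia|].
    intros [|m] Hm; [tauto|simpl; rewrite Cmod_C0; ring].
  - set (t := fun m => match m with O => 0 | S m' => Cmod (shiftC w k m') end).
    assert (Sh : sum_f_R0 (fun m => t m * x ^ m) n <= x * (Cmod w + x) ^ k).
    { destruct n as [|n].
      - simpl. assert (0 <= (Cmod w + x) ^ k) by (apply pow_le; lra). nra.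
      - rewrite decomp_sum by lia. simpl Nat.pred.
        rewrite (sum_ext _ (fun m => x * (Cmod (shiftC w k m) * x ^ m)))
          by (intros; simpl; ring).
        rewrite sum_scal. simpl t. specialize (IH n). nra. }
    apply Rle_trans with
      (sum_f_R0 (fun m => Cmod w * (Cmod (shiftC w k m) * x ^ m) + t m * x ^ m) n).
    + apply sum_Rle; intros m _. rewrite <- Rmult_assoc, <- Rmult_plus_distr_r.
      apply Rmult_le_compat_r; [apply pow_le; auto|]. simpl shiftC.
      eapply Rle_trans; [apply Cmod_add|]. rewrite Cmod_mul. unfold t.
      destruct m; [rewrite Cmod_C0|]; lra.
    + rewrite plus_sum, sum_scal. specialize (IH n). simpl pow. nra.
Qed.

(** [analytic_on_D] asks for an expansion about every centre. The Taylor coefficients at w are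
    obtained by expanding each (w + h)^k and summing over k for a fixed power of h. *)
Lemma psi_recenter (p : nat -> R) (w : C) : prob p -> Cmod w < 1 ->
  exists c : nat -> C, forall h, Cmod w + Cmod h < 1 ->
    (forall n, sum_f_R0 (fun m => Cmod (Cmul (c m) (Cpow h m))) n <= 1) /\
    Ccv (Csum (fun m => Cmul (c m) (Cpow h m))) (psi p (Cadd w h)).
Proof.
  intros Hp Hw. assert (P0 := proj1 Hp). assert (W := Cmod_nonneg w).
  set (u := fun m k => Cmul (RtoC (p k)) (shiftC w k m)).
  assert (Ex : forall m, exists l, Ccv (Csum (u m)) l).
  (* A Cauchy estimate: |w| + rho = 1, so each shifted coefficient is at most rho^(-m). *)
  { intros m. set (rho := 1 - Cmod w). assert (Hr : 0 < rho ^ m) by (apply pow_lt; unfold rho; lra).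
    destruct (Cseries_cv (u m) (/ rho ^ m)) as [l [Hl _]]; [|eauto].
    intros n. apply Rle_trans with (sum_f_R0 (fun k => / rho ^ m * p k) n).
    - apply sum_Rle; intros k _. unfold u. rewrite Cmod_mul, Cmod_RtoC_nonneg, Rmult_comm by auto.
      apply Rmult_le_compat_r; auto.
      apply Rmult_le_reg_r with (rho ^ m); auto. rewrite Rinv_l by lra.
      apply Rle_trans with ((Cmod w + rho) ^ k).
      + eapply Rle_trans; [|apply (shiftC_abs_sum w rho k m); unfold rho; lra].
        apply (sum_term (fun m => Cmod (shiftC w k m) * rho ^ m)); auto.
        intros; apply Rmult_le_pos; [apply Cmod_nonneg|apply pow_le; unfold rho; lra].
      + replace (Cmod w + rho) with 1 by (unfold rho; ring). rewrite pow1; lra.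
    - rewrite sum_scal. rewrite <- (Rmult_1_r (/ rho ^ m)) at 2.
      apply Rmult_le_compat_l; [left; apply Rinv_0_lt_compat; auto|apply prob_sum_le1; auto]. }
  set (c := fun m => epsilon (inhabits C0) (Ccv (Csum (u m)))).
  assert (Hc : forall m, Ccv (Csum (u m)) (c m)) by (intros; apply epsilon_spec; auto).
  exists c. intros h Hh. assert (H0 := Cmod_nonneg h).
  assert (Habs : forall k n, sum_f_R0 (fun m => Cmod (shiftC w k m) * Cmod h ^ m) n <= 1).
  { intros k n. eapply Rle_trans; [apply shiftC_abs_sum; auto|].
    apply pow_le1; lra. }
  split.
  - intros n. apply Un_cv_le with
      (u := fun K => sum_f_R0 (fun m => Cmod (Cmul (Csum (u m) K) (Cpow h m))) n).
    + intros K. apply Rle_trans with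
        (sum_f_R0 (fun m => sum_f_R0 (fun k => p k * (Cmod (shiftC w k m) * Cmod h ^ m)) K) n).
      * apply sum_Rle; intros m _. rewrite Cmod_mul, Cmod_pow.
        eapply Rle_trans; [apply Rmult_le_compat_r; [apply pow_le; auto|apply Cmod_Csum]|].
        rewrite Rmult_comm, <- sum_scal. apply sum_Rle; intros k _. unfold u.
        rewrite Cmod_mul, Cmod_RtoC_nonneg by auto. right; ring.
      * rewrite sum_switch. apply Rle_trans with (sum_f_R0 p K); [|apply prob_sum_le1; auto].
        apply sum_Rle; intros k _. rewrite sum_scal. specialize (Habs k n). specialize (P0 k). nra.
    + apply (Un_cv_sum (fun K m => Cmod (Cmul (Csum (u m) K) (Cpow h m)))). intros m.
      apply Ccv_Cmod_lim, Ccv_mul; auto using Ccv_const.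
  - set (s := fun n k => Csum (fun m => Cmul (shiftC w k m) (Cpow h m)) n).
    assert (Swh : Cmod (Cadd w h) <= 1) by (pose proof (Cmod_add w h); lra).
    (* The weighted error of cutting (w + h)^k at order n in h; it is 0 for n >= k. *)
    set (x := fun n k => p k * Cmod (Csub (s n k) (Cpow (Cadd w h) k))).
    assert (S1 : forall n k, Cmod (s n k) <= 1).
    { intros n k; unfold s. eapply Rle_trans; [apply Cmod_Csum|].
      eapply Rle_trans; [|apply (Habs k n)]. apply sum_Rle; intros m _.
      rewrite Cmod_mul, Cmod_pow; lra. }
    apply Ccv_Cmod. intros e He.
    destruct (tannery x (fun k => 2 * p k) 2) with (e := e / 2) as [n0 Hn0]; [| | |lra|].
    + intros n k; unfold x. split; [apply Rmult_le_pos; auto; apply Cmod_nonneg|].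
      rewrite Rmult_comm. apply Rmult_le_compat_r; auto.
      eapply Rle_trans; [apply Cmod_sub|]. specialize (S1 n k). rewrite Cmod_pow.
      destruct (pow_le1 (Cmod (Cadd w h)) k); [split; auto; apply Cmod_nonneg|lra].
    + intros n; rewrite sum_scal. pose proof (prob_sum_le1 p n Hp); lra.
    + intros k. apply Un_cv_ext_ev with (n0 := k) (2 := Un_cv_const 0). intros n Hn.
      unfold x, s. rewrite shiftC_sum by auto.
      replace (Csub _ _) with C0 by ring. rewrite Cmod_C0; ring.
    + exists n0; intros n Hn. unfold Rdist.
      rewrite Rminus_0_r, Rabs_right by (apply Rle_ge, Cmod_nonneg).
      apply Rle_lt_trans with (e / 2); [|lra].
      (* With k cut at K both sums are finite and can be exchanged; the bound does not depend on K,
         which then tends to infinity. *)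
      apply Un_cv_le with (u := fun K => Cmod (Csub (Csum (fun m => Cmul (Csum (u m) K) (Cpow h m)) n)
        (Csum (fun k => Cmul (RtoC (p k)) (Cpow (Cadd w h) k)) K))).
      * intros K. eapply Rle_trans; [|apply (Hn0 n Hn K)].
        replace (Csum (fun m => Cmul (Csum (u m) K) (Cpow h m)) n)
          with (Csum (fun k => Cmul (RtoC (p k)) (s n k)) K).
        -- rewrite <- Csum_sub. eapply Rle_trans; [apply Cmod_Csum|].
           apply sum_Rle; intros k _. unfold x. right.
           replace (Csub (Cmul (RtoC (p k)) (s n k)) (Cmul (RtoC (p k)) (Cpow (Cadd w h) k)))
             with (Cmul (RtoC (p k)) (Csub (s n k) (Cpow (Cadd w h) k))) by ring.
           now rewrite Cmod_mul, Cmod_RtoC_nonneg by auto.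
        -- rewrite (Csum_ext _ (fun k => Csum (fun m => Cmul (u m k) (Cpow h m)) n)).
           ++ rewrite Csum_switch. apply Csum_ext; intros m _.
              rewrite (Csum_ext _ (fun k => Cmul (Cpow h m) (u m k))) by (intros; ring).
              rewrite Csum_scal; ring.
           ++ intros k _. unfold s. rewrite <- Csum_scal. apply Csum_ext; intros m _.
              unfold u; ring.
      * apply (Ccv_Cmod_lim (fun K => Csub _ _)), Ccv_sub.
        -- apply (Ccv_Csum (fun K m => Cmul (Csum (u m) K) (Cpow h m))). intros m.
           apply Ccv_mul; auto using Ccv_const.
        -- apply psi_cv; auto.
Qed.

Lemma analytic_ext (N : nat) (F G : list C -> C) : (forall z, inD N z -> F z = G z) ->
  analytic_on_D N F -> analytic_on_D N G.
Proof.
  intros E H w Hw. destruct (H w Hw) as [r [Hr [c Hc]]].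
  exists r; split; auto. exists c. intros z Hz Hzr. rewrite <- E by auto. auto.
Qed.

Lemma analytic_C0 (N : nat) : analytic_on_D N (fun _ => C0).
Proof.
  intros w Hw. exists 1; split; [lra|]. exists (fun _ => C0). intros z Hz _. split.
  - exists 0. intros n. rewrite (rsum_box_ext _ _ _ (fun _ => 0 * 0)).
    + rewrite rsum_scal; lra.
    + intros a _. rewrite Cmod_mul, Cmod_C0; ring.
  - apply Ccv_ext_ev with (n0 := 0%nat) (2 := Ccv_const C0). intros n _.
    rewrite csum_scal; ring.
Qed.

Lemma analytic_y (d : nat) (p : nat -> R) : prob p ->
  analytic_on_D (S (S d))
    (fun z => match z with z1 :: z2 :: _ => Cmul z2 (psi p z1) | _ => C0 end).
Proof.
  intros Hp w Hw.
  destruct w as [|w1 [|w2 w]]; try (destruct Hw as [L _]; discriminate).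
  assert (Lw : length w = d) by (destruct Hw as [L _]; simpl in L; lia).
  apply inD_cons in Hw as [Hw1 Hw]. apply inD_cons in Hw as [Hw2 _].
  destruct (psi_recenter p w1 Hp Hw1) as [c Hc].
  exists (1 - Cmod w1); split; [lra|].
  (* Coefficients of the factor z_2 = w_2 + h_2. *)
  set (q := fun k => match k with O => w2 | S O => C1 | _ => C0 end).
  exists (fun a => match a with
    | m :: k :: r => if list_eq_dec Nat.eq_dec r (zs d) then Cmul (c m) (q k) else C0
    | _ => C0 end).
  intros z Hz Hr.
  destruct z as [|z1 [|z2 z]]; try (destruct Hz as [L _]; discriminate).
  assert (Lz : length z = d) by (destruct Hz as [L _]; simpl in L; lia).
  specialize (Hr 0%nat ltac:(lia)). simpl in Hr.
  set (h1 := Csub z1 w1) in *. set (h2 := Csub z2 w2).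
  destruct (Hc h1 ltac:(lra)) as [Hc1 Hc2].
  replace (Cadd w1 h1) with z1 in Hc2 by (unfold h1; ring).
  assert (Hvs : vsub (z1 :: z2 :: z) (w1 :: w2 :: w) = h1 :: h2 :: vsub z w) by reflexivity.
  rewrite Hvs. clear Hvs. set (v := vsub z w).
  assert (Lv : length v = d).
  { unfold v, vsub. rewrite length_map, length_combine. lia. }
  assert (Q2 : forall i, (2 <= i)%nat -> q i = C0) by (intros [|[|i]] Hi; try lia; auto).
  split.
  - exists (Cmod w2 + Cmod h2). intros n. rewrite rsum_box2.
    + assert (Hq : sum_f_R0 (fun k => Cmod (Cmul (q k) (Cpow h2 k))) n <= Cmod w2 + Cmod h2).
      (* Passing to n + 1 makes both terms of w_2 + h_2 present even when n = 0. *)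
      { eapply Rle_trans; [apply (sum_mono _ n (S n)); [intros; apply Cmod_nonneg|lia]|].
        rewrite sum_two; [|lia|].
        - simpl. rewrite !Cmod_mul, Cmod_C1. lra.
        - intros i Hi. rewrite Q2 by auto. rewrite Cmod_mul, Cmod_C0; ring. }
      apply Rle_trans with (sum_f_R0 (fun i => (Cmod w2 + Cmod h2) *
        Cmod (Cmul (c i) (Cpow h1 i))) n).
      * apply sum_Rle; intros i _.
        rewrite (sum_ext _ (fun k => Cmod (Cmul (c i) (Cpow h1 i)) *
          Cmod (Cmul (q k) (Cpow h2 k)))).
        -- rewrite sum_scal, Rmult_comm. apply Rmult_le_compat_r; auto. apply Cmod_nonneg.
        -- intros k _. destruct (list_eq_dec Nat.eq_dec (zs d) (zs d)); [|tauto].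
           rewrite <- Cmod_mul. f_equal. simpl mono. rewrite mono_zeros by auto. ring.
      * rewrite sum_scal. specialize (Hc1 n).
        pose proof (Cmod_nonneg w2); pose proof (Cmod_nonneg h2). nra.
    + intros i k a _ Ha. destruct (list_eq_dec Nat.eq_dec a (zs d)); [tauto|].
      rewrite Cmod_mul, Cmod_C0; ring.
  (* From n = 1 on the box contains the linear term in h_2. *)
  - apply Ccv_ext_ev with (n0 := 1%nat)
      (u := fun n => Cmul z2 (Csum (fun m => Cmul (c m) (Cpow h1 m)) n)).
    + intros n Hn. rewrite csum_box2.
      * rewrite <- Csum_scal. apply Csum_ext; intros i _. rewrite Csum_two; auto.
        -- destruct (list_eq_dec Nat.eq_dec (zs d) (zs d)); [|tauto].
           simpl mono. rewrite mono_zeros by auto. unfold q, h2. simpl; ring.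
        -- intros k Hk. rewrite Q2 by auto.
           destruct (list_eq_dec Nat.eq_dec (zs d) (zs d)); ring.
      * intros i k a _ Ha. destruct (list_eq_dec Nat.eq_dec a (zs d)); [tauto|ring].
    + apply Ccv_scal, Hc2.
Qed.

Lemma Phi_self_map (d : nat) (b : bool) (p : nat -> R) : prob p ->
  analytic_self_map (S (S d)) (Phi d b p).
Proof.
  intros Hp. split.
  - intros z Hz.
    destruct z as [|z1 [|z2 z]]; try (destruct Hz as [L _]; discriminate).
    apply inD_cons in Hz as [H1 Hz]. apply inD_cons in Hz as [H2 _].
    assert (Hy := inD_Phi_y p z1 z2 Hp H1 H2). simpl.
    apply inD_cons; split; auto. apply inD_cons; split.
    + destruct b; auto. rewrite Cmod_C0; lra.
    + split; [apply repeat_length|]. apply Forall_forall; intros c Hc.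
      apply repeat_spec in Hc; subst; rewrite Cmod_C0; lra.
  - intros j Hj.
    assert (K : analytic_on_D (S (S d)) (fun z => if Nat.eqb j 0 || (Nat.eqb j 1 && b) then
      match z with z1 :: z2 :: _ => Cmul z2 (psi p z1) | _ => C0 end else C0)%bool).
    { destruct (Nat.eqb j 0 || (Nat.eqb j 1 && b))%bool;
        [apply analytic_y; auto|apply analytic_C0]. }
    refine (analytic_ext _ _ _ _ K). intros z Hz.
    destruct z as [|z1 [|z2 z]]; try (destruct Hz as [L _]; discriminate).
    destruct j as [|[|j]]; simpl; [reflexivity|destruct b; reflexivity|].
    symmetry; apply nth_repeat.
Qed.

Lemma Phi_image (d : nat) (b : bool) (p : nat -> R) (y : list C) : prob p ->
  (exists z, inD (S (S d)) z /\ Phi d b p z = y) <->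
  (exists c, Cmod c < 1 /\ y = c :: (if b then c else C0) :: repeat C0 d).
Proof.
  intros Hp; split.
  - intros [z [Hz <-]].
    destruct z as [|z1 [|z2 z]]; try (destruct Hz as [L _]; discriminate).
    apply inD_cons in Hz as [H1 Hz]. apply inD_cons in Hz as [H2 _].
    exists (Cmul z2 (psi p z1)); split; [apply inD_Phi_y; auto|reflexivity].
  - intros [c [Hc ->]].
    destruct (psi_real_near1 p (Cmod c) Hp Hc) as [r [x [Hr [Hx Hcx]]]].
    pose proof (Cmod_nonneg c).
    (* The preimage has z_1 = r and z_2 = c / psi(r), which lies in the disc because psi(r) >
       |c|. *)
    exists (RtoC r :: Cmul c (RtoC (/ x)) :: repeat C0 d). split.
    + apply inD_cons; split; [rewrite Cmod_RtoC_nonneg; lra|].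
      apply inD_cons; split.
      * assert (0 < / x) by (apply Rinv_0_lt_compat; lra).
        rewrite Cmod_mul, Cmod_RtoC_nonneg by lra.
        apply Rmult_lt_reg_r with x; [lra|]. rewrite Rmult_assoc, Rinv_l by lra. lra.
      * split; [apply repeat_length|]. apply Forall_forall; intros u Hu.
        apply repeat_spec in Hu; subst; rewrite Cmod_C0; lra.
    + simpl. rewrite Hx.
      replace (Cmul (Cmul c (RtoC (/ x))) (RtoC x)) with c; [reflexivity|].
      apply C_eq; unfold Cmul, RtoC; simpl; field; lra.
Qed.

Lemma Phi_same_image (d : nat) (b : bool) (p q : nat -> R) : prob p -> prob q ->
  same_image (S (S d)) (Phi d b p) (Phi d b q).
Proof. intros Hp Hq y. now rewrite !Phi_image. Qed.

(** * Approximation numbers *)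

(** An operator chosen by [epsilon] is determined only on inputs of finite norm and on multi-indices
    of length N, hence this restricted equality. *)
Definition agree (N : nat) (T0 T : Op) : Prop :=
  forall f, inH2 N f -> forall a, length a = N -> T0 f a = T f a.

Lemma bounded_op_agree (N : nat) (T0 T : Op) : agree N T0 T -> bounded_op N T -> bounded_op N T0.
Proof.
  intros A [B1 [[L1 L2] [M HM]]]. split; [|split; [split|]].
  - intros f Hf. apply (H2_ext N (T f) (T0 f)); auto. intros; symmetry; auto.
  - intros f g Hf Hg a Ha. unfold fadd at 2.
    rewrite !A by auto using inH2_fadd. apply L1; auto.
  - intros l f Hf a Ha. unfold fscal at 2.
    rewrite !A by auto using inH2_fscal. apply L2; auto.
  - exists M. intros f Hf. rewrite (H2norm_ext N (T0 f) (T f)); auto.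
Qed.

Lemma zero_bounded_op (N : nat) : bounded_op N (fun _ _ => C0).
Proof.
  assert (Z : forall n, rsum (box N n) (fun _ => Csq C0) <= 0).
  { intros n. rewrite (rsum_box_ext _ _ _ (fun _ => 0 * 0)).
    - rewrite rsum_scal; lra.
    - intros; unfold Csq; simpl; ring. }
  split; [|split; [split|]].
  - intros f _. exists 0; auto.
  - intros; unfold fadd; ring.
  - intros; unfold fscal; ring.
  - exists 0. intros f _. destruct (H2sqnorm_le N (fun _ => C0) 0 Z) as [_ K].
    unfold H2norm at 1. rewrite sqrt_neg_0 by auto. lra.
Qed.

Definition unit_vec (a0 : list nat) : coeffs :=
  fun a => if list_eq_dec Nat.eq_dec a a0 then C1 else C0.

Lemma unit_vec_H2 (N : nat) (a0 : list nat) :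
  inH2 N (unit_vec a0) /\ H2sqnorm N (unit_vec a0) <= 1.
Proof.
  apply H2sqnorm_le. intros n. revert a0; induction N as [|N IH]; intros a0.
  - simpl. unfold unit_vec. destruct (list_eq_dec Nat.eq_dec [] a0); unfold Csq; simpl; lra.
  - rewrite rsum_box_S.
    assert (Z : forall k, (forall a, k :: a <> a0) ->
      rsum (box N n) (fun a => Csq (unit_vec a0 (k :: a))) = 0).
    { intros k Hk. rewrite (rsum_box_ext _ _ _ (fun _ => 0 * 0)).
      - rewrite rsum_scal; ring.
      - intros a _. unfold unit_vec. specialize (Hk a).
        destruct (list_eq_dec Nat.eq_dec (k :: a) a0); [tauto|]. unfold Csq; simpl; ring. }
    destruct a0 as [|k0 a0].
    + rewrite sum_zero; [lra|]. intros k _; apply Z; discriminate.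
    + destruct (le_lt_dec k0 n) as [L|L].
      * rewrite (sum_single _ k0); auto.
        -- rewrite (rsum_box_ext _ _ _ (fun a => Csq (unit_vec a0 a))); [apply IH|].
           intros a _. unfold unit_vec.
           destruct (list_eq_dec Nat.eq_dec (k0 :: a) (k0 :: a0)) as [E|E];
             destruct (list_eq_dec Nat.eq_dec a a0) as [E'|E']; congruence.
        -- intros k Hk; apply Z; congruence.
      * rewrite sum_zero; [lra|]. intros k Hk; apply Z; intros a; intros E.
        injection E as E _. lia.
Qed.

Definition approx_set (N : nat) (T : Op) (n : nat) (t : R) : Prop :=
  exists Rop, bounded_op N Rop /\ rank_lt N Rop n /\
    forall f, inH2 N f -> H2norm N (fsub (T f) (Rop f)) <= t * H2norm N f.

Lemma unit_vec_norm_pos (N : nat) : 0 < H2norm N (unit_vec (repeat 0%nat N)).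
Proof.
  assert (I := proj1 (unit_vec_H2 N (repeat 0%nat N))).
  pose proof (Cmod_le_H2norm N _ (repeat 0%nat N) I (repeat_length _ _)) as K.
  unfold unit_vec at 1 in K.
  destruct (list_eq_dec Nat.eq_dec (repeat 0%nat N) (repeat 0%nat N)); [|tauto].
  rewrite Cmod_C1 in K. lra.
Qed.

(** The zero operator, of rank 0 < n + 1, makes the set nonempty, and testing on a nonzero vector
    bounds it below by 0. Completeness is applied to the opposite set. *)
Lemma approx_num_glb (N : nat) (T : Op) (n : nat) : bounded_op N T ->
  is_glb (approx_set N T (S n)) (approx_num N T (S n)).
Proof.
  intros [B1 [_ [M HM]]]. unfold approx_num. apply epsilon_spec.
  change (exists x, is_glb (approx_set N T (S n)) x).
  destruct (completeness (fun x => approx_set N T (S n) (- x))) as [l [Hl1 Hl2]].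
  - exists 0. intros x [Rop [_ [_ H]]].
    assert (Hu := unit_vec_norm_pos N).
    specialize (H _ (proj1 (unit_vec_H2 N (repeat 0%nat N)))).
    pose proof (H2norm_nonneg N (fsub (T (unit_vec (repeat 0%nat N))) (Rop (unit_vec (repeat 0%nat N))))).
    nra.
  - exists (- M). rewrite Ropp_involutive.
    exists (fun _ _ => C0). split; [apply zero_bounded_op|split].
    + exists []. simpl; split; [lia|split; auto]. intros f _; exists []; auto.
    + intros f Hf. rewrite (H2norm_ext N _ (T f)); auto.
      intros a _; unfold fsub; ring.
  - exists (- l). split.
    + intros x Hx. assert (- x <= l); [|lra]. apply Hl1. now rewrite Ropp_involutive.
    + intros b Hb. assert (l <= - b); [|lra]. apply Hl2. intros x Hx.
      specialize (Hb _ Hx). lra.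
Qed.

(** ** Lower bound *)

Definition lsum (ks : list nat) (F : nat -> C) : C := fold_right (fun k s => Cadd (F k) s) C0 ks.

Lemma lsum_app (l l' : list nat) (F : nat -> C) : lsum (l ++ l') F = Cadd (lsum l F) (lsum l' F).
Proof. induction l as [|a l IH]; simpl; [ring|rewrite IH; ring]. Qed.

Lemma lsum_ext (l : list nat) (F G : nat -> C) :
  (forall k, In k l -> F k = G k) -> lsum l F = lsum l G.
Proof.
  induction l as [|a l IH]; simpl; intros H; [reflexivity|]. rewrite H, IH; auto.
Qed.

Lemma lsum_comb (l : list nat) (F G : nat -> C) (c : C) :
  lsum l (fun k => Csub (F k) (Cmul (G k) c)) = Csub (lsum l F) (Cmul (lsum l G) c).
Proof. induction l as [|a l IH]; simpl; [ring|rewrite IH; ring]. Qed.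

Lemma lsum_seq (n : nat) (F : nat -> C) : lsum (seq 0 (S n)) F = Csum F n.
Proof.
  induction n as [|n IH]; [simpl; ring|].
  rewrite seq_S, lsum_app, IH. simpl; ring.
Qed.

(* Gaussian elimination of the last equation, by induction on the number [m] of equations. *)
Lemma kernel_vector (m : nat) (ks : list nat) (lam : nat -> nat -> C) :
  NoDup ks -> (m < length ks)%nat ->
  exists x : nat -> C, (exists k, In k ks /\ x k <> C0) /\
    forall l, (l < m)%nat -> lsum ks (fun k => Cmul (x k) (lam k l)) = C0.
Proof.
  assert (C10 : C1 <> C0) by (intros E; injection E; lra).
  revert ks lam; induction m as [|m IH]; intros ks lam ND L.
  - destruct ks as [|k ks]; [simpl in L; lia|]. exists (fun _ => C1). split; [|lia].
    exists k; simpl; auto.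
  - destruct (classic (exists k0, In k0 ks /\ lam k0 m <> C0)) as [[k0 [Hk0 H0]]|Hno].
    + apply in_split in Hk0 as [l1 [l2 ->]]. assert (ND' := NoDup_remove _ _ _ ND).
      destruct ND' as [ND1 Hnin].
      (* k0 is the pivot of the last equation: subtracting [mu k] times its column leaves m
         equations on one index fewer, and its own coefficient is then dictated by the last
         equation. *)
      set (mu := fun k => Cmul (lam k m) (Cinv (lam k0 m))).
      destruct (IH (l1 ++ l2) (fun k l => Csub (lam k l) (Cmul (mu k) (lam k0 l)))) as [x [[k [Hk Hxk]] Hx]];
        [auto|rewrite length_app in *; simpl in L; lia|].
      set (s := lsum (l1 ++ l2) (fun k => Cmul (x k) (mu k))).
      exists (fun k => if Nat.eq_dec k k0 then Csub C0 s else x k). split.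
      { exists k. split; [apply in_app_iff in Hk; apply in_app_iff; simpl; tauto|].
        destruct (Nat.eq_dec k k0) as [->|]; tauto. }
      assert (Red : forall l, lsum (l1 ++ k0 :: l2)
          (fun k => Cmul (if Nat.eq_dec k k0 then Csub C0 s else x k) (lam k l)) =
        Csub (lsum (l1 ++ l2) (fun k => Cmul (x k) (lam k l))) (Cmul s (lam k0 l))).
      { intros l. rewrite lsum_app. simpl lsum. destruct (Nat.eq_dec k0 k0); [|tauto].
        rewrite (lsum_ext l1 _ (fun k => Cmul (x k) (lam k l))),
          (lsum_ext l2 _ (fun k => Cmul (x k) (lam k l))), lsum_app; [ring| |];
          intros j Hj; destruct (Nat.eq_dec j k0) as [->|]; auto;
          elim Hnin; apply in_app_iff; tauto. }
      intros l Hl. rewrite Red. destruct (Nat.eq_dec l m) as [->|Hlm].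
      * assert (E : s = Cmul (lsum (l1 ++ l2) (fun k => Cmul (x k) (lam k m))) (Cinv (lam k0 m))).
        { unfold s, mu. generalize (l1 ++ l2). intros q; induction q as [|a q IHq]; simpl; [ring|].
          rewrite IHq; ring. }
        rewrite E. set (y := lsum _ _).
        replace (Cmul (Cmul y (Cinv (lam k0 m))) (lam k0 m))
          with (Cmul y (Cmul (lam k0 m) (Cinv (lam k0 m)))) by ring.
        rewrite Cmul_inv by auto. ring.
      * rewrite <- (Hx l) by lia. unfold s.
        rewrite <- lsum_comb. apply lsum_ext; intros; ring.
    + destruct (IH ks lam ND) as [x [Hx1 Hx2]]; [lia|]. exists x; split; auto.
      intros l Hl. destruct (Nat.eq_dec l m) as [->|]; [|apply Hx2; lia].
      rewrite (lsum_ext _ _ (fun _ => C0)).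
      * clear. induction ks as [|a ks IH]; simpl; [reflexivity|rewrite IH; ring].
      * intros k Hk. assert (E : lam k m = C0); [|rewrite E; ring].
        destruct (classic (lam k m = C0)); auto. elim Hno; eauto.
Qed.

Lemma lincomb_combination (n : nat) (x : nat -> C) (ls : nat -> list C) (es : list coeffs)
  (a : list nat) : (forall k, (k <= n)%nat -> length (ls k) = length es) ->
  (forall l, (l < length es)%nat -> Csum (fun k => Cmul (x k) (nth l (ls k) C0)) n = C0) ->
  Csum (fun k => Cmul (x k) (lincomb (ls k) es a)) n = C0.
Proof.
  revert ls; induction es as [|e es IH]; intros ls Hl H.
  - apply Csum_zero. intros k Hk. specialize (Hl k Hk).
    destruct (ls k); [simpl; ring|discriminate].
  - rewrite (Csum_ext _ (fun k => Cadd (Cmul (e a) (Cmul (x k) (nth 0 (ls k) C0)))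
      (Cmul (x k) (lincomb (tl (ls k)) es a)))).
    + rewrite Csum_add, Csum_scal, (H 0%nat) by (simpl; lia).
      rewrite IH; [ring| |].
      * intros k Hk. specialize (Hl k Hk). destruct (ls k); simpl in *; lia.
      * intros l Hll. transitivity (Csum (fun k => Cmul (x k) (nth (S l) (ls k) C0)) n);
          [|apply H; simpl; lia]. apply Csum_ext; intros k Hk.
        specialize (Hl k Hk). destruct (ls k); [discriminate|reflexivity].
    + intros k Hk. specialize (Hl k Hk). destruct (ls k) as [|y ys]; [discriminate|].
      simpl. unfold fadd, fscal. ring.
Qed.

(** A polynomial in z_1 alone, built from [fadd] and [fscal] so that the binary form of linearity
    applies step by step. *)
Fixpoint comb (d : nat) (x : nat -> C) (n : nat) : coeffs :=
  match n with
  | O => fscal (x O) (unit_vec (O :: O :: zs d))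
  | S n' => fadd (comb d x n') (fscal (x n) (unit_vec (n :: O :: zs d)))
  end.

Lemma comb_H2 (d : nat) (x : nat -> C) (n : nat) : inH2 (S (S d)) (comb d x n).
Proof.
  induction n as [|n IH]; simpl; [|apply inH2_fadd; auto]; apply inH2_fscal, unit_vec_H2.
Qed.

Lemma comb_op (d : nat) (Rop : Op) (x : nat -> C) (n : nat) (a : list nat) :
  bounded_op (S (S d)) Rop -> length a = S (S d) ->
  Rop (comb d x n) a = Csum (fun k => Cmul (x k) (Rop (unit_vec (k :: O :: zs d)) a)) n.
Proof.
  intros [_ [[L1 L2] _]] Ha. induction n as [|n IH]; simpl comb; simpl Csum.
  - rewrite L2; auto. apply unit_vec_H2.
  - rewrite L1; auto; [|apply comb_H2|apply inH2_fscal, unit_vec_H2].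
    unfold fadd. rewrite IH, L2; auto. apply unit_vec_H2.
Qed.

Lemma comb_val (d : nat) (x : nat -> C) (n i k : nat) (r : list nat) :
  comb d x n (i :: k :: r) =
  if le_dec i n then
    if list_eq_dec Nat.eq_dec (k :: r) (O :: zs d) then x i else C0
  else C0.
Proof.
  assert (U : forall j, unit_vec (j :: O :: zs d) (i :: k :: r) =
    if Nat.eq_dec i j then if list_eq_dec Nat.eq_dec (k :: r) (O :: zs d) then C1 else C0 else C0).
  { intros j. unfold unit_vec.
    destruct (list_eq_dec Nat.eq_dec (i :: k :: r) (j :: O :: zs d)) as [E|E];
      destruct (Nat.eq_dec i j) as [E'|E'];
      destruct (list_eq_dec Nat.eq_dec (k :: r) (O :: zs d)) as [E''|E'']; congruence. }
  induction n as [|n IH]; simpl comb; unfold fadd, fscal.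
  - rewrite U. destruct (Nat.eq_dec i 0) as [->|]; destruct (le_dec _ 0); try lia; try ring.
    destruct (list_eq_dec Nat.eq_dec (k :: r) (O :: zs d)); ring.
  - rewrite IH, U.
    destruct (le_dec i n); destruct (le_dec i (S n)); destruct (Nat.eq_dec i (S n)) as [->|];
      try lia; destruct (list_eq_dec Nat.eq_dec (k :: r) (O :: zs d)); ring.
Qed.

Lemma sum_truncated_le (u : nat -> R) (m n : nat) : (forall i, 0 <= u i) ->
  sum_f_R0 (fun i => if le_dec i n then u i else 0) m <= sum_f_R0 u n.
Proof.
  intros P. destruct (le_lt_dec m n) as [L|L].
  - rewrite (sum_ext _ u); [apply sum_mono; auto|].
    intros i Hi. destruct (le_dec i n); [auto|lia].
  - apply Nat.lt_le_incl in L. induction L as [|m L IH].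
    + right; apply sum_ext. intros i Hi. destruct (le_dec i n); [auto|lia].
    + simpl. destruct (le_dec (S m) n); [lia|lra].
Qed.

Lemma comb_sqnorm_le (d : nat) (x : nat -> C) (n : nat) :
  H2sqnorm (S (S d)) (comb d x n) <= sum_f_R0 (fun k => Csq (x k)) n.
Proof.
  apply H2sqnorm_le. intros m. rewrite rsum_box2.
  - eapply Rle_trans; [|apply (sum_truncated_le _ m n); intros; apply Csq_nonneg].
    right. apply sum_ext; intros i _. rewrite (sum_single _ 0); [|lia|].
    + rewrite comb_val. destruct (le_dec i n); [|unfold Csq; simpl; ring].
      destruct (list_eq_dec Nat.eq_dec (O :: zs d) (O :: zs d)); tauto.
    + intros k Hk. rewrite comb_val.
      destruct (list_eq_dec Nat.eq_dec (k :: zs d) (O :: zs d)) as [E|_]; [injection E; lia|].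
      destruct (le_dec i n); unfold Csq; simpl; ring.
  - intros i k a _ Ha. rewrite comb_val.
    destruct (list_eq_dec Nat.eq_dec (k :: a) (O :: zs d)) as [E|_]; [congruence|].
    destruct (le_dec i n); unfold Csq; simpl; ring.
Qed.

Lemma energy_mono (p : nat -> R) (k m n : nat) : (m <= n)%nat -> energy p k m <= energy p k n.
Proof. apply sum_mono; intros; apply Rle_0_sqr. Qed.

Lemma energy_common (p : nat -> R) (beta : R) (n : nat) :
  (forall k, (k <= n)%nat -> exists m, beta <= energy p k m) ->
  exists m, (n <= m)%nat /\ forall k, (k <= n)%nat -> beta <= energy p k m.
Proof.
  intros H.
  assert (K : forall j, (j <= n)%nat -> exists m, (n <= m)%nat /\
    forall k, (k <= j)%nat -> beta <= energy p k m).
  { induction j as [|j IH]; intros Hj.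
    - destruct (H 0%nat) as [m Hm]; [lia|]. exists (max n m); split; [lia|].
      intros k Hk. replace k with 0%nat by lia.
      eapply Rle_trans; [exact Hm|apply energy_mono; lia].
    - destruct IH as [m [Hm1 Hm2]]; [lia|]. destruct (H (S j)) as [m' Hm']; [lia|].
      exists (max m m'); split; [lia|]. intros k Hk.
      destruct (Nat.eq_dec k (S j)) as [->|].
      + eapply Rle_trans; [exact Hm'|apply energy_mono; lia].
      + eapply Rle_trans; [apply (Hm2 k); lia|apply energy_mono; lia]. }
  apply (K n); lia.
Qed.

(** Among the n + 1 monomials z_1^0, ..., z_1^n an operator of rank at most n kills a nonzero
    combination f. The images y^k are orthogonal with squared norms at least beta, so the difference
    still stretches f by at least sqrt beta. *)
Lemma approx_num_lower (d : nat) (p : nat -> R) (T0 : Op) (n : nat) (beta : R) :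
  bounded_op (S (S d)) T0 -> agree (S (S d)) T0 (Top d false p) -> 0 <= beta ->
  (forall k, (k <= n)%nat -> exists m, beta <= energy p k m) ->
  sqrt beta <= approx_num (S (S d)) T0 (S n).
Proof.
  intros HT HA Hb H. apply (approx_num_glb _ _ n HT).
  intros t [Rop [HR [[es [Les [_ Hes]]] Ht]]].
  (* The coordinates of the images of the monomials in a spanning family of the range become the
     coefficients of the linear system. *)
  destruct (choice (fun k ls => length ls = length es /\ forall a, length a = S (S d) ->
    Rop (unit_vec (k :: O :: zs d)) a = lincomb ls es a)) as [ls Hls].
  { intros k. destruct (Hes (unit_vec (k :: O :: zs d))) as [ls Hls]; [apply unit_vec_H2|eauto]. }
  destruct (kernel_vector (length es) (seq 0 (S n)) (fun k l => nth l (ls k) C0))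
    as [x [[k0 [Hk0 Hxk0]] Hx]]; [apply seq_NoDup|rewrite length_seq; lia|].
  apply in_seq in Hk0.
  set (f := comb d x n). assert (Hf : inH2 (S (S d)) f) by apply comb_H2.
  assert (HRf : forall a, length a = S (S d) -> Rop f a = C0).
  { intros a Ha. unfold f. rewrite comb_op by auto.
    rewrite (Csum_ext _ (fun k => Cmul (x k) (lincomb (ls k) es a))).
    - apply lincomb_combination; [intros; apply Hls|].
      intros l Hl. rewrite <- lsum_seq. apply Hx; auto.
    - intros k _. now rewrite (proj2 (Hls k) a Ha). }
  assert (HTf : H2norm (S (S d)) (fsub (T0 f) (Rop f)) = H2norm (S (S d)) (Top d false p f)).
  { apply H2norm_ext. intros a Ha. unfold fsub. rewrite HRf, HA by auto. ring. }
  specialize (Ht f Hf). rewrite HTf in Ht.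
  assert (IT : inH2 (S (S d)) (Top d false p f)).
  { apply (H2_ext _ (T0 f)); [intros; apply HA; auto|]. apply HT; auto. }
  destruct (energy_common p beta n H) as [m [Hm1 Hm2]].
  assert (Hlow : beta * sum_f_R0 (fun k => Csq (x k)) n <= H2sqnorm (S (S d)) (Top d false p f)).
  { eapply Rle_trans; [|apply (H2sqnorm_ge _ m _ IT)]. unfold Top. rewrite syn_rsum.
    eapply Rle_trans; [|apply (sum_mono _ n m); auto; intros; apply Rmult_le_pos;
      [apply Csq_nonneg|apply energy_nonneg]].
    rewrite <- sum_scal. apply sum_Rle; intros k Hk. unfold level, f. rewrite comb_val.
    destruct (le_dec k n); [|lia].
    destruct (list_eq_dec Nat.eq_dec (O :: zs d) (O :: zs d)); [|tauto].
    rewrite Rmult_comm. apply Rmult_le_compat_l; [apply Csq_nonneg|auto]. }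
  assert (Hn : sqrt beta * H2norm (S (S d)) f <= H2norm (S (S d)) (Top d false p f)).
  { unfold H2norm. rewrite <- sqrt_mult; auto using H2sqnorm_nonneg.
    apply sqrt_le_1_alt. eapply Rle_trans; [|exact Hlow].
    apply Rmult_le_compat_l; auto. apply comb_sqnorm_le. }
  assert (Hpos : 0 < H2norm (S (S d)) f).
  { apply Rlt_le_trans with (Cmod (f (k0 :: O :: zs d))).
    - unfold f. rewrite comb_val. destruct (le_dec k0 n); [|lia].
      destruct (list_eq_dec Nat.eq_dec (O :: zs d) (O :: zs d)); [|tauto].
      apply sqrt_lt_R0, Csq_pos, Hxk0.
    - apply Cmod_le_H2norm; auto. simpl; now rewrite repeat_length. }
  apply Rmult_le_reg_r with (H2norm (S (S d)) f); lra.
Qed.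

(** ** Upper bound *)

Lemma lincomb_app (ls ls' : list C) (es es' : list coeffs) (a : list nat) :
  length ls = length es ->
  lincomb (ls ++ ls') (es ++ es') a = Cadd (lincomb ls es a) (lincomb ls' es' a).
Proof.
  revert es; induction ls as [|l ls IH]; intros [|e es] H; try discriminate; simpl; [ring|].
  unfold fadd. rewrite IH by (simpl in H; lia). ring.
Qed.

Lemma syn_finite_lincomb (d : nat) (p : nat -> R) (c : nat -> C) (n : nat) (a : list nat) :
  syn d p (fun k => if (k <? n)%nat then c k else C0) a =
  lincomb (map c (seq 0 n))
    (map (fun k => syn d p (fun j => if Nat.eqb j k then C1 else C0)) (seq 0 n)) a.
Proof.
  induction n as [|n IH].
  - simpl. unfold syn. destruct a as [|i [|k r]]; auto.
    destruct (list_eq_dec Nat.eq_dec r (zs d)); ring.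
  - rewrite seq_S, !map_app, lincomb_app, <- IH by (now rewrite !length_map).
    simpl lincomb. unfold fadd at 1. simpl Nat.add.
    rewrite <- syn_fscal.
    match goal with |- _ = Cadd (?u a) (Cadd (?v a) C0) =>
      replace (Cadd (u a) (Cadd (v a) C0)) with (fadd u v a) by (unfold fadd; ring) end.
    rewrite <- syn_fadd. refine (equal_f (syn_ext _ _ _ _ _) a). intros k.
    destruct (Nat.ltb_spec k (S n)); destruct (Nat.ltb_spec k n); destruct (Nat.eqb_spec k n);
      try lia; subst; ring.
Qed.

(** Keeping the levels k < n gives rank at most n, and the remainder is governed by the weighted
    energies with k >= n. The cruder bound [B'] provides boundedness. *)
Lemma approx_num_upper (d : nat) (b : bool) (p : nat -> R) (T0 : Op) (n : nat) (B B' : R) :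
  agree (S (S d)) T0 (Top d b p) -> 0 <= B -> (forall k m, wt b k * energy p k m <= B') ->
  (forall k m, (n <= k)%nat -> wt b k * energy p k m <= B) ->
  approx_num (S (S d)) T0 (S n) <= sqrt B.
Proof.
  intros HA HB H' H.
  assert (HB' : 0 <= B').
  { eapply Rle_trans; [|apply (H' 0%nat 0%nat)]. apply Rmult_le_pos; [|apply energy_nonneg].
    pose proof (wt_ge1 b 0); lra. }
  assert (HT : bounded_op (S (S d)) T0).
  { apply (bounded_op_agree _ _ _ HA). rewrite Top_trunc. apply trunc_bounded_op with (B := B'); auto. }
  apply (approx_num_glb _ _ n HT).
  exists (trunc d b p (fun k => (k <? n)%nat)).
  split; [apply trunc_bounded_op with (B := B'); auto|split].
  - exists (map (fun k => syn d p (fun j => if Nat.eqb j k then C1 else C0)) (seq 0 n)).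
    rewrite length_map, length_seq. split; [lia|split].
    + apply Forall_forall. intros e He. apply in_map_iff in He as [k [<- _]].
      apply syn_H2 with (v := fun j => if Nat.eqb j k then B' else 0) (M := B').
      * intros j m. destruct (Nat.eqb j k); [|unfold Csq; simpl; lra].
        specialize (H' j m). pose proof (wt_ge1 b j). pose proof (energy_nonneg p j m).
        unfold Csq; simpl. nra.
      * intros m. destruct (le_lt_dec k m) as [L|L].
        -- rewrite (sum_single _ k); auto; [rewrite Nat.eqb_refl; lra|].
           intros i Hi. apply Nat.eqb_neq in Hi. now rewrite Hi.
        -- rewrite sum_zero; auto. intros i Hi. destruct (Nat.eqb_spec i k); [lia|auto].
    + intros f _. exists (map (level d b f) (seq 0 n)).
      rewrite length_map, length_seq. split; auto.
      intros a _. apply syn_finite_lincomb.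
  - intros f Hf.
    rewrite (H2norm_ext _ _ (trunc d b p (fun k => negb (k <? n)%nat) f)).
    + unfold H2norm. rewrite <- sqrt_mult by auto using H2sqnorm_nonneg.
      apply sqrt_le_1_alt. apply level_syn_H2; auto. intros k m Hk.
      apply H. destruct (Nat.ltb_spec k n); [discriminate|auto].
    + intros a Ha. unfold fsub. rewrite HA by auto. unfold Top, trunc.
      change (Csub (syn d p (level d b f) a) (syn d p (fun k => if (k <? n)%nat then level d b f k else C0) a))
        with (fsub (syn d p (level d b f)) (syn d p (fun k => if (k <? n)%nat then level d b f k else C0)) a).
      rewrite <- syn_fsub. refine (equal_f (syn_ext _ _ _ _ _) a). intros k.
      destruct (k <? n)%nat; simpl; ring.
Qed.

(** ** Compactness *)

Definition increasing (s : nat -> nat) : Prop := forall n, (s n < s (S n))%nat.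

Lemma increasing_ge (s : nat -> nat) (n : nat) : increasing s -> (n <= s n)%nat.
Proof. intros H; induction n as [|n IH]; [lia|]. specialize (H n); lia. Qed.

Lemma increasing_lt (s : nat -> nat) (m n : nat) : increasing s -> (m < n)%nat -> (s m < s n)%nat.
Proof.
  intros H L; induction L as [|n L IH]; [apply H|]. specialize (H n); lia.
Qed.

Lemma bounded_subseq (u : nat -> R) (M : R) : (forall n, Rabs (u n) <= M) ->
  exists s, increasing s /\ exists l, Un_cv (fun n => u (s n)) l.
Proof.
  intros B. destruct (Bolzano_Weierstrass u (fun c => - M <= c <= M)) as [l Hl].
  - apply compact_P3.
  - intros n. specialize (B n). pose proof (Rle_abs (u n)). pose proof (Rle_abs (- u n)).
    rewrite Rabs_Ropp in *; lra.
  (* [next] selects, from a given index on, a term within 1 / (n + 1) of the cluster point. *)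
  - destruct (choice (fun q s => (fst q <= s)%nat /\ Rabs (u s - l) < / INR (S (snd q))))
      as [next Hnext].
    { intros [N0 n]; simpl.
      assert (Hp : 0 < / INR (S n)) by (apply Rinv_0_lt_compat, lt_0_INR; lia).
      destruct (Hl (disc l (mkposreal _ Hp)) N0) as [q [Hq1 Hq2]].
      - exists (mkposreal _ Hp). intros x Hx; exact Hx.
      - exists q; split; auto. }
    set (s := fix s n := match n with O => next (0, 0)%nat | S n' => next (S (s n'), S n') end).
    exists s. split.
    + intros n. simpl. destruct (Hnext (S (s n), S n)) as [A _]. simpl in A. lia.
    + exists l. intros e He. destruct (archimed_cor1 e He) as [N0 [HN0 HN0']].
      exists N0. intros n Hn. unfold Rdist.
      assert (Hs : Rabs (u (s n) - l) < / INR (S n)) by (destruct n; apply Hnext).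
      apply Rlt_trans with (1 := Hs). apply Rle_lt_trans with (/ INR N0); auto.
      apply Rinv_le_contravar; [apply lt_0_INR; lia|apply le_INR; lia].
Qed.

Lemma diagonal_subseq (u : nat -> nat -> R) (M : nat -> R) : (forall k n, Rabs (u k n) <= M k) ->
  exists s, increasing s /\ exists l, forall k, Un_cv (fun n => u k (s n)) (l k).
Proof.
  intros B.
  destruct (choice (fun (q : nat * (nat -> nat)) t => increasing t /\
    exists l, Un_cv (fun n => u (fst q) (snd q (t n))) l)) as [next Hnext].
  { intros [k s]; simpl. apply (bounded_subseq (fun n => u k (s n)) (M k)); auto. }
  (* Nested extraction: [sg (S k)] refines [sg k] so that the sequence [u k] converges along it. *)
  set (sg := fix sg k := match k with
    | O => fun n => n
    | S k' => fun n => sg k' (next (k', sg k') n) end).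
  assert (Sinc : forall k, increasing (sg k)).
  { induction k as [|k IH]; intros n; simpl; [lia|].
    apply increasing_lt; auto. apply Hnext. }
  (* Later subsequences factor through [sg k], which lets the diagonal inherit the limits. *)
  assert (Sfac : forall k j, exists t, increasing t /\
    forall n, sg (k + j)%nat n = sg k (t n)).
  { intros k j; induction j as [|j [t [Ht1 Ht2]]].
    - exists (fun n => n). split; [intros n; lia|]. intros; now rewrite Nat.add_0_r.
    - exists (fun n => t (next ((k + j)%nat, sg (k + j)%nat) n)). split.
      + intros n. apply increasing_lt; auto. apply Hnext.
      + intros n. rewrite Nat.add_succ_r. simpl. apply Ht2. }
  exists (fun n => sg n n). split.
  - intros n. simpl. apply increasing_lt; auto.
    pose proof (increasing_ge _ (S n) (proj1 (Hnext (n, sg n)))). lia.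
  - destruct (choice (fun k l => Un_cv (fun n => u k (sg (S k) n)) l)) as [l Hl].
    { intros k. destruct (Hnext (k, sg k)) as [_ [l Hl]]. exists l; exact Hl. }
    exists l. intros k e He. destruct (Hl k e He) as [N0 HN0].
    exists (max N0 (S k)). intros n Hn.
    destruct (Sfac (S k) (n - S k)%nat) as [t [Ht1 Ht2]].
    replace (S k + (n - S k))%nat with n in Ht2 by lia.
    rewrite Ht2. apply HN0. pose proof (increasing_ge t n Ht1). lia.
Qed.

Lemma Csq_level_le (d : nat) (b : bool) (f : coeffs) (k : nat) (M : R) : inH2 (S (S d)) f ->
  H2norm (S (S d)) f <= M -> Csq (level d b f k) <= wt b k * (M * M).
Proof.
  intros Hf HM. eapply Rle_trans; [apply level_le|].
  apply Rmult_le_compat_l; [pose proof (wt_ge1 b k); lra|].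
  eapply Rle_trans; [apply (sum_term (mass d b f) k k); auto; intros; apply mass_nonneg|].
  eapply Rle_trans; [apply mass_sum_le; auto|]. rewrite <- H2norm_sq by auto.
  pose proof (H2norm_nonneg (S (S d)) f). apply Rmult_le_compat; auto.
Qed.

(** A diagonal extraction makes every level converge, the limits of the levels synthesize the limit,
    and the summable weighted energies dominate the squared error. *)
Lemma compact_of_summable (d : nat) (b : bool) (p : nat -> R) (T0 : Op) (v : nat -> R) (W : R) :
  agree (S (S d)) T0 (Top d b p) -> (forall k m, wt b k * energy p k m <= v k) ->
  (forall n, sum_f_R0 v n <= W) -> compact_op (S (S d)) T0.
Proof.
  intros HA Hv HW.
  assert (V0 : forall k, 0 <= v k).
  { intros k. eapply Rle_trans; [|apply (Hv k 0%nat)]. apply Rmult_le_pos; [|apply energy_nonneg].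
    pose proof (wt_ge1 b k); lra. }
  split.
  - apply (bounded_op_agree _ _ _ HA). rewrite Top_trunc. apply trunc_bounded_op with (B := W).
    + eapply Rle_trans; [apply (V0 0%nat)|apply (HW 0%nat)].
    + intros k m _. eapply Rle_trans; [apply Hv|].
      eapply Rle_trans; [apply (sum_term v k k); auto|auto].
  - intros fs Hfs [M HM].
    assert (HL : forall k n, Csq (level d b (fs n) k) <= wt b k * (M * M))
      by (intros; apply Csq_level_le; auto).
    assert (HLm : forall k n, Cmod (level d b (fs n) k) <= sqrt (wt b k * (M * M)))
      by (intros; apply sqrt_le_1_alt; apply HL).
    (* Even indices carry the real parts of the levels, odd ones the imaginary parts. *)
    destruct (diagonal_subseq (fun j n => if Nat.even j then fst (level d b (fs n) (Nat.div2 j))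
                                          else snd (level d b (fs n) (Nat.div2 j)))
      (fun j => sqrt (wt b (Nat.div2 j) * (M * M)))) as [s [Hs [l Hl]]].
    { intros j n. destruct (Nat.even j); eapply Rle_trans; try apply (HLm (Nat.div2 j) n);
        [apply Cmod_fst|apply Cmod_snd]. }
    set (L := fun k => (l (2 * k)%nat, l (S (2 * k)))).
    assert (HcL : forall k, Ccv (fun n => level d b (fs (s n)) k) (L k)).
    { intros k; split; simpl fst; simpl snd.
      - specialize (Hl (2 * k)%nat). rewrite Nat.even_even, Nat.div2_double in Hl. exact Hl.
      - specialize (Hl (S (2 * k))). rewrite Nat.even_succ, Nat.odd_even, Nat.div2_succ_double in Hl.
        exact Hl. }
    assert (HLq : forall k, Csq (L k) <= wt b k * (M * M)).
    { intros k. rewrite <- Cmod_sq. specialize (HcL k). apply Ccv_Cmod_lim in HcL.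
      apply Un_cv_le with (u := fun n => Cmod (level d b (fs (s n)) k) * Cmod (level d b (fs (s n)) k)).
      - intros n. rewrite Cmod_sq. auto.
      - apply CV_mult; auto. }
    assert (Wb : forall k m c, Csq c <= wt b k * (M * M) -> Csq c * energy p k m <= M * M * v k).
    { intros k m c Hc. pose proof (energy_nonneg p k m).
      apply Rle_trans with (wt b k * (M * M) * energy p k m); [nra|].
      specialize (Hv k m). pose proof (Rle_0_sqr M). unfold Rsqr in *. nra. }
    assert (HWs : forall n, sum_f_R0 (fun k => M * M * v k) n <= M * M * W).
    { intros n. rewrite sum_scal. apply Rmult_le_compat_l; auto. apply Rle_0_sqr. }
    exists s; split; [exact Hs|]. exists (syn d p L). split.
    { apply syn_H2 with (v := fun k => M * M * v k) (M := M * M * W); auto. }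
    intros e He.
    (* Full energies replace the partial ones, so that the terms fed to [tannery] do not depend on
       the truncation. *)
    destruct (choice (fun k E => Un_cv (energy p k) E /\ forall m, energy p k m <= E)) as [En HEn].
    { intros k. apply (nonneg_bounded_sums_cv _ (v k)); [intros; apply Rle_0_sqr|].
      intros n. specialize (Hv k n). pose proof (wt_ge1 b k). unfold energy in *.
      pose proof (energy_nonneg p k n). unfold energy in *. nra. }
    assert (EnV : forall k, 0 <= En k /\ wt b k * En k <= v k).
    { intros k. destruct (HEn k) as [H1 H2]. split.
      - eapply Rle_trans; [apply (energy_nonneg p k 0)|auto].
      - apply Un_cv_le with (u := fun m => wt b k * energy p k m); auto.
        apply CV_mult; auto using Un_cv_const. }
    set (x := fun n k => Csq (Csub (level d b (fs (s n)) k) (L k)) * En k).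
    (* 4 comes from |a - b|^2 <= 2 |a|^2 + 2 |b|^2 with both levels bounded; e^2 / 4 controls a
       squared norm, so that the norm is at most e / 2. *)
    destruct (tannery x (fun k => 4 * (M * M) * v k) (4 * (M * M * W))) with (e := e * e / 4)
      as [n0 Hn0]; [| | |nra|].
    + intros n k; unfold x. destruct (EnV k) as [E0 E1]. split.
      * apply Rmult_le_pos; auto using Csq_nonneg.
      * apply Rle_trans with (4 * (wt b k * (M * M)) * En k).
        -- apply Rmult_le_compat_r; auto. eapply Rle_trans; [apply Csq_sub_le|].
           specialize (HL k (s n)). specialize (HLq k). lra.
        -- pose proof (Rle_0_sqr M). unfold Rsqr in *. nra.
    + intros n. rewrite (sum_ext _ (fun k => 4 * (M * M * v k))) by (intros; ring).
      rewrite sum_scal. specialize (HWs n). lra.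
    + intros k. unfold x. replace 0 with (0 * 0 * En k) by ring.
      apply CV_mult; [|apply Un_cv_const].
      apply Un_cv_ext_ev with (n0 := 0%nat)
        (u := fun n => Cmod (Csub (level d b (fs (s n)) k) (L k)) * Cmod (Csub (level d b (fs (s n)) k) (L k)));
        [intros; apply Cmod_sq|].
      apply CV_mult; apply Ccv_Cmod, HcL.
    + exists n0. intros n Hn. unfold Rdist.
      rewrite Rminus_0_r, Rabs_right by (apply Rle_ge, H2norm_nonneg).
      rewrite (H2norm_ext _ _ (syn d p (fun k => Csub (level d b (fs (s n)) k) (L k)))).
      2:{ intros a Ha. rewrite syn_fsub. unfold fsub. rewrite HA by auto. reflexivity. }
      destruct (syn_H2 d p (fun k => Csub (level d b (fs (s n)) k) (L k)) (x n) (e * e / 4)) as [_ K].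
      * intros k m. unfold x. apply Rmult_le_compat_l; [apply Csq_nonneg|apply HEn].
      * intros m; apply Hn0; auto.
      * unfold H2norm. apply Rle_lt_trans with (sqrt (e * e / 4)); [apply sqrt_le_1_alt, K|].
        replace (e * e / 4) with ((e / 2) * (e / 2)) by field. rewrite sqrt_square; lra.
Qed.

(** * Coefficients with logarithmically decaying tails *)

Definition tail (e : R) (i : nat) : R := Rpower (1 + ln (INR (S i))) (- e).
Definition logp (e : R) (i : nat) : R := tail e i - tail e (S i).

Lemma INR_S_ge1 (i : nat) : 1 <= INR (S i).
Proof. rewrite S_INR; pose proof (pos_INR i); lra. Qed.

Lemma ln_diff_le (x y : R) : 0 < x -> x <= y -> 0 <= ln y - ln x <= (y - x) / x.
Proof.
  intros Hx Hy. split.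
  - destruct Hy as [Hy|<-]; [|lra]. pose proof (ln_increasing x y Hx Hy); lra.
  - assert (0 < y / x) by (apply Rdiv_lt_0_compat; lra).
    replace (ln y - ln x) with (ln (y / x)) by (unfold Rdiv; rewrite ln_mult, ln_Rinv; try lra;
      apply Rinv_0_lt_compat; lra).
    pose proof (exp_ineq1_le (ln (y / x))) as K. rewrite exp_ln in K by lra.
    replace ((y - x) / x) with (y / x - 1) by (field; lra). lra.
Qed.

Lemma ln_S_nonneg (i : nat) : 0 <= ln (INR (S i)).
Proof.
  pose proof (ln_diff_le 1 (INR (S i)) Rlt_0_1 (INR_S_ge1 i)). rewrite ln_1 in *. lra.
Qed.

Lemma exp_le (x y : R) : x <= y -> exp x <= exp y.
Proof. intros [H|<-]; [left; apply exp_increasing; auto|lra]. Qed.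

Lemma exp_neg_diff (a b : R) : 0 <= a <= b -> 0 <= exp (- a) - exp (- b) <= b - a.
Proof.
  intros H. split; [pose proof (exp_le (- b) (- a)); lra|].
  replace (- b) with (- a + (a - b)) by ring. rewrite exp_plus.
  pose proof (exp_ineq1_le (a - b)). pose proof (exp_pos (- a)).
  assert (exp (- a) <= 1) by (rewrite <- exp_0; apply exp_le; lra).
  assert (exp (a - b) <= 1) by (rewrite <- exp_0; apply exp_le; lra). nra.
Qed.

(** 1 + ln(i + 1) increases by at most 1 / (i + 1), its logarithm by no more because it is at least
    1, and t -> exp(- t) is a contraction on t >= 0. *)
Lemma logp_bound (e : R) (i : nat) : 0 < e -> 0 <= logp e i <= e / INR (S i).
Proof.
  intros He. unfold logp, tail, Rpower.
  set (u := 1 + ln (INR (S i))). set (w := 1 + ln (INR (S (S i)))).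
  assert (Hi := INR_S_ge1 i). assert (Hu : 1 <= u) by (unfold u; pose proof (ln_S_nonneg i); lra).
  assert (Huw : 0 <= w - u <= / INR (S i)).
  { unfold w, u. pose proof (ln_diff_le (INR (S i)) (INR (S (S i))) ltac:(lra)) as K.
    rewrite (S_INR (S i)) in K at 1. specialize (K ltac:(lra)).
    replace ((INR (S (S i)) - INR (S i)) / INR (S i)) with (/ INR (S i)) in K
      by (rewrite (S_INR (S i)); field; lra). lra. }
  assert (HL : 0 <= ln w - ln u <= w - u).
  { destruct (ln_diff_le u w ltac:(lra) ltac:(lra)) as [A B]. split; auto.
    apply Rle_trans with (1 := B). apply Rmult_le_reg_r with u; [lra|].
    unfold Rdiv. rewrite Rmult_assoc, Rinv_l by lra. nra. }
  assert (L0 : 0 <= ln u).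
  { pose proof (ln_diff_le 1 u Rlt_0_1 Hu). rewrite ln_1 in *; lra. }
  replace (- e * ln u) with (- (e * ln u)) by ring.
  replace (- e * ln w) with (- (e * ln w)) by ring.
  destruct (exp_neg_diff (e * ln u) (e * ln w)) as [A B]; [split; nra|].
  split; auto. unfold Rdiv. nra.
Qed.

Lemma tail_0 (e : R) : tail e 0 = 1.
Proof. unfold tail. simpl INR. rewrite ln_1, Rplus_0_r. unfold Rpower. rewrite ln_1, Rmult_0_r, exp_0. reflexivity. Qed.

Lemma logp_sum (e : R) (n : nat) : sum_f_R0 (logp e) n = 1 - tail e (S n).
Proof.
  induction n as [|n IH]; simpl sum_f_R0; unfold logp in *; [rewrite tail_0|rewrite IH]; ring.
Qed.

Lemma tail_pos (e : R) (i : nat) : 0 < tail e i.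
Proof. apply exp_pos. Qed.

Lemma tail_le1 (e : R) (i : nat) : 0 < e -> tail e i <= 1.
Proof.
  intros He. induction i as [|i IH]; [rewrite tail_0; lra|].
  pose proof (logp_bound e i He). unfold logp in *; lra.
Qed.

Lemma INR_ev_gt (M : R) : exists n0, forall n, (n0 <= n)%nat -> M < INR n.
Proof.
  destruct (INR_unbounded M) as [n0 H]. exists n0; intros n Hn.
  apply Rlt_le_trans with (1 := H), le_INR, Hn.
Qed.

Lemma logp_prob (e : R) : 0 < e -> prob (logp e).
Proof.
  intros He. split; [intros; apply logp_bound; auto|].
  (* Chosen so that exp(- e A) = eps; as the tail is a power of a logarithm, the threshold is a
     double exponential. *)
  intros eps Heps. set (A := - ln eps / e).
  destruct (INR_ev_gt (exp (exp A))) as [n0 H0].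
  exists n0; intros n Hn. unfold Rdist. rewrite logp_sum.
  replace (1 - tail e (S n) - 1) with (- tail e (S n)) by ring.
  rewrite Rabs_Ropp, Rabs_right by (left; apply tail_pos).
  assert (L : exp A < ln (INR (S (S n)))).
  { rewrite <- (ln_exp (exp A)). apply ln_increasing; [apply exp_pos|].
    apply H0; lia. }
  unfold tail, Rpower. apply Rlt_le_trans with (exp (- e * A)).
  - apply exp_increasing. assert (A < ln (1 + ln (INR (S (S n))))); [|nra].
    rewrite <- (ln_exp A). apply ln_increasing; [apply exp_pos|lra].
  - replace (- e * A) with (ln eps) by (unfold A; field; lra). rewrite exp_ln; lra.
Qed.

(** * The balance exponent and two-sided bounds for the norms of the powers *)

Definition npow (s : R) (k : nat) : R := Rpower (INR (S k)) s.

Lemma npow_ge1 (s : R) (k : nat) : 0 <= s -> 1 <= npow s k.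
Proof.
  intros Hs. unfold npow, Rpower. rewrite <- exp_0. apply exp_le.
  apply Rmult_le_pos; auto. apply ln_S_nonneg.
Qed.

Lemma npow_mono (s : R) (k n : nat) : 0 <= s -> (k <= n)%nat -> npow s k <= npow s n.
Proof.
  intros Hs L. unfold npow. apply Rle_Rpower_l; auto. split; [pose proof (INR_S_ge1 k); lra|].
  apply le_INR; lia.
Qed.

Lemma ln_npow (s : R) (k : nat) : ln (npow s k) = s * ln (INR (S k)).
Proof. apply ln_exp. Qed.

Lemma Rpower_anti (x y e : R) : 0 < x -> x <= y -> 0 <= e -> Rpower y (- e) <= Rpower x (- e).
Proof.
  intros Hx Hy He. rewrite !Rpower_Ropp. apply Rinv_le_contravar; [apply exp_pos|].
  apply Rle_Rpower_l; lra.
Qed.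

(** Origin of s = 1 / (1 + e): the exponent for staying below the cut exp X and the exponent from
    the small coefficients beyond it coincide. *)
Lemma npow_balance (e : R) (k : nat) : 0 < e ->
  INR (S k) * Rpower (npow (/ (1 + e)) k) (- e) = npow (/ (1 + e)) k.
Proof.
  intros He. unfold npow. rewrite Rpower_mult.
  rewrite <- (Rpower_1 (INR (S k))) at 1 by (pose proof (INR_S_ge1 k); lra).
  rewrite <- Rpower_plus. f_equal. field. lra.
Qed.

(** A squared l^2 norm is at most the sup norm times the l^1 norm, and the latter is at most 1. *)
Lemma energy_sup (p : nat -> R) (k m : nat) (M : R) : prob p -> (forall i, pcoef p k i <= M) ->
  energy p k m <= M.
Proof.
  intros Hp H. apply Rle_trans with (sum_f_R0 (fun i => M * pcoef p k i) m).
  - apply sum_Rle; intros i _. apply Rmult_le_compat_r; auto. apply pcoef_nonneg, Hp.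
  - rewrite sum_scal. pose proof (pcoef_sum_le1 p k m Hp).
    assert (0 <= M) by (eapply Rle_trans; [apply (pcoef_nonneg p k 0), Hp|auto]). nra.
Qed.

(** From 1 - t <= exp(- t); as t <= 1, the extra 1 in the exponent pays for the passage from k to k
    + 1. *)
Lemma pow_exp_le (t : R) (k : nat) : 0 <= t <= 1 -> (1 - t) ^ k <= exp (1 - INR (S k) * t).
Proof.
  intros Ht. apply Rle_trans with (exp (- (INR k * t))).
  - induction k as [|k IH]; [simpl; rewrite Rmult_0_l, Ropp_0, exp_0; lra|].
    rewrite S_INR. replace (- ((INR k + 1) * t)) with (- t + - (INR k * t)) by ring.
    rewrite exp_plus. simpl pow. pose proof (exp_ineq1_le (- t)).
    assert (0 <= (1 - t) ^ k) by (apply pow_le; lra).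
    apply Rmult_le_compat; lra.
  - apply exp_le. rewrite S_INR. lra.
Qed.

Lemma floor_exp (x : R) : exists j : nat, INR j <= exp x < INR (S j).
Proof.
  destruct (Rcomplements.nfloor_ex (exp x)) as [j Hj]; [left; apply exp_pos|].
  exists j. rewrite S_INR. exact Hj.
Qed.

(** [pcoef_upper] with the cut at exp X: the mass beyond it yields a factor exp(- c0 X), the small
    coefficients there yield k e / exp X. The cube is a reserve, one factor for the weight k + 1 and
    two for summability in k. *)
Lemma logp_energy_upper (e : R) : 0 < e -> exists K c, 0 < c /\ forall k m,
  INR (S k) ^ 3 * energy (logp e) k m <= exp (K - c * npow (/ (1 + e)) k).
Proof.
  (* 3^(-e) because 1 + ln(j + 1) <= 3 X at the cut j. *)
  intros He. set (s := / (1 + e)). set (c0 := Rpower 3 (- e)).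
  assert (Hs : 0 < s) by (apply Rinv_0_lt_compat; lra).
  assert (Hc0 : 0 < c0 <= 1).
  { split; [apply exp_pos|]. unfold c0, Rpower. rewrite <- exp_0. apply exp_le.
    pose proof (ln_diff_le 1 3 Rlt_0_1 ltac:(lra)). rewrite ln_1 in *. nra. }
  (* Four factors x have to be absorbed, the cube and the one in [E2]: up to a constant, 4 ln x
     costs (4 / s) dl X = (c0 / 2) X, half of the exponent. *)
  set (dl := s * c0 / 8). assert (Hdl : 0 < dl) by (unfold dl; nra).
  exists (ln (3 + e) - 4 / s * ln dl), (c0 / 2). split; [lra|]. intros k m.
  set (x := INR (S k)). set (Xk := npow s k). assert (Hx : 1 <= x) by apply INR_S_ge1.
  assert (HX : 1 <= Xk) by (apply npow_ge1; lra).
  destruct (floor_exp Xk) as [j [Hj1 Hj2]].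
  assert (Hp := logp_prob e He).
  assert (Ht1 := tail_le1 e j He). assert (Ht0 := tail_pos e j).
  assert (E1 : energy (logp e) k m <= (1 - tail e j) ^ k + INR k * (e / INR (S j))).
  { apply energy_sup; auto. intros i.
    assert (Hsig : 0 <= e / INR (S j)).
    { apply Rle_trans with (logp e j); apply logp_bound; auto. }
    apply pcoef_upper with (m := j); auto; [lra| |].
    - intros n. destruct (le_lt_dec j n) as [L|L].
      (* [sum_f_R0] has no empty sum, so a cut at 0 is treated apart. *)
      + destruct j as [|j].
        * rewrite sum_zero; [rewrite tail_0; lra|]. intros i' _. destruct (lt_dec i' 0); [lia|auto].
        * rewrite <- (logp_sum e j).
          rewrite (sum_ext _ (fun i => if le_dec i j then logp e i else 0)).
          -- apply sum_truncated_le. apply Hp.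
          -- intros i' _. destruct (lt_dec i' (S j)); destruct (le_dec i' j); try lia; auto.
      + rewrite (sum_ext _ (logp e)).
        * rewrite logp_sum. clear -L He. assert (tail e j <= tail e (S n)); [|lra].
          induction L as [|j L IH]; [lra|]. pose proof (logp_bound e j He). unfold logp in *; lra.
        * intros i' Hi'. destruct (lt_dec i' j); [auto|lia].
    - intros i' Hi'. eapply Rle_trans; [apply logp_bound; auto|].
      apply Rmult_le_compat_l; [lra|]. apply Rinv_le_contravar; [pose proof (INR_S_ge1 j); lra|].
      apply le_INR; lia. }
  assert (Ht : c0 * Xk <= x * tail e j).
  { unfold x, Xk, s. rewrite <- npow_balance at 1 by auto. fold s. fold Xk. fold x.
    replace (c0 * (x * Rpower Xk (- e))) with (x * (c0 * Rpower Xk (- e))) by ring.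
    apply Rmult_le_compat_l; [lra|]. unfold c0.
    rewrite Rpower_mult_distr by lra. unfold tail. apply Rpower_anti; [|  |lra].
    - pose proof (ln_S_nonneg j); lra.
    - assert (HE : 1 <= exp Xk) by (rewrite <- exp_0; apply exp_le; lra).
      pose proof (INR_S_ge1 j).
      assert (ln (INR (S j)) <= ln (2 * exp Xk)).
      { pose proof (ln_diff_le (INR (S j)) (2 * exp Xk)). rewrite S_INR in *. lra. }
      rewrite ln_mult, ln_exp in * by (try lra; apply exp_pos).
      pose proof (ln_diff_le 1 2 Rlt_0_1 ltac:(lra)) as L2. rewrite ln_1 in L2. lra. }
  assert (E2 : energy (logp e) k m <= (3 + e) * x * exp (- c0 * Xk)).
  { eapply Rle_trans; [exact E1|].
    assert (P1 : (1 - tail e j) ^ k <= 3 * exp (- c0 * Xk)).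
    { eapply Rle_trans; [apply pow_exp_le; lra|]. fold x.
      apply Rle_trans with (exp (1 + - c0 * Xk)); [apply exp_le; lra|].
      rewrite exp_plus. apply Rmult_le_compat_r; [left; apply exp_pos|apply exp_le_3]. }
    assert (P2 : INR k * (e / INR (S j)) <= x * (e * exp (- c0 * Xk))).
    { apply Rmult_le_compat; [apply pos_INR| | |].
      - apply Rle_trans with (logp e j); apply logp_bound; auto.
      - unfold x; rewrite S_INR; lra.
      - apply Rmult_le_compat_l; [lra|].
        apply Rle_trans with (/ exp Xk); [apply Rinv_le_contravar; [apply exp_pos|lra]|].
        rewrite <- exp_Ropp. apply exp_le. nra. }
    pose proof (exp_pos (- c0 * Xk)). nra. }
  (* From ln(dl X) <= dl X and ln X = s ln x. *)
  assert (Hlnx : ln x <= / s * (dl * Xk - ln dl)).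
  { assert (HlX : ln Xk = s * ln x) by apply ln_npow.
    pose proof (ln_diff_le 1 (1 + dl * Xk) Rlt_0_1 ltac:(nra)) as K.
    assert (K2 : ln (dl * Xk) <= ln (1 + dl * Xk)).
    { pose proof (ln_diff_le (dl * Xk) (1 + dl * Xk) ltac:(nra) ltac:(lra)); lra. }
    rewrite ln_mult, HlX in K2 by lra. rewrite ln_1 in K.
    apply Rmult_le_reg_l with s; auto. rewrite <- Rmult_assoc, Rinv_r by lra.
    unfold Rdiv in K. rewrite Rinv_1 in K. lra. }
  apply Rle_trans with (exp (ln (3 + e) + 4 * ln x + - c0 * Xk)).
  - rewrite !exp_plus, exp_ln by lra.
    replace (4 * ln x) with (ln x + ln x + ln x + ln x) by ring.
    rewrite !exp_plus, exp_ln by lra.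
    replace ((3 + e) * (x * x * x * x) * exp (- c0 * Xk))
      with (x ^ 3 * ((3 + e) * x * exp (- c0 * Xk))) by ring.
    apply Rmult_le_compat_l; [apply pow_le; lra|exact E2].
  - apply exp_le.
    replace (4 / s * ln dl) with (4 * (/ s * ln dl)) by (field; lra).
    assert (/ s * (dl * Xk) = c0 / 8 * Xk) by (unfold dl; field; lra). lra.
Qed.

(** With probability at least exp(- 2 X) all k variables are at most j, the integer part of exp X.
    Their sum then takes at most k j + 1 values, and Cauchy-Schwarz bounds the collision probability
    from below. *)
Lemma logp_energy_lower (e : R) : 1 <= e -> exists C, 0 < C /\ forall k, exists m,
  exp (- (C * npow (/ (1 + e)) k)) <= energy (logp e) k m.
Proof.
  intros He. set (s := / (1 + e)).
  assert (Hs : 0 < s) by (apply Rinv_0_lt_compat; lra).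
  assert (Hs' : 0 < / s) by (apply Rinv_0_lt_compat; lra).
  (* 4 from the square of the probability exp(- 2 X), 2 from j + 1 <= exp(2 X), and 1 / s from k + 1
     <= exp(X / s). *)
  exists (6 + / s). split; [lra|]. intros k.
  set (x := INR (S k)). set (Xk := npow s k). assert (Hx : 1 <= x) by apply INR_S_ge1.
  assert (HX : 1 <= Xk) by (apply npow_ge1; lra).
  destruct (floor_exp Xk) as [j [Hj1 Hj2]].
  assert (Hp := logp_prob e ltac:(lra)).
  set (t := tail e (S j)). assert (Ht0 : 0 < t) by apply tail_pos.
  assert (Ht : t <= Rpower (1 + Xk) (- e)).
  { apply Rpower_anti; try lra. apply Rplus_le_compat_l.
    rewrite <- (ln_exp Xk) at 1. left. apply ln_increasing; [apply exp_pos|].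
    rewrite (S_INR (S j)). lra. }
  (* Here e >= 1 enters, together with 1 + X >= 2; t <= 1 / 2 is used for exp(- 2 t) <= 1 - t. *)
  assert (Ht2 : t <= 1 / 2).
  { apply Rle_trans with (1 := Ht). apply Rle_trans with (Rpower 2 (- e)); [apply Rpower_anti; lra|].
    replace (1 / 2) with (Rpower 2 (Ropp 1)).
    - apply Rle_Rpower; lra.
    - rewrite Rpower_Ropp, Rpower_1 by lra. field. }
  assert (HtX : x * t <= Xk).
  { unfold Xk at 1, s. rewrite <- npow_balance by lra. fold s. fold Xk. fold x.
    apply Rmult_le_compat_l; [lra|]. apply Rle_trans with (1 := Ht). apply Rpower_anti; lra. }
  exists (k * j)%nat. set (n := (k * j)%nat).
  assert (Low : exp (- (2 * Xk)) <= sum_f_R0 (pcoef (logp e) k) n).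
  { eapply Rle_trans; [|apply pcoef_lower; auto]. rewrite logp_sum. fold t.
    assert (B : exp (- (2 * t)) <= 1 - t).
    { rewrite exp_Ropp. pose proof (exp_ineq1_le (2 * t)).
      apply Rle_trans with (/ (1 + 2 * t)); [apply Rinv_le_contravar; lra|].
      apply Rmult_le_reg_r with (1 + 2 * t); [lra|]. rewrite Rinv_l by lra. nra. }
    apply Rle_trans with (exp (- (2 * t)) ^ k).
    - replace (exp (- (2 * t)) ^ k) with (exp (- (2 * (INR k * t)))).
      + apply exp_le. unfold x in HtX. rewrite S_INR in HtX. nra.
      + clear. induction k as [|k IH]; [simpl; rewrite Rmult_0_l, Rmult_0_r, Ropp_0; apply exp_0|].
        rewrite S_INR. simpl pow. rewrite <- IH, <- exp_plus. f_equal; ring.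
    - apply pow_incr. split; [left; apply exp_pos|auto]. }
  pose proof (sum_sq_Cauchy (pcoef (logp e) k) n) as CS. fold (energy (logp e) k n) in CS.
  assert (HE0 := energy_nonneg (logp e) k n).
  assert (Hn : INR (S n) <= exp (2 * Xk + / s * Xk)).
  { assert (Hn1 : INR (S n) <= x * INR (S j)).
    { unfold x. rewrite <- mult_INR. apply le_INR. unfold n; nia. }
    assert (Hn2 : INR (S j) <= exp (2 * Xk)).
    { replace (2 * Xk) with (Xk + Xk) by ring. rewrite exp_plus, S_INR.
      pose proof (exp_ineq1_le Xk). nra. }
    assert (Hn3 : x <= exp (/ s * Xk)).
    { rewrite <- (exp_ln x) by lra. apply exp_le.
      assert (HlX : ln Xk = s * ln x) by apply ln_npow.
      pose proof (ln_diff_le 1 Xk Rlt_0_1 HX) as K. rewrite ln_1, HlX in K.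
      apply Rmult_le_reg_l with s; auto. rewrite <- Rmult_assoc, Rinv_r by lra.
      unfold Rdiv in K. rewrite Rinv_1 in K. lra. }
    rewrite exp_plus, Rmult_comm. eapply Rle_trans; [exact Hn1|].
    apply Rmult_le_compat; try lra. apply pos_INR. }
  set (S1 := sum_f_R0 (pcoef (logp e) k) n) in *.
  assert (Sq : exp (- (2 * Xk)) * exp (- (2 * Xk)) <= S1 * S1).
  { pose proof (exp_pos (- (2 * Xk))). apply Rmult_le_compat; lra. }
  assert (F : exp (- (2 * Xk)) * exp (- (2 * Xk)) <= exp (2 * Xk + / s * Xk) * energy (logp e) k n).
  { apply Rle_trans with (1 := Sq). apply Rle_trans with (1 := CS).
    apply Rmult_le_compat_r; auto. }
  apply Rmult_le_reg_l with (exp (2 * Xk + / s * Xk)); [apply exp_pos|].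
  apply Rle_trans with (2 := F). rewrite <- !exp_plus. apply exp_le. lra.
Qed.

(** * The spectral parameters *)

Lemma cv_beta_eq (N : nat) (T : Op) (c : R) : Un_cv (beta_seq N T) c -> beta_eq N T c.
Proof.
  intros H. split; intros eps He; destruct (H eps He) as [n0 H0]; split.
  - exists n0; intros k Hk. specialize (H0 k Hk). apply Rabs_def2 in H0. lra.
  - intros n. exists (max n n0); split; [lia|].
    specialize (H0 (max n n0) ltac:(lia)). apply Rabs_def2 in H0. lra.
  - exists n0; intros k Hk. specialize (H0 k Hk). apply Rabs_def2 in H0. lra.
  - intros n. exists (max n n0); split; [lia|].
    specialize (H0 (max n n0) ltac:(lia)). apply Rabs_def2 in H0. lra.
Qed.

Lemma limsup_exists (u : nat -> R) (a b : R) : (forall k, a <= u k <= b) ->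
  exists L, is_limsup u L.
Proof.
  intros H. destruct (Lim_seq.ex_LimSup_seq u) as [[l| |] Hl]; simpl in Hl.
  - exists l. intros eps He. destruct (Hl (mkposreal eps He)) as [A [n0 B]]. simpl in *.
    split; [exists n0; exact B|]. intros n. destruct (A n) as [k [Hk1 Hk2]]. eauto.
  - destruct (Hl b 0%nat) as [n [_ Hn]]. specialize (H n); lra.
  - destruct (Hl a) as [n0 Hn]. specialize (Hn n0 (Nat.le_refl _)). specialize (H n0); lra.
Qed.

Lemma liminf_exists (u : nat -> R) (a b : R) : (forall k, a <= u k <= b) ->
  exists L, is_liminf u L.
Proof.
  intros H. destruct (limsup_exists (fun k => - u k) (- b) (- a)) as [L HL].
  - intros k; specialize (H k); lra.
  - exists (- L). intros eps He. destruct (HL eps He) as [[n0 A] B]. split.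
    + exists n0; intros k Hk. specialize (A k Hk). lra.
    + intros n. destruct (B n) as [k [Hk1 Hk2]]. exists k; split; auto; lra.
Qed.

Lemma Rpower_INR_cv0 (r : R) : 0 < r -> Un_cv (fun k => Rpower (INR (S k)) (- r)) 0.
Proof.
  intros Hr eps He. destruct (INR_ev_gt (exp (- ln eps / r))) as [n0 H0].
  exists n0; intros n Hn. unfold Rdist. rewrite Rminus_0_r, Rabs_right by (left; apply exp_pos).
  unfold Rpower. apply Rlt_le_trans with (exp (ln eps)); [|rewrite exp_ln; lra]. apply exp_increasing.
  assert (- ln eps / r < ln (INR (S n))).
  { rewrite <- (ln_exp (- ln eps / r)). apply ln_increasing; [apply exp_pos|apply H0; lia]. }
  assert (r * (- ln eps / r) < r * ln (INR (S n))) by (apply Rmult_lt_compat_l; auto).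
  replace (r * (- ln eps / r)) with (- ln eps) in * by (field; lra). lra.
Qed.

(** The root of order (k + 1)^(1 / N) divides the exponents by [npow (1 / INR N) k]. *)
Lemma beta_seq_exp (N : nat) (T : Op) (k : nat) (a b : R) :
  exp a <= approx_num N T (S k) <= exp b ->
  exp (a * / npow (1 / INR N) k) <= beta_seq N T k <= exp (b * / npow (1 / INR N) k).
Proof.
  intros H. unfold beta_seq, rpow. pose proof (exp_pos a).
  destruct (Rlt_dec 0 (approx_num N T (S k))) as [P|P]; [|lra].
  change (Rpower (INR (S k)) (1 / INR N)) with (npow (1 / INR N) k).
  assert (HX : 0 < / npow (1 / INR N) k) by (apply Rinv_0_lt_compat, exp_pos).
  set (D := npow (1 / INR N) k) in *. unfold Rpower, Rdiv. rewrite Rmult_1_l.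
  assert (a <= ln (approx_num N T (S k)) <= b).
  { split.
    - rewrite <- (ln_exp a). destruct (proj1 H) as [L| <-]; [|lra].
      left; apply ln_increasing; auto.
    - rewrite <- (ln_exp b). destruct (proj2 H) as [L|E]; [|rewrite E; lra].
      left; apply ln_increasing; auto. }
  split; apply exp_le; nra.
Qed.

(** Without a lower bound, positivity of the approximation number is not known; otherwise [rpow]
    returns 0. *)
Lemma beta_seq_upper (N : nat) (T : Op) (k : nat) (b : R) : approx_num N T (S k) <= exp b ->
  0 <= beta_seq N T k <= exp (b * / npow (1 / INR N) k).
Proof.
  intros H. destruct (Rlt_dec 0 (approx_num N T (S k))) as [P|P].
  - destruct (beta_seq_exp N T k (ln (approx_num N T (S k))) b) as [A B].
    + rewrite exp_ln by auto. lra.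
    + split; auto. eapply Rle_trans; [|exact A]. left; apply exp_pos.
  - unfold beta_seq, rpow.
    destruct (Rlt_dec 0 (approx_num N T (S k))); [tauto|].
    split; [lra|left; apply exp_pos].
Qed.

Lemma exp_cv1 (u : nat -> R) : Un_cv u 0 -> Un_cv (fun n => exp (u n)) 1.
Proof.
  intros H. rewrite <- exp_0. apply (continuity_seq exp u 0); auto.
  apply derivable_continuous_pt, derivable_pt_exp.
Qed.

Lemma Un_cv_between (u a b : nat -> R) (l : R) : (forall n, a n <= u n <= b n) ->
  Un_cv a l -> Un_cv b l -> Un_cv u l.
Proof.
  intros H A B e He. destruct (A e He) as [n1 H1]. destruct (B e He) as [n2 H2].
  exists (max n1 n2); intros n Hn. specialize (H1 n ltac:(lia)). specialize (H2 n ltac:(lia)).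
  specialize (H n). unfold Rdist in *. apply Rabs_def2 in H1, H2. apply Rabs_def1; lra.
Qed.

Lemma inv_npow_bounds (s : R) (k : nat) : 0 <= s -> 0 < / npow s k <= 1.
Proof.
  intros Hs. pose proof (npow_ge1 s k Hs). split; [apply Rinv_0_lt_compat; lra|].
  rewrite <- Rinv_1. apply Rinv_le_contravar; lra.
Qed.

Lemma npow_ratio (s r : R) (k : nat) : npow s k * / npow r k = Rpower (INR (S k)) (- (r - s)).
Proof.
  unfold npow. rewrite <- Rpower_Ropp, <- Rpower_plus. f_equal; ring.
Qed.

(** After the root both exponents are of order at most k^(s - 1 / N), which tends to 0. *)
Lemma beta_eq1 (N : nat) (T : Op) (s A B : R) : 0 <= s < 1 / INR N -> 0 <= A ->
  (forall k, exp (- (A * npow s k)) <= approx_num N T (S k) <= exp B) -> beta_eq N T 1.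
Proof.
  intros Hs HA H. apply cv_beta_eq.
  assert (Hr : 0 < 1 / INR N - s) by lra.
  apply Un_cv_between with (a := fun k => exp (- (A * npow s k) * / npow (1 / INR N) k))
    (b := fun k => exp (B * / npow (1 / INR N) k)).
  - intros k. apply beta_seq_exp; auto.
  - apply exp_cv1. apply Un_cv_ext_ev with (n0 := 0%nat)
      (u := fun k => - A * Rpower (INR (S k)) (- (1 / INR N - s))).
    + intros k _. rewrite <- npow_ratio. ring.
    + apply Un_cv_scal0, Rpower_INR_cv0; auto.
  - apply exp_cv1. apply Un_cv_ext_ev with (n0 := 0%nat)
      (u := fun k => B * Rpower (INR (S k)) (- (1 / INR N))).
    + intros k _. unfold npow. now rewrite Rpower_Ropp.
    + apply Un_cv_scal0, Rpower_INR_cv0; lra.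
Qed.

Lemma beta_eq0 (N : nat) (T : Op) (s K c : R) : 0 < 1 / INR N < s -> 0 < c ->
  (forall k, approx_num N T (S k) <= exp (K - c * npow s k)) -> beta_eq N T 0.
Proof.
  intros Hs Hc H. apply cv_beta_eq. set (r := 1 / INR N) in *.
  (* The majorant comes from exp(- y) <= 1 / y with y = c (k + 1)^(s - r). *)
  apply Un_cv_squeeze0 with (v := fun k => exp (Rabs K) * (/ c * Rpower (INR (S k)) (- (s - r)))).
  - intros k. destruct (beta_seq_upper N T k _ (H k)) as [A B]. split; auto.
    apply Rle_trans with (1 := B). fold r.
    assert (Hi := inv_npow_bounds r k ltac:(lra)).
    replace ((K - c * npow s k) * / npow r k) with (K * / npow r k + - (c * (npow s k * / npow r k))) by ring.
    rewrite exp_plus. apply Rmult_le_compat; try (left; apply exp_pos).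
    + apply exp_le. pose proof (Rle_abs K). pose proof (Rabs_pos K). nra.
    + rewrite npow_ratio. replace (- (r - s)) with (s - r) by ring.
      rewrite exp_Ropp, (Rpower_Ropp _ (s - r)).
      assert (P : 0 < Rpower (INR (S k)) (s - r)) by apply exp_pos.
      rewrite <- Rinv_mult. apply Rinv_le_contravar; [nra|].
      pose proof (exp_ineq1_le (c * Rpower (INR (S k)) (s - r))). lra.
  - apply Un_cv_scal0, Un_cv_scal0, Rpower_INR_cv0. lra.
Qed.

(** At the critical exponent the root turns the bounds into constants: exp(- A) below and, in the
    limit, exp(- c) < 1 above. *)
Lemma beta_strict (N : nat) (T : Op) (A K c : R) : (0 < N)%nat -> 0 < c -> 0 <= A ->
  (forall k, exp (- (A * npow (1 / INR N) k)) <= approx_num N T (S k)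
             <= exp (K - c * npow (1 / INR N) k)) ->
  beta_minus_pos N T /\ beta_plus_lt1 N T.
Proof.
  intros HN Hc HA H. set (r := 1 / INR N) in *.
  assert (Hr : 0 < r) by (apply Rdiv_lt_0_compat; [lra|apply lt_0_INR; auto]).
  assert (B : forall k, exp (- A) <= beta_seq N T k <= exp (K * / npow r k - c)).
  { intros k. destruct (beta_seq_exp N T k _ _ (H k)) as [B1 B2]. fold r in B1, B2.
    assert (HX : npow r k <> 0) by (pose proof (npow_ge1 r k ltac:(lra)); lra).
    replace (- A) with (- (A * npow r k) * / npow r k) by (field; auto).
    replace (K * / npow r k - c) with ((K - c * npow r k) * / npow r k) by (field; auto). auto. }
  assert (Bd : forall k, exp (- A) <= beta_seq N T k <= exp (Rabs K)).
  { intros k. split; [apply B|]. eapply Rle_trans; [apply B|]. apply exp_le.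
    destruct (inv_npow_bounds r k ltac:(lra)). pose proof (Rle_abs K). pose proof (Rabs_pos K). nra. }
  split.
  - destruct (liminf_exists _ _ _ Bd) as [L HL]. exists L; split; auto.
    assert (exp (- A) <= L); [|pose proof (exp_pos (- A)); lra].
    apply le_epsilon. intros eps He. destruct (HL eps He) as [_ HL2].
    destruct (HL2 0%nat) as [k [_ Hk]]. specialize (Bd k); lra.
  - destruct (limsup_exists _ _ _ Bd) as [L HL]. exists L; split; auto.
    assert (HK : Un_cv (fun k => K * Rpower (INR (S k)) (- r)) 0)
      by (apply Un_cv_scal0, Rpower_INR_cv0; auto).
    (* Half of c is spent on the vanishing term in K, which leaves the bound exp(- c / 2). *)
    destruct (HK (c / 2)) as [n0 H0]; [lra|].
    assert (Q : exp (- (c / 2)) < 1) by (rewrite <- exp_0; apply exp_increasing; lra).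
    assert (L <= exp (- (c / 2))); [|lra].
    apply le_epsilon. intros eps He. destruct (HL eps He) as [_ HL2].
    destruct (HL2 n0) as [k [Hk1 Hk2]].
    assert (beta_seq N T k <= exp (- (c / 2))); [|lra].
    eapply Rle_trans; [apply B|]. apply exp_le.
    specialize (H0 k Hk1). unfold Rdist in H0. rewrite Rpower_Ropp in H0. fold (npow r k) in H0.
    apply Rabs_def2 in H0. lra.
Qed.

Lemma sqrt_exp (y : R) : sqrt (exp y) = exp (y / 2).
Proof.
  replace (exp y) with (exp (y / 2) * exp (y / 2)) by (rewrite <- exp_plus; f_equal; field).
  apply sqrt_square. left; apply exp_pos.
Qed.

(** * The four situations *)

Lemma comp_agree (d : nat) (b : bool) (p : nat -> R) (B : R) : prob p ->
  (forall k m, wt b k * energy p k m <= B) ->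
  comp_welldef (S (S d)) (Phi d b p) /\
  agree (S (S d)) (comp_fun (S (S d)) (Phi d b p)) (Top d b p).
Proof.
  intros Hp HB.
  assert (HB0 : 0 <= B).
  { eapply Rle_trans; [|apply (HB 0%nat 0%nat)]. apply Rmult_le_pos; [|apply energy_nonneg].
    pose proof (wt_ge1 b 0); lra. }
  assert (I : forall f, inH2 (S (S d)) f -> inH2 (S (S d)) (Top d b p f)).
  { intros f Hf. rewrite Top_trunc. apply (level_syn_H2 d b p f (fun _ => true) B); auto. }
  split.
  - intros f Hf. exists (Top d b p f). apply comp_rel_Top; auto.
  - intros f Hf a Ha. apply comp_fun_Top; auto.
Qed.

Lemma sum_inv_sq_le (n : nat) : sum_f_R0 (fun k => / (INR (S k) * INR (S k))) n <= 2.
Proof.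
  (* The sharper right-hand side telescopes, through 1 / (y + 1)^2 <= 1 / y - 1 / (y + 1). *)
  assert (sum_f_R0 (fun k => / (INR (S k) * INR (S k))) n <= 2 - / INR (S n)); cycle 1.
  { assert (0 < / INR (S n)) by (apply Rinv_0_lt_compat, lt_0_INR; lia). lra. }
  induction n as [|n IH]; [simpl; lra|]. rewrite tech5.
  pose proof (INR_S_ge1 n). rewrite (S_INR (S n)). set (y := INR (S n)) in *.
  assert (/ ((y + 1) * (y + 1)) <= / y - / (y + 1)); [|lra].
  replace (/ y - / (y + 1)) with (/ (y * (y + 1))) by (field; lra).
  apply Rinv_le_contravar; nra.
Qed.

(** The reserve (k + 1)^3 is spent here: one factor covers the weight, the others leave 1 / (k +
    1)^2 for compactness. Exponents halve because square roots of energies bound the approximation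
    numbers. *)
Lemma logp_comp_upper (d : nat) (b : bool) (e : R) : 0 < e ->
  comp_compact (S (S d)) (Phi d b (logp e)) /\
  exists K c, 0 < c /\ forall k,
    approx_num (S (S d)) (comp_fun (S (S d)) (Phi d b (logp e))) (S k)
      <= exp (K - c * npow (/ (1 + e)) k).
Proof.
  intros He. destruct (logp_energy_upper e He) as [K [c [Hc H]]].
  set (s := / (1 + e)) in *. assert (Hs : 0 < s) by (apply Rinv_0_lt_compat; lra).
  assert (Hw : forall k m, wt b k * energy (logp e) k m
    <= exp (K - c * npow s k) * / (INR (S k) * INR (S k))).
  { intros k m. assert (Hx := INR_S_ge1 k). destruct (wt_ge1 b k) as [W1 W2].
    assert (E0 := energy_nonneg (logp e) k m).
    apply Rmult_le_reg_r with (INR (S k) * INR (S k)); [nra|].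
    rewrite (Rmult_assoc (exp _)), Rinv_l, Rmult_1_r by nra.
    apply Rle_trans with (2 := H k m).
    replace (INR (S k) ^ 3 * energy (logp e) k m)
      with (INR (S k) * energy (logp e) k m * (INR (S k) * INR (S k))) by ring.
    apply Rmult_le_compat_r; [nra|]. apply Rmult_le_compat_r; auto. }
  assert (Hinv : forall k, 0 < / (INR (S k) * INR (S k)) <= 1).
  { intros k. pose proof (INR_S_ge1 k). split; [apply Rinv_0_lt_compat; nra|].
    rewrite <- Rinv_1. apply Rinv_le_contravar; nra. }
  assert (Hw1 : forall k m, wt b k * energy (logp e) k m <= exp (K - c * npow s k)).
  { intros k m. apply Rle_trans with (1 := Hw k m). specialize (Hinv k).
    pose proof (exp_pos (K - c * npow s k)). nra. }
  assert (HwK : forall k m, wt b k * energy (logp e) k m <= exp K).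
  { intros k m. apply Rle_trans with (1 := Hw1 k m). apply exp_le.
    pose proof (npow_ge1 s k ltac:(lra)). nra. }
  destruct (comp_agree d b (logp e) (exp K) (logp_prob e He) HwK) as [WD AG].
  split.
  - split; auto. apply compact_of_summable with (b := b) (p := logp e)
      (v := fun k => exp K * / (INR (S k) * INR (S k))) (W := exp K * 2); auto.
    + intros k m. apply Rle_trans with (1 := Hw k m). apply Rmult_le_compat_r.
      * specialize (Hinv k); lra.
      * apply exp_le. pose proof (npow_ge1 s k ltac:(lra)). nra.
    + intros n. rewrite sum_scal. apply Rmult_le_compat_l; [left; apply exp_pos|apply sum_inv_sq_le].
  - exists (K / 2), (c / 2). split; [lra|]. intros n.
    replace (K / 2 - c / 2 * npow s n) with ((K - c * npow s n) / 2) by field. rewrite <- sqrt_exp.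
    apply approx_num_upper with (b := b) (p := logp e) (B' := exp K); auto; [left; apply exp_pos|].
    intros k m Hk. apply Rle_trans with (1 := Hw1 k m). apply exp_le.
    pose proof (npow_mono s n k ltac:(lra) Hk). nra.
Qed.

Lemma logp_comp_lower (d : nat) (e : R) : 1 <= e ->
  exists A, 0 <= A /\ forall k, exp (- (A * npow (/ (1 + e)) k))
    <= approx_num (S (S d)) (comp_fun (S (S d)) (Phi d false (logp e))) (S k).
Proof.
  intros He. destruct (logp_energy_lower e He) as [C [HC H]].
  set (s := / (1 + e)) in *. assert (Hs : 0 < s) by (apply Rinv_0_lt_compat; lra).
  exists (C / 2). split; [lra|]. intros n.
  replace (- (C / 2 * npow s n)) with (- (C * npow s n) / 2) by field. rewrite <- sqrt_exp.
  assert (Hp := logp_prob e ltac:(lra)).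
  apply approx_num_lower with (p := logp e).
  - apply (logp_comp_upper d false e ltac:(lra)).
  - apply (comp_agree d false (logp e) 1 Hp). intros k m. unfold wt. rewrite Rmult_1_l.
    apply energy_sup; auto. intros i.
    eapply Rle_trans; [|apply (pcoef_sum_le1 (logp e) k i Hp)].
    apply sum_term; auto. intros; apply pcoef_nonneg, Hp.
  - left; apply exp_pos.
  - intros k Hk. destruct (H k) as [m Hm]. exists m. eapply Rle_trans; [|exact Hm].
    apply exp_le. pose proof (npow_mono s k n ltac:(lra) Hk). nra.
Qed.

(** * The constant law, for which [psi] is 1 and y is z_2 *)

Definition dirac0 (i : nat) : R := match i with O => 1 | S _ => 0 end.

Lemma dirac0_sum (n : nat) : sum_f_R0 dirac0 n = 1.
Proof. rewrite (sum_single _ 0); [reflexivity|lia|]. intros [|i]; simpl; tauto. Qed.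

Lemma dirac0_prob : prob dirac0.
Proof.
  split; [intros [|i]; simpl; lra|].
  apply Un_cv_ext_ev with (n0 := 0%nat) (2 := Un_cv_const 1).
  intros n _. symmetry; apply dirac0_sum.
Qed.

Lemma pcoef_dirac0 (k i : nat) : pcoef dirac0 k i = dirac0 i.
Proof.
  revert i; induction k as [|k IH]; intros i; [reflexivity|].
  simpl pcoef. rewrite (sum_single _ 0); [|lia|].
  - rewrite IH, Nat.sub_0_r. simpl dirac0 at 1. ring.
  - intros [|j] Hj; [tauto|simpl; ring].
Qed.

Lemma energy_dirac0 (k n : nat) : energy dirac0 k n = 1.
Proof.
  unfold energy. rewrite (sum_single _ 0); [|lia|].
  - rewrite pcoef_dirac0; simpl; ring.
  - intros [|i] Hi; [tauto|]. rewrite pcoef_dirac0; simpl; ring.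
Qed.

Definition diag_poly (d n : nat) : coeffs := fun a =>
  match a with
  | j :: k :: r => if Nat.eq_dec (j + k) n then
      if list_eq_dec Nat.eq_dec r (zs d) then C1 else C0 else C0
  | _ => C0
  end.

Lemma diag_poly_H2 (d n : nat) :
  inH2 (S (S d)) (diag_poly d n) /\ H2sqnorm (S (S d)) (diag_poly d n) <= INR (S n).
Proof.
  apply H2sqnorm_le. intros m. rewrite rsum_box2.
  - replace (INR (S n)) with (sum_f_R0 (fun _ => 1) n) by (rewrite sum_cte; ring).
    eapply Rle_trans; [|apply (sum_truncated_le (fun _ => 1) m n); intros; lra].
    apply sum_Rle; intros i _. simpl diag_poly.
    destruct (list_eq_dec Nat.eq_dec (zs d) (zs d)); [|tauto].
    destruct (le_dec i n) as [L|L].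
    (* The range is enlarged to contain k = n - i, the only index that contributes. *)
    + apply Rle_trans with (sum_f_R0 (fun k => Csq (if Nat.eq_dec (i + k) n then C1 else C0)) (max m n)).
      * apply sum_mono; [intros; apply Csq_nonneg|lia].
      * rewrite (sum_single _ (n - i)); [|lia|].
        -- destruct (Nat.eq_dec _ n); unfold Csq; simpl; lra.
        -- intros k Hk. destruct (Nat.eq_dec _ n); [lia|]. unfold Csq; simpl; ring.
    + rewrite sum_zero; [lra|]. intros k _. destruct (Nat.eq_dec (i + k) n); [lia|].
      unfold Csq; simpl; ring.
  - intros i k a _ Ha. simpl. destruct (list_eq_dec Nat.eq_dec a (zs d)); [tauto|].
    destruct (Nat.eq_dec (i + k) n); unfold Csq; simpl; ring.
Qed.

Lemma level_diag_poly (d n k : nat) :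
  level d true (diag_poly d n) k = if Nat.eq_dec k n then RtoC (INR (S n)) else C0.
Proof.
  unfold level. destruct (Nat.eq_dec k n) as [->|Hne].
  - rewrite (Csum_ext _ (fun _ => C1)).
    + rewrite Csum_parts. apply C_eq; cbv [fst snd RtoC C1]; rewrite sum_cte; ring.
    + intros j Hj. simpl. destruct (Nat.eq_dec (j + (n - j)) n); [|lia].
      destruct (list_eq_dec Nat.eq_dec (zs d) (zs d)); tauto.
  - apply Csum_zero. intros j Hj. simpl. destruct (Nat.eq_dec (j + (k - j)) n); [lia|auto].
Qed.

(* The polynomials [sum_{j + k = n} z_1 ^ j z_2 ^ k], of norm [sqrt (n + 1)], are mapped to
   [(n + 1) z_2 ^ n]. *)
Lemma diagonal_unbounded (d : nat) : ~ comp_bounded (S (S d)) (Phi d true dirac0).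
Proof.
  intros [_ [B1 [_ [M HM]]]].
  (* A bound M would give (n + 1)^2 <= M^2 (n + 1), which fails once n > M^2. *)
  destruct (INR_ev_gt (M * M)) as [n Hn0].
  destruct (diag_poly_H2 d n) as [I1 I2]. set (f := diag_poly d n) in *.
  assert (IT : inH2 (S (S d)) (Top d true dirac0 f)).
  { apply syn_H2 with (v := fun k => if Nat.eq_dec k n then INR (S n) * INR (S n) else 0)
      (M := INR (S n) * INR (S n)).
    - intros k m. unfold f. rewrite level_diag_poly, energy_dirac0.
      destruct (Nat.eq_dec k n); [rewrite Csq_RtoC|unfold Csq; simpl]; lra.
    - intros m. destruct (le_lt_dec n m) as [L|L].
      + rewrite (sum_single _ n); auto; [destruct (Nat.eq_dec n n); [lra|tauto]|].
        intros i Hi; destruct (Nat.eq_dec i n); tauto.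
      + rewrite sum_zero; [apply Rle_0_sqr|]. intros i Hi; destruct (Nat.eq_dec i n); [lia|auto]. }
  specialize (HM f I1). specialize (B1 f I1).
  assert (Ha : length (O :: n :: zs d) = S (S d)) by (simpl; now rewrite repeat_length).
  pose proof (Cmod_le_H2norm _ _ _ B1 Ha) as Hlow.
  rewrite (comp_fun_Top d true dirac0 f dirac0_prob I1 IT _ Ha) in Hlow.
  unfold Top in Hlow. rewrite syn_eq, pcoef_dirac0 in Hlow. unfold f in Hlow at 1.
  rewrite level_diag_poly in Hlow. destruct (Nat.eq_dec n n); [|tauto].
  assert (Hn := INR_S_ge1 n).
  rewrite Cmod_mul, !Cmod_RtoC_nonneg in Hlow by (simpl dirac0; lra). simpl dirac0 in Hlow.
  assert (Hq := H2norm_sq _ _ I1). assert (Q0 := H2norm_nonneg (S (S d)) f).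
  assert (HMn := Hn0 n (Nat.le_refl _)). rewrite S_INR in *.
  set (y := INR n) in *. set (q := H2norm (S (S d)) f) in *.
  assert (E : y + 1 <= M * q) by lra.
  assert (E2 : (y + 1) * (y + 1) <= (M * q) * (M * q)) by (apply Rmult_le_compat; lra).
  replace ((M * q) * (M * q)) with ((M * M) * (q * q)) in E2 by ring.
  assert ((M * M) * (q * q) <= (M * M) * (y + 1)).
  { apply Rmult_le_compat_l; [apply Rle_0_sqr|lra]. }
  nra.
Qed.

Lemma dirac0_wt (k m : nat) : wt false k * energy dirac0 k m <= 1.
Proof. rewrite energy_dirac0; unfold wt; lra. Qed.

Lemma coordinate_bounded (d : nat) : comp_bounded (S (S d)) (Phi d false dirac0).
Proof.
  destruct (comp_agree d false dirac0 1 dirac0_prob dirac0_wt) as [WD AG].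
  split; auto. apply (bounded_op_agree _ _ _ AG).
  rewrite Top_trunc. apply trunc_bounded_op with (B := 1); [lra|].
  intros; apply dirac0_wt.
Qed.

(** z_1^k is mapped to z_2^k, so for a subsequential limit g some coefficient would be at distance
    less than 1 / 2 from both 1 and 0. *)
Lemma coordinate_not_compact (d : nat) : ~ comp_compact (S (S d)) (Phi d false dirac0).
Proof.
  destruct (comp_agree d false dirac0 1 dirac0_prob dirac0_wt) as [_ AG].
  intros [_ [[HI _] Hc]].
  set (T := comp_fun (S (S d)) (Phi d false dirac0)) in *.
  set (fs := fun k => unit_vec (k :: O :: zs d)).
  assert (If : forall k, inH2 (S (S d)) (fs k)) by (intros; apply unit_vec_H2).
  destruct (Hc fs If) as [s [Hs [g [Ig Hg]]]].
  { exists 1. intros k. rewrite <- sqrt_1. apply sqrt_le_1_alt, unit_vec_H2. }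
  assert (HT : forall k n, T (fs k) (O :: n :: zs d) = if Nat.eq_dec n k then C1 else C0).
  { intros k n. rewrite AG by (auto; simpl; now rewrite repeat_length).
    unfold Top. rewrite syn_eq, pcoef_dirac0. unfold level, fs, unit_vec.
    destruct (list_eq_dec Nat.eq_dec (n :: O :: zs d) (k :: O :: zs d)) as [E|E];
      destruct (Nat.eq_dec n k); try congruence; simpl dirac0; change (RtoC 1) with C1; ring. }
  destruct (Hg (1 / 2)) as [n0 H0]; [lra|].
  assert (Bd : forall n k, (n0 <= n)%nat ->
    Cmod (Csub (T (fs (s n)) (O :: k :: zs d)) (g (O :: k :: zs d))) < 1 / 2).
  { intros n k Hn. specialize (H0 n Hn). unfold Rdist in H0.
    rewrite Rminus_0_r, Rabs_right in H0 by (apply Rle_ge, H2norm_nonneg).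
    eapply Rle_lt_trans; [|exact H0].
    apply (Cmod_le_H2norm _ (fsub (T (fs (s n))) g)); [apply inH2_fsub; auto|].
    simpl; now rewrite repeat_length. }
  pose proof (Bd n0 (s n0) (Nat.le_refl _)) as B1.
  pose proof (Bd (S n0) (s n0) ltac:(lia)) as B2.
  rewrite HT in B1, B2. specialize (Hs n0).
  destruct (Nat.eq_dec (s n0) (s n0)); [|tauto].
  destruct (Nat.eq_dec (s n0) (s (S n0))); [lia|].
  set (y := g (O :: s n0 :: zs d)) in *.
  pose proof (Cmod_sub (Csub C1 y) (Csub C0 y)) as F.
  replace (Csub (Csub C1 y) (Csub C0 y)) with C1 in F by ring.
  rewrite Cmod_C1 in F. lra.
Qed.

(** All energies are 1, so the upper and lower estimates coincide. *)
Lemma coordinate_approx_num (d k : nat) :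
  approx_num (S (S d)) (comp_fun (S (S d)) (Phi d false dirac0)) (S k) = 1.
Proof.
  destruct (comp_agree d false dirac0 1 dirac0_prob dirac0_wt) as [_ AG].
  rewrite <- sqrt_1. apply Rle_antisym.
  - apply approx_num_upper with (b := false) (p := dirac0) (B' := 1); auto; [lra|apply dirac0_wt|].
    intros; apply dirac0_wt.
  - apply approx_num_lower with (p := dirac0); auto; [apply coordinate_bounded|lra|].
    intros j _. exists 0%nat. rewrite energy_dirac0; lra.
Qed.

Theorem theorem4p1 (N : nat) (HN : (2 <= N)%nat) :
  (exists Phi1 Phi2, analytic_self_map N Phi1 /\ analytic_self_map N Phi2 /\
     same_image N Phi1 Phi2 /\
     ~ comp_bounded N Phi1 /\
     comp_compact N Phi2 /\ beta_eq N (comp_fun N Phi2) 0) /\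
  (exists Phi1 Phi2, analytic_self_map N Phi1 /\ analytic_self_map N Phi2 /\
     same_image N Phi1 Phi2 /\
     comp_bounded N Phi1 /\ ~ comp_compact N Phi1 /\ beta_eq N (comp_fun N Phi1) 1 /\
     comp_compact N Phi2 /\ beta_eq N (comp_fun N Phi2) 0) /\
  (exists Phi1 Phi2, analytic_self_map N Phi1 /\ analytic_self_map N Phi2 /\
     same_image N Phi1 Phi2 /\
     comp_compact N Phi1 /\ beta_minus_pos N (comp_fun N Phi1) /\
     beta_plus_lt1 N (comp_fun N Phi1) /\
     comp_compact N Phi2 /\ beta_eq N (comp_fun N Phi2) 0) /\
  (exists Phi1 Phi2, analytic_self_map N Phi1 /\ analytic_self_map N Phi2 /\
     same_image N Phi1 Phi2 /\
     comp_compact N Phi1 /\ beta_eq N (comp_fun N Phi1) 1 /\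
     comp_compact N Phi2 /\ beta_eq N (comp_fun N Phi2) 0).
Proof.
  destruct N as [|[|d]]; [lia|lia|].
  assert (HNR : 1 <= INR (S d)) by apply INR_S_ge1.
  assert (HNS : INR (S (S d)) = 1 + INR (S d)) by (rewrite (S_INR (S d)); ring).
  assert (P0 : 0 < 1 / INR (S (S d))) by (apply Rdiv_lt_0_compat; lra).
  (* One fast map for each shape of the image serves all four situations; 1 / N <= 1 / 2 < 2 / 3. *)
  assert (fast : forall b, comp_compact (S (S d)) (Phi d b (logp (/ 2))) /\
    beta_eq (S (S d)) (comp_fun (S (S d)) (Phi d b (logp (/ 2)))) 0).
  { intros b. destruct (logp_comp_upper d b (/ 2)) as [CC [K [c [Hc H]]]]; [lra|].
    split; auto. apply beta_eq0 with (2 := Hc) (3 := H). split; auto.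
    apply Rle_lt_trans with (/ 2); [|apply Rinv_lt_contravar; lra].
    unfold Rdiv; rewrite Rmult_1_l. apply Rinv_le_contravar; lra. }
  assert (D0 := dirac0_prob). assert (F0 := logp_prob (/ 2) ltac:(lra)).
  split; [|split; [|split]].
  - exists (Phi d true dirac0), (Phi d true (logp (/ 2))).
    split; [|split; [|split; [|split; [|apply fast]]]];
      auto using Phi_self_map, Phi_same_image, diagonal_unbounded.
  - exists (Phi d false dirac0), (Phi d false (logp (/ 2))).
    split; [|split; [|split; [|split; [|split; [|split; [|apply fast]]]]]];
      auto using Phi_self_map, Phi_same_image, coordinate_bounded, coordinate_not_compact.
    (* All approximation numbers are 1 = exp 0. *)
    apply beta_eq1 with (s := 0) (A := 0) (B := 0); try lra.
    intros k. rewrite coordinate_approx_num, Rmult_0_l, Ropp_0, exp_0. lra.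
  - exists (Phi d false (logp (INR (S d)))), (Phi d false (logp (/ 2))).
    destruct (logp_comp_upper d false (INR (S d))) as [CC [K [c [Hc HU]]]]; [lra|].
    destruct (logp_comp_lower d (INR (S d)) HNR) as [A [HA HL]].
    assert (F1 := logp_prob (INR (S d)) ltac:(lra)).
    destruct (beta_strict (S (S d)) (comp_fun (S (S d)) (Phi d false (logp (INR (S d))))) A K c)
      as [B1 B2]; auto; [lia| |].
    + intros k. unfold Rdiv. rewrite Rmult_1_l, HNS. auto.
    + split; [|split; [|split; [|split; [|split; [|split; [|apply fast]]]]]];
        auto using Phi_self_map, Phi_same_image.
  - exists (Phi d false (logp (INR (S (S d))))), (Phi d false (logp (/ 2))).
    destruct (logp_comp_upper d false (INR (S (S d)))) as [CC [K [c [Hc HU]]]]; [lra|].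
    destruct (logp_comp_lower d (INR (S (S d)))) as [A [HA HL]]; [lra|].
    assert (F1 := logp_prob (INR (S (S d))) ltac:(lra)).
    set (s := / (1 + INR (S (S d)))) in *.
    assert (Hs : 0 < s) by (apply Rinv_0_lt_compat; lra).
    split; [|split; [|split; [|split; [|split; [|apply fast]]]]];
      auto using Phi_self_map, Phi_same_image.
    (* Here s = 1 / (N + 1) < 1 / N; from the upper estimate only the constant exp K is kept. *)
    apply beta_eq1 with (s := s) (A := A) (B := K); auto.
    + split; [lra|]. unfold s, Rdiv. rewrite Rmult_1_l. apply Rinv_lt_contravar; nra.
    + intros k. split; auto. eapply Rle_trans; [apply HU|]. apply exp_le.
      pose proof (npow_ge1 s k ltac:(lra)). nra.
Qed.
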